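(* For all integers $l\ge0$, as identities of formal power series in $x=(x_1,x_2,\ldots)$, $y=(y_1,y_2,\ldots)$: $$\sum_{\ell(\lambda)\le2l}\tilde s_\lambda(x)\tilde s_\lambda(y)=\mathrm{E}_{U\in U^{UU}(2l)}\det(H(U;x)H(U^\dagger;y)),$$ $$\sum_{\ell(\lambda)\le l}\tilde s_{2\lambda^2}(x)=\mathrm{E}_{U\in U^{u}(2l)}\det(H(U;x)).$$
   Context: $s_\lambda$ are Schur functions and $\ell(\lambda)$ is the number of parts of $\lambda$. For a partition $\lambda$ with trivial 2-core and 2-quotient $(\lambda^{(0)},\lambda^{(1)})$, set $\tilde s_\lambda(x)=s_{\lambda^{(0)}}(x)s_{\lambda^{(1)}}(x)$; if $\lambda$ has nontrivial 2-core, $\tilde s_\lambda(x)=0$. $2\lambda^2$ is the partition $(2\lambda_1,2\lambda_1,2\lambda_2,2\lambda_2,\ldots)$. $H(u;x)=\prod_j(1-ux_j)^{-1}$, so $\det(H(U;x))=\prod_j\det(1-x_jU)^{-1}$. With $J=\begin{pmatrix} 0 & -I_l \\ I_l & 0 \end{pmatrix}$, $U^{UU}(2l)$ is the subgroup of $U(2l)$ of matrices commuting with $J$; it is isomorphic to $U(l)\times U(l)$, and is conjugate in $U(2l)$ to the block-diagonal subgroup $U(l)\oplus U(l)$. $U^{u}(2l)=O(2l)\cap Sp(2l)$ is the group of real orthogonal matrices commuting with $J$; it is isomorphic to $U(l)$, the $2l$-dimensional representation being the direct sum of the fundamental representation of $U(l)$ and its conjugate. $\mathrm{E}_{U\in G}$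 is integration against normalized Haar measure, applied term by term after formal expansion in the variables. *)

(* Defs.v *)
From mathcomp Require Import all_boot all_order all_algebra.
From mathcomp Require Import finmap complex.
From mathcomp Require Import all_classical all_reals all_analysis.
Import Order.TTheory GRing.Theory Num.Theory.
Import numFieldNormedType.Exports.

Set Implicit Arguments.
Unset Strict Implicit.
Unset Printing Implicit Defensive.

Local Open Scope classical_set_scope.
Local Open Scope ring_scope.

Definition is_part (la : seq nat) : bool := sorted geq la && (0%N \notin la).

Definition dbl_part (la : seq nat) : seq nat :=
  flatten [seq [:: p.*2; p.*2] | p <- la].

(* 2-cores and 2-quotients as in Macdonald, Symmetric Functions and Hall
   Polynomials, I.1, Ex. 8: for m >= l(la), the m numbers la_i + m - i are
   sorted by residue mod 2, and the residues' quotients are again beta-numbers.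
   Taking m even makes the quotient independent of m. *)
Definition beta_set (m : nat) (la : seq nat) : seq nat :=
  mkseq (fun i => nth 0 la i + (m - i.+1))%N m.

Definition part_of_beta (B : seq nat) : seq nat :=
  [seq p <- mkseq (fun i => nth 0 B i - (size B - i.+1))%N (size B) | p != 0%N].

Definition beta_runner (r : bool) (la : seq nat) : seq nat :=
  [seq b./2 | b <- beta_set (size la).*2 la & odd b == r].

Definition two_quotient (r : bool) (la : seq nat) : seq nat :=
  part_of_beta (beta_runner r la).

Definition two_core (la : seq nat) : seq nat :=
  part_of_beta (sort geq
    ([seq s.*2 | s <- iota 0 (size (beta_runner false la))] ++
     [seq s.*2.+1 | s <- iota 0 (size (beta_runner true la))])).

(* a : monom stands for the monomial \prod_j x_j ^ (a j) in x_0, x_1, x_2, ... *)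
Definition monom : Type := {fsfun nat -> nat with 0%N}.

(* A series in x is a function [monom -> C]; a series in x and y is a function
   [monom * monom -> C]. *)
Section FormalSeries.
Variable C : comNzRingType.

Definition fps_mul (f g : monom -> C) (a : monom) : C :=
  \sum_(bc \in [set bc : monom * monom | forall j, (bc.1 j + bc.2 j)%N = a j])
    f bc.1 * g bc.2.

(* f(x) g(y) *)
Definition fps_xy (f g : monom -> C) (ab : monom * monom) : C :=
  f ab.1 * g ab.2.

(* The family (F la), la in P, is summable, with sum S. *)
Definition fps_has_sum (K : Type) (P : set (seq nat))
    (F : seq nat -> K -> C) (S : K -> C) : Prop :=
  forall a, finite_set (P `&` [set la | F la a <> 0]) /\
            \sum_(la \in P) F la a = S a.

(* T is the list of the rows of a semistandard Young tableau of shape la with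
   entries in nat. *)
Definition is_ssyt (la : seq nat) (T : seq (seq nat)) : bool :=
  [&& shape T == la, all (sorted leq) T &
      sorted (fun r s : seq nat =>
                [forall j : 'I_(size s), nth 0 r j < nth 0 s j])%N T].

(* s_la = \sum_T x^T over semistandard tableaux T of shape la *)
Definition schur (la : seq nat) (a : monom) : C :=
  \sum_(T \in [set T : seq (seq nat) |
                 is_ssyt la T /\ forall j, count_mem j (flatten T) = a j]) (1 : C).

Definition schur_tilde (la : seq nat) : monom -> C :=
  if two_core la == [::] then
    fps_mul (schur (two_quotient false la)) (schur (two_quotient true la))
  else fun=> 0.

(* The coefficient of u^k in 1 / det(1 - u U): a power series p in u with
   constant term 1 has inverse \sum_i (1 - p)^i, whose terms with i > k do not
   contribute to the coefficient of u^k. *)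
Definition inv_det_coef (n : nat) (U : 'M[C]_n) (k : nat) : C :=
  (\sum_(i < k.+1) (1 - \det (1%:M - 'X *: map_mx polyC U)) ^+ i)`_k.

(* det H(U; x) = \prod_j 1 / det(1 - x_j U) *)
Definition detH (n : nat) (U : 'M[C]_n) (a : monom) : C :=
  \prod_(j <- finsupp a) inv_det_coef U (a j).

End FormalSeries.

Definition Cplx (R : realType) : numClosedFieldType := R[i].

(* The n x n complex matrices with their Borel sigma-algebra. *)
Notation borel_mx R n := (g_sigma_algebraType (@open 'M[Cplx R]_n)).

Section Haar.
Variables (R : realType) (n : nat).
Local Notation C := (Cplx R).

(* A Haar measure on G is represented by a Borel probability measure on all
   n x n complex matrices which is carried by G. *)
Definition is_haar (G : set 'M[C]_n) (mu : probability (borel_mx R n) R) : Prop :=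
  mu G = 1%E /\
  forall g, G g -> forall A : set (borel_mx R n), measurable A ->
    mu [set g *m U | U in A] = mu A.

Definition expect_fps (G : set 'M[C]_n) (mu : probability (borel_mx R n) R)
    (K : Type) (F : 'M[C]_n -> K -> C) (a : K) : C :=
  Complex (\int[mu]_(U in G) complex.Re (F U a))
          (\int[mu]_(U in G) complex.Im (F U a)).

End Haar.

Section Groups.
Variables (R : realType) (l : nat).
Local Notation C := (Cplx R).

Definition Jmx : 'M[C]_(l + l) := block_mx 0 (- 1%:M) 1%:M 0.

Definition UU_group : set 'M[C]_(l + l) :=
  [set U | U \is unitarymx /\ U *m Jmx = Jmx *m U].

(* U^u(2l) = O(2l) :&: Sp(2l): for U orthogonal, U^T J U = J says that U commutes
   with J. *)
Definition Uu_group : set 'M[C]_(l + l) :=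
  [set U | [/\ U \is a mxOver Num.real, U *m U^T = 1%:M
             & U *m Jmx = Jmx *m U]].

End Groups.

Arguments UU_group : clear implicits.
Arguments Uu_group : clear implicits.

(* Main.v *)
(* Matrices commuting with J are simultaneously conjugate to diag(V1, V2), with V1
   and V2 unitary of size l, and V2 = conj V1 if the matrix is real. Hence
   det H(U; x) = det H(V1; x) det H(V2; x), and both identities reduce to the
   orthogonality relation
     E_V[det H(V; x) conj(det H(V; y))] = sum_{l(la) <= l} s_la(x) s_la(y)
   on U(l), since la |-> (la^(0), la^(1)) is a bijection from the partitions with
   at most 2l parts and trivial 2-core to the pairs of partitions with at most l
   parts, sending 2la^2 to (la, la).

   The orthogonality relation is proved for every left-invariant linear functional
   on the polynomial functions, which covers both factors of U(l) x U(l) one at a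
   time. Differentiating the invariance gives Schwinger-Dyson equations for the
   moments of the coefficients of det(1 - X V); these equations determine the
   moments, and the average over diagonal matrices with root of unity entries,
   weighted by the squared Vandermonde determinant, satisfies them too. This is
   Weyl's integration formula, and under it the Pieri rule for alternants turns
   det H into a sum of Schur functions, paired by orthogonality of characters of
   the finite torus. *)

Require Import Defs.
From mathcomp Require Import all_boot all_order all_algebra.
From mathcomp Require Import finmap complex.
From mathcomp Require Import all_classical all_reals all_analysis.
From mathcomp Require Import measurable_realfun fingroup perm.
From mathcomp Require cyclic separable cyclotomic.
From mathcomp Require Import ring lra zify.
Import Order.TTheory GRing.Theory Num.Theory.
Import numFieldNormedType.Exports.

Set Implicit Arguments.
Unset Strict Implicit.
Unset Printing Implicit Defensive.

Local Open Scope classical_set_scope.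
Local Open Scope ring_scope.

(** * Elementary symmetric coefficients *)

(** On unitary matrices conj(c_r) = c_(n-r) conj(c_n), so every class function at hand is a
    combination of monomials in the coefficients c_r times a power of conj(c_n), which is conj(det)
    up to sign. Only this power is not polynomial in the entries, and it is a character: along w |->
    (1 + (w - 1) P) U, with P a rank one orthogonal projection and |w| = 1, it is multiplied by
    conj(w)^k. Everything else is polynomial in w, so invariance says that a polynomial in w equals
    a constant times w^k on the circle, and differentiating under the integral amounts to comparing
    coefficients. The same argument works on a grid of roots of unity of order larger than all
    degrees involved, which is why a finite torus can replace the continuous one. The equations
    determine the moments because, for k > 0, the one for an index r leaves the factor (n - r)(r +
    k) once the moments with a larger index are known, and this is nonzero for r < n. The index n
    itself is removed by c_n conj(c_n) = 1, which lowers k. *)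

Section LogDerivation.
Variables (R : comNzRingType) (I : eqType).

Lemma deriv_prod_seq (s : seq I) (F : I -> {poly R}) : uniq s ->
  (\prod_(i <- s) F i)^`() =
  \sum_(i <- s) (F i)^`() * \prod_(j <- s | j != i) F j.
Proof.
elim: s => [|x s IHs] /=; first by rewrite !big_nil derivC.
case/andP=> xs us; rewrite !big_cons derivM IHs // eqxx /=.
congr (_ + _).
  congr (_ * _); rewrite [LHS]big_seq [RHS]big_seq_cond; apply: eq_bigl => j.
  by case: (boolP (j \in s)) => //= js; apply/esym; apply: contraNneq xs => <-.
rewrite mulr_sumr; apply: eq_big_seq => j js.
rewrite big_cons ifT; last by apply: contraNneq xs => ->.
by rewrite mulrCA.
Qed.

End LogDerivation.

Section ElementaryCoefficients.
Variables (C : fieldType) (n : nat).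
Implicit Types (A : pred 'I_n) (z : 'I_n -> C).

(** With [A] full and [z] the eigenvalues of U this is det(1 - X U), whose coefficients are signed
    elementary symmetric functions. The predicate [A] allows variables to be left out. *)
Definition psi A z : {poly C} := \prod_(i | A i) (1 - z i *: 'X).

Definition psi_coef A z r : C := (psi A z)`_r.

Definition omit j A : pred 'I_n := [pred i | A i && (i != j)].

Lemma psiD1 A z j : A j -> psi A z = (1 - z j *: 'X) * psi (omit j A) z.
Proof. by move=> Aj; rewrite /psi (bigD1 j). Qed.

Lemma psi_coef0 A z : psi_coef A z 0 = 1.
Proof.
rewrite /psi_coef -horner_coef0 /psi horner_prod big1 // => i _.
by rewrite !(hornerD, hornerN, hornerZ, hornerX, hornerC) mulr0 subr0.
Qed.

Lemma psi_coefS A z j r : A j ->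
  psi_coef A z r.+1 =
  psi_coef (omit j A) z r.+1 - z j * psi_coef (omit j A) z r.
Proof.
move=> Aj; rewrite /psi_coef (psiD1 _ Aj) mulrBl mul1r -scalerAl coefB coefZ.
by rewrite coefXM.
Qed.

(** Without the factor j the product is [psi A z] plus z_j X times itself, and the terms z_j
    [psi (omit j A) z] add up to minus the derivative. *)
Lemma sum_psi_omit A z :
  \sum_(j | A j) psi (omit j A) z = #|A|%:R * psi A z - 'X * (psi A z)^`().
Proof.
have -> : (psi A z)^`() = \sum_(j | A j) - (z j)%:P * psi (omit j A) z.
  rewrite /psi -big_filter deriv_prod_seq ?filter_uniq ?index_enum_uniq //.
  rewrite big_filter; apply: eq_bigr => j Aj; rewrite big_filter_cond.
  by rewrite derivB derivZ derivC derivX sub0r alg_polyC.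
rewrite mulr_natl -sumr_const mulr_sumr -sumrB; apply: eq_bigr => j Aj.
rewrite (psiD1 _ Aj) -mul_polyC; ring.
Qed.

Lemma sum_psi_coef_omit A z r :
  \sum_(j | A j) psi_coef (omit j A) z r = (#|A|%:R - r%:R) * psi_coef A z r.
Proof.
rewrite /psi_coef -coef_sum sum_psi_omit coefB mulr_natl coefMn coefXM.
rewrite coef_deriv mulrBl !mulr_natl; case: r => [|r] //=.
Qed.

Lemma size_psi A z : (size (psi A z) <= #|A|.+1)%N.
Proof.
have h1 i : (size (1 - z i *: 'X : {poly C})%R <= 2)%N.
  apply: leq_trans (size_polyD _ _) _; rewrite geq_max size_poly1 /= size_polyN.
  by apply: leq_trans (size_scale_leq _ _) _; rewrite size_polyX.
apply: leq_trans (size_prod_leq _ _) _.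
have : (\sum_(i | A i) size (1 - z i *: 'X : {poly C})%R <= \sum_(i | A i) 2)%N.
  exact: leq_sum.
rewrite sum_nat_const => le2; rewrite leq_subLR addnS ltnS addnn -muln2; exact: le2.
Qed.

Lemma psi_coef_gt A z r : (#|A| < r)%N -> psi_coef A z r = 0.
Proof.
move=> rA; rewrite /psi_coef nth_default //.
exact: leq_trans (size_psi _ _) _.
Qed.

Lemma psi_coef_sum A z r : psi_coef A z r =
  (-1) ^+ r * \sum_(J : {set 'I_n} | (J \subset A) && (#|J| == r)) \prod_(i in J) z i.
Proof.
rewrite /psi_coef /psi.
under eq_bigr do rewrite addrC -scaleNr.
have -> : \prod_(i | A i) (- z i *: 'X + 1) =
   \sum_(J : {set 'I_n} | J \subset A)  (\prod_(i in J) - z i) *: 'X ^+ #|J| :> {poly C}.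
  rewrite big_mkcond /=.
  have -> : \prod_(i < n) (if A i then - z i *: 'X + 1 else 1) =
    \prod_(i < n) ((if A i then - z i *: 'X else 0) + 1) :> {poly C}.
    by apply: eq_bigr => i _; case: ifP => // _; rewrite add0r.
  rewrite bigA_distr /= (bigID (fun J : {set 'I_n} => J \subset A)) /=.
  rewrite [X in _ + X]big1 ?addr0; last first.
    move=> J /subsetPn[i iJ iA]; rewrite (bigD1 i) //= iJ.
    by move: iA; rewrite unfold_in => /negbTE ->; rewrite mul0r.
  apply: eq_bigr => J /fintype.subsetP JA.
  rewrite -big_mkcond /= -prodr_const -scaler_prod.
  by apply: eq_bigr => i iJ; have := JA _ iJ; rewrite unfold_in => ->.
rewrite coef_sum mulr_sumr big_mkcondr /=.
apply: eq_bigr => J _; rewrite coefZ coefXn [r == _]eq_sym.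
case: eqP => [<-|]; last by rewrite mulr0.
by rewrite mulr1 -prodrN.
Qed.

End ElementaryCoefficients.

(** Unfolded, this is the sum over i < s of (s - i) F(r + i, s - i) - (r + i + 1) F(r + i + 1, s - i
    - 1). With F(a, b) = c_a c_b it is the pairing of the gradients of c_r and c_s. [F] is left
    abstract so that moments can take the place of the products. *)
Fixpoint Gam (C : pzRingType) (F : nat -> nat -> C) (r s : nat) : C :=
  if s is s'.+1 then
    s%:R * F r s - r.+1%:R * F r.+1 s' + Gam F r.+1 s'
  else 0.

Section DiagonalDerivatives.
Variables (C : fieldType) (n : nat).
Implicit Types (z : 'I_n -> C).

Local Notation coef z := (psi_coef predT z).

(* z_j d/dz_j applied to the coefficient of X^r in \prod_j (1 - z_j X) *)
Definition dpsi z j r : C := coef z r - psi_coef (omit j predT) z r.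

Lemma dpsi0 z j : dpsi z j 0 = 0.
Proof. by rewrite /dpsi !psi_coef0 subrr. Qed.

Lemma dpsiS z j r : dpsi z j r.+1 = - z j * psi_coef (omit j predT) z r.
Proof. by rewrite /dpsi (@psi_coefS _ _ predT z j) //; ring. Qed.

Lemma card_omit (A : pred 'I_n) j : A j -> #|omit j A| = #|A|.-1.
Proof.
move=> Aj; rewrite (cardD1 j A) unfold_in Aj /=.
by apply: eq_card => i; rewrite !unfold_in /= andbC.
Qed.

Lemma sum_dpsi z r : \sum_j dpsi z j r = r%:R * coef z r.
Proof.
rewrite sumrB sumr_const (@sum_psi_coef_omit _ _ predT) -mulr_natl card_ord.
ring.
Qed.

(** With d for [dpsi], both (c_r - d_r) d_(s+1) and d_(r+1) (c_s - d_s) equal -z_j (c_r - d_r)(c_s -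
    d_s). Iterating moves units from s to r, which is the recursion of [Gam]. *)
Lemma dpsi_mul z j r s : dpsi z j r * dpsi z j s.+1 =
  coef z r * dpsi z j s.+1 - dpsi z j r.+1 * coef z s +
  dpsi z j r.+1 * dpsi z j s.
Proof. by rewrite !dpsiS /dpsi; ring. Qed.

Lemma sum_dpsi_mul z r s :
  \sum_j dpsi z j r * dpsi z j s =
  Gam (fun a b => coef z a * coef z b) r s.
Proof.
elim: s r => [|s IHs] r /=; first by rewrite big1 // => j _; rewrite dpsi0 mulr0.
under eq_bigr do rewrite dpsi_mul.
rewrite big_split sumrB -mulr_sumr -mulr_suml !sum_dpsi IHs /=; ring.
Qed.

(** The vector field with components [dpsi z j r] along z_j d/dz_j sends the factor z_j - z_m of the
    discriminant to a polynomial multiple of itself. *)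
Lemma dpsi_sub z j m r : j != m -> z j * dpsi z j r - z m * dpsi z m r =
  (z j - z m) * (coef z r - psi_coef (omit m (omit j predT)) z r).
Proof.
move=> jm; have mj : omit j predT m by rewrite /omit /= eq_sym.
have jm' : omit m predT j by [].
case: r => [|r]; first by rewrite !dpsi0 !psi_coef0; ring.
rewrite !dpsiS.
rewrite (@psi_coefS _ _ predT z j) // (psi_coefS _ _ mj).
have com : psi (omit j (omit m predT)) z = psi (omit m (omit j predT)) z.
  by apply: eq_bigl => i; rewrite /omit /= andbC.
case: r => [|r]; first by rewrite !psi_coef0; ring.
rewrite (psi_coefS _ _ mj).
rewrite (psi_coefS _ _ jm').
rewrite /psi_coef com; ring.
Qed.

Lemma sum_psi_coef_omit2 z r :
  \sum_j \sum_(m | m != j) (coef z r - psi_coef (omit m (omit j predT)) z r) =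
  (n%:R * (n%:R - 1) - (n%:R - r%:R) * (n%:R - 1 - r%:R)) * coef z r.
Proof.
have H j : \sum_(m | m != j) (coef z r - psi_coef (omit m (omit j predT)) z r)
   = (n%:R - 1) * coef z r - (n%:R - 1 - r%:R) * psi_coef (omit j predT) z r.
  have cj : #|omit j (@predT 'I_n)|%:R = n%:R - 1 :> C.
    rewrite card_omit // card_ord; case: n j => [[]//|k] _.
    by rewrite -natr1 addrK.
  rewrite sumrB; congr (_ - _).
    by rewrite sumr_const -cj mulr_natl; congr (_ *+ _); apply: eq_card.
  by rewrite -cj; apply: (@sum_psi_coef_omit _ _ (omit j predT)).
rewrite (eq_bigr _ (fun j _ => H j)) sumrB sumr_const -mulr_sumr.
rewrite (@sum_psi_coef_omit _ _ predT) -mulr_natl card_ord; ring.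
Qed.

End DiagonalDerivatives.

(** On the unit circle the conjugate of a product over J is the product over the complement of J
    times the conjugate of the full product; complementation exchanges r and n - r. *)
Lemma conj_psi_coef (C : numClosedFieldType) n (z : 'I_n -> C) r :
  (forall j, z j * (z j)^* = 1) -> (r <= n)%N ->
  (psi_coef predT z r)^* =
  psi_coef predT z (n - r) * (psi_coef predT z n)^*.
Proof.
move=> z1 rn.
have top : psi_coef predT z n = (-1) ^+ n * \prod_i z i.
  rewrite psi_coef_sum (big_pred1 [set: 'I_n]%SET) => [|J].
    by congr (_ * _); apply: eq_bigl => i; rewrite inE.
  have Jn : (#|J| <= n)%N by rewrite -[X in (_ <= X)%N]card_ord max_card.
  rewrite (introT fintype.subsetP) => [|i _]; last by rewrite inE.
  by rewrite /= eqEcard finset.subsetT cardsT card_ord eqn_leq Jn.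
rewrite top !psi_coef_sum !rmorphM !rmorphXn /= rmorphN1 rmorph_sum /=.
have -> : (-1) ^+ r = (-1) ^+ (n - r) * (-1) ^+ n :> C.
  by rewrite -exprD -[LHS]signr_odd -[RHS]signr_odd oddD oddB // addbAC addbb.
rewrite mulrACA rmorph_prod /=; congr (_ * _).
rewrite mulr_suml (reindex_inj (@finset.setC_inj 'I_n)) /=.
apply: eq_big => [J|J _].
  have sT (K : {set 'I_n}) : K \subset predT by apply/fintype.subsetP.
  have := cardsC J; rewrite !sT card_ord /=.
  move: #|_| #|_| => a b ab; apply/eqP/eqP; lia.
rewrite rmorph_prod /= [X in _ = _ * X](bigID (mem J)) /= mulrA -big_split /=.
rewrite [X in _ = X * _]big1 => [|i _]; last exact: z1.
by rewrite mul1r; apply: eq_bigl => i; rewrite inE.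
Qed.

(** * Characteristic polynomials of unitary matrices *)

Section UnitaryCoefficients.
Variables (C : numClosedFieldType) (n : nat).
Local Notation M := 'M[C]_n.
Local Open Scope sesquilinear_scope.

Definition char_coef m (U : 'M[C]_m) r : C :=
  (\det (1%:M - 'X *: map_mx polyC U))`_r.

Lemma char_coef_similar (P Q D : M) r : P *m Q = 1%:M ->
  char_coef (Q *m D *m P) r = char_coef D r.
Proof.
move=> PQ; have QP := mulmx1C PQ; rewrite /char_coef; congr ((_ : {poly C})`_r).
have -> : 1%:M - 'X *: map_mx polyC (Q *m D *m P) =
    map_mx polyC Q *m (1%:M - 'X *: map_mx polyC D) *m map_mx polyC P.
  rewrite mulmxBr mulmxBl mulmx1 -map_mxM QP map_mx1 !map_mxM /=.
  by rewrite -scalemxAr -scalemxAl.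
by rewrite !det_mulmx mulrAC -det_mulmx -map_mxM QP map_mx1 det1 mul1r.
Qed.

Lemma char_coef_diag (z : 'rV[C]_n) r :
  char_coef (diag_mx z) r = psi_coef predT (z 0) r.
Proof.
rewrite /char_coef /psi_coef; congr ((_ : {poly C})`_r).
have -> : 1%:M - 'X *: map_mx polyC (diag_mx z) =
    diag_mx (\row_j (1 - z 0 j *: 'X)).
  apply/matrixP => i j; rewrite !mxE; case: eqP => [->|_] /=.
    by rewrite !mulr1n mulrC mul_polyC.
  by rewrite !mulr0n polyC0 mulr0 subrr.
by rewrite det_diag /psi; apply: eq_big => // j _; rewrite mxE.
Qed.

Lemma unitary_diagonalize (U : M) : U \is unitarymx ->
  exists (P : M) (z : 'rV[C]_n), [/\ P \is unitarymx, U = P^t* *m diag_mx z *m P &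
               forall j, z 0 j * (z 0 j)^* = 1].
Proof.
move=> Uu; have UUt : U *m U^t* = 1%:M := unitarymxP Uu.
have /orthomx_spectralP UE : U \is normalmx.
  by apply/normalmxP; rewrite UUt (mulmx1C UUt).
set P := spectralmx U in UE.
have Pu : P \is unitarymx := spectral_unitarymx U.
have Pi := invmx_unitary Pu; rewrite Pi in UE.
have PP := unitarymxP Pu; have PP' := mulmx1C PP.
exists P, (spectral_diag U); split=> // j; set z := spectral_diag U.
have : diag_mx z *m (diag_mx z)^t* = 1%:M.
  have -> : diag_mx z = P *m U *m P^t*.
    by rewrite UE !mulmxA PP mul1mx -mulmxA PP mulmx1.
  rewrite !trmx_mul !map_mxM trmxCK !mulmxA mulmxKtV //.
  by rewrite -(mulmxA P) UUt mulmx1 PP.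
move/matrixP/(_ j j); rewrite !mxE (bigD1 j) //= big1 ?addr0 => [|k kj].
  by rewrite !mxE eqxx !mulr1n.
by rewrite !mxE [j == k]eq_sym (negbTE kj) mulr0n mul0r.
Qed.

(** G_r is the gradient of c_r: the derivative of c_r along U |-> A U is tr(A G_r), see
    [hder_char_coef]. The recursion is the one satisfied by [dpsi] on diagonal matrices. *)
Fixpoint grad_coef (U : M) r : M :=
  if r is r'.+1 then - U *m ((char_coef U r')%:M - grad_coef U r') else 0.

Lemma grad_coefS U r :
  grad_coef U r.+1 = - U *m ((char_coef U r)%:M - grad_coef U r).
Proof. by []. Qed.

Arguments grad_coef : simpl never.

Lemma grad_coef_similar (P Q D : M) r : P *m Q = 1%:M ->
  grad_coef (Q *m D *m P) r = Q *m grad_coef D r *m P.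
Proof.
move=> PQ; have QP := mulmx1C PQ; elim: r => [|r IHr].
  by rewrite /grad_coef mulmx0 mul0mx.
rewrite !grad_coefS IHr char_coef_similar // !mulNmx mulmxN mulNmx; congr (- _).
rewrite !mulmxBr mulmxBl !mulmxA; congr (_ - _).
  by rewrite !mul_mx_scalar -scalemxAl.
by congr (_ *m _); rewrite -!mulmxA; congr (_ *m (_ *m _)); rewrite mulmxA PQ mul1mx.
Qed.

Lemma grad_coef_diag (z : 'rV[C]_n) r :
  grad_coef (diag_mx z) r = diag_mx (\row_j dpsi (z 0) j r).
Proof.
elim: r => [|r IHr].
  by apply/matrixP => i j; rewrite !mxE dpsi0 mul0rn.
rewrite grad_coefS IHr mulNmx mul_diag_mx; apply/matrixP => i j; rewrite !mxE char_coef_diag.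
case: eqP => [->|_] /=; last by rewrite !mulr0n subrr mulr0 oppr0.
by rewrite !mulr1n dpsiS /dpsi; ring.
Qed.

Lemma tr_grad_coef (U : M) r : U \is unitarymx ->
  \tr (grad_coef U r) = r%:R * char_coef U r.
Proof.
move=> /unitary_diagonalize[P [z [/unitarymxP PP -> _]]].
rewrite grad_coef_similar // char_coef_similar // mxtrace_mulC mulmxA PP mul1mx.
rewrite grad_coef_diag char_coef_diag mxtrace_diag -sum_dpsi.
by apply: eq_bigr => j _; rewrite mxE.
Qed.

Lemma char_coef_gt (U : M) r : U \is unitarymx -> (n < r)%N -> char_coef U r = 0.
Proof.
move=> /unitary_diagonalize[P [z [/unitarymxP PP -> _]]] nr.
by rewrite char_coef_similar // char_coef_diag psi_coef_gt // card_ord.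
Qed.

Lemma char_coef0 (U : M) : U \is unitarymx -> char_coef U 0 = 1.
Proof.
move=> /unitary_diagonalize[P [z [/unitarymxP PP -> _]]].
by rewrite char_coef_similar // char_coef_diag psi_coef0.
Qed.

Lemma conj_char_coef (U : M) r : U \is unitarymx -> (r <= n)%N ->
  (char_coef U r)^* = char_coef U (n - r) * (char_coef U n)^*.
Proof.
move=> /unitary_diagonalize[P [z [/unitarymxP PP -> z1]]] rn.
by rewrite !char_coef_similar // !char_coef_diag conj_psi_coef.
Qed.

Lemma char_coef_top (U : M) : U \is unitarymx ->
  char_coef U n = (-1) ^+ n * \det U.
Proof.
move=> /unitary_diagonalize[P [z [/unitarymxP PP -> z1]]].
rewrite char_coef_similar // char_coef_diag !det_mulmx mulrAC -det_mulmx.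
rewrite (mulmx1C PP) det1 mul1r det_diag psi_coef_sum.
rewrite (big_pred1 [set: 'I_n]%SET) => [|J].
  by congr (_ * _); apply: eq_bigl => i; rewrite inE.
have Jn : (#|J| <= n)%N by rewrite -[X in (_ <= X)%N]card_ord max_card.
rewrite (introT fintype.subsetP) => [|i _]; last by rewrite inE.
by rewrite /= eqEcard finset.subsetT cardsT card_ord eqn_leq Jn.
Qed.

Lemma grad_coef_comm (U : M) r : U *m grad_coef U r = grad_coef U r *m U.
Proof.
elim: r => [|r IHr]; first by rewrite mulmx0 mul0mx.
rewrite grad_coefS !mulNmx mulmxN -mulmxA; congr (- (_ *m _)).
by rewrite mulmxBl mulmxBr scalar_mxC IHr.
Qed.

(** The matrix form of [dpsi_mul]: as G_r commutes with U, both sides of [key] are -U (c_r -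
    G_r)(c_s - G_s). *)
Lemma grad_coef_mul (U : M) r s : grad_coef U r *m grad_coef U s.+1 =
  char_coef U r *: grad_coef U s.+1 - char_coef U s *: grad_coef U r.+1 +
  grad_coef U r.+1 *m grad_coef U s.
Proof.
have key : ((char_coef U r)%:M - grad_coef U r) *m grad_coef U s.+1 =
    grad_coef U r.+1 *m ((char_coef U s)%:M - grad_coef U s).
  rewrite !grad_coefS mulmxA; congr (_ *m _).
  by rewrite mulNmx mulmxN mulmxBr mulmxBl grad_coef_comm scalar_mxC.
move: key; rewrite mulmxBl mul_scalar_mx mulmxBr mul_mx_scalar => key.
by rewrite -[LHS](subKr (char_coef U r *: grad_coef U s.+1)) key opprB addrCA addrC.
Qed.

Lemma tr_grad_coef_mul (U : M) r s : U \is unitarymx ->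
  \tr (grad_coef U r *m grad_coef U s) =
  Gam (fun a b => char_coef U a * char_coef U b) r s.
Proof.
move=> Uu; elim: s r => [|s IHs] r /=; first by rewrite mulmx0 mxtrace0.
rewrite grad_coef_mul mxtraceD linearB /= !mxtraceZ !tr_grad_coef //.
by rewrite IHs; ring.
Qed.

Lemma grad_coef_expand (U : M) t :
  grad_coef U t = - \sum_(i < t) char_coef U (t - i.+1) *: U ^+ i.+1.
Proof.
elim: t => [|t IHt]; first by rewrite big_ord0 oppr0.
rewrite grad_coefS big_ord_recl {}IHt subn1 /= mulNmx mulmxBr mul_mx_scalar.
rewrite mulmxN opprK mulmx_sumr expr1.
rewrite (eq_bigr (fun i : 'I_t => char_coef U (t - i.+1) *: U ^+ i.+2)) //.
by move=> i _; rewrite [U ^+ i.+2]exprS -scalemxAr.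
Qed.

Lemma char_coef_newton (U : M) t : U \is unitarymx -> t%:R * char_coef U t =
  - \sum_(i < t) \tr (U ^+ i.+1) * char_coef U (t - i.+1).
Proof.
move=> Uu; rewrite -tr_grad_coef // grad_coef_expand (raddfN (@mxtrace C n)) (raddf_sum (@mxtrace C n)).
by congr (- _); apply: eq_bigr => i _; rewrite /= mxtraceZ mulrC.
Qed.

(* r G_r in terms of the power sums tr(U^i): the logarithmic derivative of
   det(1 - X U) *)
Lemma grad_coef_newton (U : M) r : U \is unitarymx ->
  r%:R *: grad_coef U r =
  - \sum_(i < r) (\tr (U ^+ i.+1) *: grad_coef U (r - i.+1) +
                  (i.+1%:R * char_coef U (r - i.+1)) *: U ^+ i.+1).
Proof.
move=> Uu.
elim: r => [|r IHr]; first by rewrite big_ord0 scale0r oppr0.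
rewrite big_split /= [X in X + _]big_ord_recr /= subnn scaler0 addr0.
have -> : \sum_(i < r) \tr (U ^+ i.+1) *: grad_coef U (r.+1 - i.+1) =
   U *m (r%:R * char_coef U r)%:M +
   U *m \sum_(i < r) \tr (U ^+ i.+1) *: grad_coef U (r - i.+1).
  rewrite char_coef_newton // mul_mx_scalar scaleNr mulmx_sumr scaler_suml -sumrN -big_split /=.
  apply: eq_bigr => i _; rewrite subSS -{1}(subnSK (ltn_ord i)) /=.
  rewrite grad_coefS mulNmx scalerN mulmxBr mul_mx_scalar scalerBr scalerA -scalemxAr.
  by rewrite opprB addrC.
have -> : \sum_(i < r.+1) (i.+1%:R * char_coef U (r.+1 - i.+1)) *: U ^+ i.+1 =
   U *m (char_coef U r)%:M +
   U *m \sum_(i < r) (i.+1%:R * char_coef U (r - i.+1)) *: U ^+ i.+1 - U *m grad_coef U r.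
  rewrite big_ord_recl subn1 mul1r mul_mx_scalar -addrA; congr (_ + _).
  rewrite grad_coef_expand mulmxN opprK !mulmx_sumr -big_split /=.
  apply: eq_bigr => i _; rewrite subSS [U ^+ i.+2]exprS -!scalemxAr -scalerDl.
  by congr (_ *: _); rewrite -[i.+2%:R]natr1; ring.
move: IHr; rewrite big_split /= => /(congr1 (fun X => U *m X)).
rewrite -scalemxAr mulmxN mulmxDr => /(congr1 -%R); rewrite opprK.
set a := U *m \sum_(i < r) _; set b := U *m \sum_(i < r) _ => ab.
rewrite grad_coefS mulNmx mulmxBr scalerN !mul_mx_scalar; congr (- _).
have -> : b = - (r%:R *: (U *m grad_coef U r)) - a by rewrite ab addrAC subrr add0r.
move: {ab} a (U *m _) => a Y; apply/matrixP => i j.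
by rewrite !mxE -natr1; ring.
Qed.

End UnitaryCoefficients.

Arguments grad_coef : simpl never.

(** * Derivatives along the unitary group *)

Section HolomorphicDerivative.
Variables (C : numClosedFieldType) (n : nat).
Local Notation M := 'M[C]_n.
Local Open Scope sesquilinear_scope.

(* [hder q dq]: on the unitary group, q agrees with a polynomial in the entries
   of U, and [dq A] is its derivative in the direction U |-> A U. *)
Inductive hder : (M -> C) -> (M -> M -> C) -> Prop :=
| hder_cst c : hder (fun=> c) (fun _ _ => 0)
| hder_entry i j : hder (fun U => U i j) (fun A U => (A *m U) i j)
| hder_add f df g dg : hder f df -> hder g dg ->
    hder (fun U => f U + g U) (fun A U => df A U + dg A U)
| hder_mul f df g dg : hder f df -> hder g dg ->
    hder (fun U => f U * g U) (fun A U => df A U * g U + f U * dg A U)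
| hder_ext f df g dg : hder f df ->
    (forall U, U \is unitarymx -> f U = g U) ->
    (forall A U, U \is unitarymx -> df A U = dg A U) -> hder g dg.

Lemma hder_sum (I : Type) (s : seq I) f df : (forall i : I, hder (f i) (df i)) ->
  hder (fun U => \sum_(i <- s) f i U) (fun A U => \sum_(i <- s) df i A U).
Proof.
move=> H; elim: s => [|i s IHs].
  by apply: (hder_ext (hder_cst 0)) => *; rewrite big_nil.
by apply: (hder_ext (hder_add (H i) IHs)) => *; rewrite big_cons.
Qed.

Lemma hder_scale c f df : hder f df ->
  hder (fun U => c * f U) (fun A U => c * df A U).
Proof.
move=> H; apply: (hder_ext (hder_mul (hder_cst c) H)) => // A U _.
by rewrite mul0r add0r.
Qed.

Lemma hder_linear f df : hder f df -> forall U, U \is unitarymx ->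
  forall a A B, df (a *: A + B) U = a * df A U + df B U.
Proof.
elim=> {f df} [c|i j|f df g dg _ IHf _ IHg|f df g dg _ IHf _ IHg
  |f df g dg _ IHf fg dfg] U Uu a A B.
- by rewrite mulr0 addr0.
- by rewrite mulmxDl -scalemxAl !mxE.
- by rewrite IHf // IHg //; ring.
- by rewrite IHf // IHg //; ring.
- by rewrite -!dfg // IHf.
Qed.

Definition hderm m p (F : M -> 'M[C]_(m, p)) (dF : M -> M -> 'M[C]_(m, p)) :=
  forall i j, hder (fun U => F U i j) (fun A U => dF A U i j).

Lemma hderm_id : hderm id (fun A U => A *m U).
Proof. by move=> i j; apply: hder_entry. Qed.

Lemma hderm_mul m p q (F : M -> 'M[C]_(m, p)) dF (G : M -> 'M[C]_(p, q)) dG :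
  hderm F dF -> hderm G dG ->
  hderm (fun U => F U *m G U) (fun A U => dF A U *m G U + F U *m dG A U).
Proof.
move=> HF HG i j.
apply: (hder_ext (hder_sum (index_enum 'I_p) (fun k => hder_mul (HF i k) (HG k j)))).
  by move=> U _; rewrite mxE.
by move=> A U _; rewrite !mxE -big_split.
Qed.

Lemma hderm_add m p (F : M -> 'M[C]_(m, p)) dF (G : M -> 'M[C]_(m, p)) dG :
  hderm F dF -> hderm G dG ->
  hderm (fun U => F U + G U) (fun A U => dF A U + dG A U).
Proof.
move=> HF HG i j.
by apply: (hder_ext (hder_add (HF i j) (HG i j))) => *; rewrite mxE.
Qed.

Lemma hderm_scale m p (f : M -> C) df (G : M -> 'M[C]_(m, p)) dG :
  hder f df -> hderm G dG ->
  hderm (fun U => f U *: G U) (fun A U => df A U *: G U + f U *: dG A U).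
Proof.
move=> Hf HG i j.
by apply: (hder_ext (hder_mul Hf (HG i j))) => *; rewrite !mxE.
Qed.

Lemma hder_tr m (F : M -> 'M[C]_m) dF : hderm F dF ->
  hder (fun U => \tr (F U)) (fun A U => \tr (dF A U)).
Proof. by move=> HF; apply: hder_sum. Qed.

Lemma hder_trX k :
  hder (fun U => \tr (U ^+ k)) (fun A U => k%:R * \tr (A *m U ^+ k)).
Proof.
(* The derivative of U^k is the sum of U^i A U^(k-i) for i < k. Under the trace against a matrix B
   commuting with U all its terms coincide, and this form passes through the induction. *)
have [dX [HX dXE]] : exists dX, hderm (fun U => U ^+ k) dX /\
    forall A U B, B *m U = U *m B ->
      \tr (dX A U *m B) = k%:R * \tr (A *m U ^+ k *m B).
  elim: k => [|k [dX [HX dXE]]].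
    exists (fun _ _ => 0); split=> [i j|A U B _].
      by apply: (hder_ext (hder_cst ((1 : M) i j))) => *; rewrite ?mxE.
    by rewrite mul0mx mxtrace0 mul0r.
  exists (fun A U => A *m U *m U ^+ k + U *m dX A U); split.
    move=> i j; apply: (hder_ext (hderm_mul hderm_id HX i j)) => // U _.
    by rewrite exprS.
  move=> A U B BU; rewrite mulmxDl mxtraceD -(mulmxA U) (mxtrace_mulC U).
  rewrite -(mulmxA (dX A U)) dXE ?mulmxA ?BU // exprSr -[_ * U]/(_ *m U).
  have XU : U *m U ^+ k = U ^+ k *m U by rewrite -[LHS]exprS -[RHS]exprSr.
  by rewrite -(mulmxA A U) XU -!mulmxA BU -[k.+1%:R]natr1; ring.
have := hder_tr HX; move/hder_ext; apply=> // A U _.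
by rewrite -[dX A U]mulmx1 dXE ?mulmx1 ?mul1mx.
Qed.

(** Newton's identities write r c_r through power sums and lower coefficients, hence a strong
    induction with a division by r; [grad_coef_newton] is the matching identity for the
    gradients. *)
Lemma hder_char_coef r :
  hder (fun U => char_coef U r) (fun A U => \tr (A *m grad_coef U r)).
Proof.
have [m le_rm] := ubnP r; elim: m r le_rm => // m IHm [|r] le_rm.
  apply: (hder_ext (hder_cst 1)) => [U Uu|A U _]; first by rewrite char_coef0.
  by rewrite /grad_coef mulmx0 mxtrace0.
have H (i : 'I_r.+1) := hder_mul (hder_trX i.+1)
   (IHm (r.+1 - i.+1)%N (leq_ltn_trans (leq_subr i r) le_rm)).
have := hder_scale (- r.+1%:R^-1) (hder_sum (index_enum 'I_r.+1) H).
have r0 : r.+1%:R != 0 :> C by rewrite pnatr_eq0.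
move/hder_ext; apply=> [U Uu|A U Uu].
  apply: (mulfI r0); rewrite mulrA mulrN divff // mulN1r.
  by rewrite char_coef_newton.
apply: (mulfI r0); rewrite mulrA mulrN divff // mulN1r.
rewrite -mxtraceZ scalemxAr grad_coef_newton // mulmxN mulmx_sumr.
rewrite (raddfN (@mxtrace C n)) (raddf_sum (@mxtrace C n)); congr (- _).
apply: eq_bigr => i _ /=; rewrite mulmxDr mxtraceD -!scalemxAr !mxtraceZ; ring.
Qed.

Lemma mxtrace_delta_mul a b (X : M) : \tr (delta_mx a b *m X) = X b a.
Proof.
rewrite -(mul_delta_mx (0 : 'I_1)) -mulmxA -rowE mxtrace_mulC -colE.
by rewrite trace_mx11 !mxE.
Qed.

(* The direction A U |-> \sum_(a, b) of the second derivatives along the matrix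
   units: the Laplacian on U(n). *)
Definition laplace (dF : M -> M -> M) (U : M) : C :=
  \sum_a \sum_b dF (delta_mx a b) U a b.

Lemma hderm_grad_coef r : exists dG : M -> M -> M,
  hderm (fun U => grad_coef U r) dG /\
  forall U, U \is unitarymx ->
    laplace dG U = r%:R * (n%:R - r%:R + 1) * char_coef U r.
Proof.
(* The recursion for G_r puts U to the left of the derivative of the previous gradient, so the
   induction carries an arbitrary left factor B. Taking B = 1 gives n r c_r - (r - 1) r c_r. *)
have [dG [HG dGE]] : exists dG : M -> M -> M, hderm (fun U => grad_coef U r) dG /\
  forall U B, U \is unitarymx -> laplace (fun A U => B *m dG A U) U =
    \tr (B *m (r%:R * char_coef U r)%:M) - (r%:R - 1) * \tr (B *m grad_coef U r).
  elim: r => [|r [dG [HG dGE]]].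
    exists (fun _ _ => 0); split=> [i j|U B _].
      by apply: (hder_ext (hder_cst 0)) => *; rewrite mxE.
    rewrite /grad_coef !mulmx0 mul0r raddf0 mulmx0 mxtrace0 mulr0 subrr /laplace.
    by rewrite big1 // => a _; rewrite big1 // => b _; rewrite mxE.
  exists (fun A U => A *m grad_coef U r.+1 - \tr (A *m grad_coef U r) *: U +
                     U *m dG A U); split.
    have H1 := hderm_scale (hder_scale (-1) (hder_char_coef r)) hderm_id.
    have := hderm_add H1 (hderm_mul hderm_id HG).
    move=> H i j; apply: (hder_ext (H i j)) => [U _|A U _].
      by rewrite grad_coefS mulNmx mulmxBr mul_mx_scalar mulN1r scaleNr opprB addrC.
    have -> : A *m grad_coef U r.+1 =
        - (char_coef U r *: (A *m U)) + A *m U *m grad_coef U r.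
      by rewrite grad_coefS mulNmx mulmxN mulmxA mulmxBr mul_mx_scalar opprB addrC.
    move: (A *m U) (_ *m grad_coef U r) (U *m dG A U) => X Y Z.
    by rewrite !mxE; ring.
  move=> U B Uu.
  have main (G1 G0 : M) :
     laplace (fun A V => B *m (A *m G1 - \tr (A *m G0) *: U + U *m dG A U)) U =
     \tr B * \tr G1 - \tr (B *m U *m G0) +
     laplace (fun A V => (B *m U) *m dG A V) U.
    have tr1 (X Y : M) : \sum_a \sum_b (X *m delta_mx a b *m Y) a b = \tr X * \tr Y.
      rewrite /mxtrace mulr_suml; apply: eq_bigr => a _; rewrite mulr_sumr.
      apply: eq_bigr => b _; rewrite -(mul_delta_mx (0 : 'I_1)) mulmxA -mulmxA.
      by rewrite -colE -rowE !mxE big_ord1 !mxE.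
    rewrite -tr1 [\tr (_ *m G0)]/mxtrace -sumrB -big_split /=.
    apply: eq_bigr => a _; rewrite [(B *m U *m _) a a]mxE -sumrB -big_split /=.
    apply: eq_bigr => b _; rewrite mxtrace_delta_mul mulmxDr mulmxBr -scalemxAr !mulmxA.
    set X := _ *m G1; set Y := _ *m dG _ _.
    by rewrite !mxE; ring.
  rewrite [LHS](main (grad_coef U r.+1) (grad_coef U r)).
  rewrite dGE // tr_grad_coef // !mul_mx_scalar !mxtraceZ.
  rewrite grad_coefS mulNmx mulmxN mulmxA mulmxBr mul_mx_scalar raddfN raddfB /=.
  rewrite mxtraceZ -[r.+1%:R]natr1; ring.
exists dG; split=> // U Uu.
have := dGE U 1%:M Uu; rewrite /laplace; under eq_bigr do under eq_bigr do rewrite mul1mx.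
by move=> ->; rewrite !mul1mx mxtrace_scalar tr_grad_coef //; ring.
Qed.
End HolomorphicDerivative.

(** * Invariant functionals and their Schwinger-Dyson equations *)

Lemma exists_prim_root (C : numClosedFieldType) m : (0 < m)%N ->
  exists w : C, m.-primitive_root w.
Proof.
move=> m0; have [rs E] := closed_field_poly_normal ('X^m - 1 : {poly C}).
rewrite (monicP _) ?monicXnsubC // scale1r in E.
have rsu : uniq rs.
  by rewrite -separable.separable_prod_XsubC -E cyclotomic.separable_Xn_sub_1 // pnatr_eq0 -lt0n.
have /hasP[w _ wm] : has m.-primitive_root rs.
  apply: cyclic.has_prim_root => //; last first.
    by rewrite -ltnS -(size_prod_XsubC rs id) -E size_XnsubC.
  by apply/allP => w; rewrite -root_prod_XsubC -E.
by exists w.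
Qed.

Lemma prim_root_circle (C : numClosedFieldType) m (w : C) k :
  m.-primitive_root w -> w ^+ k * (w ^+ k)^* = 1.
Proof.
move=> wm; have m0 := prim_order_gt0 wm.
have w1 : `|w| = 1.
  apply/eqP; rewrite -(@pexpr_eq1 _ _ m) //.
  by rewrite -normrX (prim_expr_order wm) normr1.
by rewrite -normCK normrX w1 !expr1n.
Qed.

Lemma poly_eq_circle (C : numClosedFieldType) (p q : {poly C}) m :
  (size p <= m)%N -> (size q <= m)%N -> (0 < m)%N -> forall w, m.-primitive_root w ->
  (forall k, p.[w ^+ k] = q.[w ^+ k]) -> p = q.
Proof.
move=> sp sq m0 w wm pq; apply/eqP; rewrite -subr_eq0; apply/eqP.
apply: (@roots_geq_poly_eq0 _ _ [seq w ^+ i | i <- iota 0 m]).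
- by apply/allP => _ /mapP[k _ ->]; rewrite /root !hornerE pq subrr.
- rewrite map_inj_in_uniq ?iota_uniq // => i j.
  rewrite !mem_iota add0n !andTb => im jm /eqP.
  by rewrite (eq_prim_root_expr wm) !modn_small // => /eqP.
- rewrite size_map size_iota (leq_trans (size_polyD _ _)) // size_polyN.
  by rewrite geq_max sp.
Qed.

Section HaarFunctional.
Variables (C : numClosedFieldType) (n : nat).
Local Notation M := 'M[C]_n.
Local Open Scope sesquilinear_scope.

(** The test functions: additivity, homogeneity and invariance of a functional are asked only here,
    where integrals converge. Values off the unitary group are irrelevant, hence the last
    constructor. *)
Inductive polyfun : (M -> C) -> Prop :=
| polyfun_cst c : polyfun (fun=> c)
| polyfun_entry i j : polyfun (fun U => U i j)
| polyfun_conj f : polyfun f -> polyfun (fun U => (f U)^*)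
| polyfun_add f g : polyfun f -> polyfun g -> polyfun (fun U => f U + g U)
| polyfun_mul f g : polyfun f -> polyfun g -> polyfun (fun U => f U * g U)
| polyfun_ext f g : polyfun f -> (forall U, U \is unitarymx -> f U = g U) ->
    polyfun g.

Lemma polyfun_sum (I : Type) (s : seq I) f : (forall i : I, polyfun (f i)) ->
  polyfun (fun U => \sum_(i <- s) f i U).
Proof.
move=> H; elim: s => [|i s IHs].
  by apply: (polyfun_ext (polyfun_cst 0)) => *; rewrite big_nil.
by apply: (polyfun_ext (polyfun_add (H i) IHs)) => *; rewrite big_cons.
Qed.

Lemma polyfun_exp f k : polyfun f -> polyfun (fun U => f U ^+ k).
Proof.
move=> Hf; elim: k => [|k IHk]; first exact: polyfun_ext (polyfun_cst 1) _.
by apply: (polyfun_ext (polyfun_mul Hf IHk)) => U _; rewrite exprS.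
Qed.

Lemma hder_polyfun f df : hder f df ->
  polyfun f /\ forall A, polyfun (df A).
Proof.
elim=> {f df} [c|i j|f df g dg _ [f1 f2] _ [g1 g2]|f df g dg _ [f1 f2] _ [g1 g2]
  |f df g dg _ [f1 f2] fg dfg]; split=> [|A].
- exact: polyfun_cst.
- exact: polyfun_cst.
- exact: polyfun_entry.
- have H := polyfun_sum (index_enum 'I_n)
    (fun k => polyfun_mul (polyfun_cst (A i k)) (polyfun_entry k j)).
  by apply: (polyfun_ext H) => U _; rewrite mxE.
- exact: polyfun_add.
- exact: polyfun_add.
- exact: polyfun_mul.
- by apply: polyfun_add; apply: polyfun_mul.
- exact: polyfun_ext fg.
- by apply: polyfun_ext (f2 A) _; auto.
Qed.

Lemma polyfun_char_coef r : polyfun (fun U => char_coef U r).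
Proof. by have [] := hder_polyfun (hder_char_coef C n r). Qed.

(** T 1 is left free: on one factor of U(l) x U(l), T carries a weight depending on the other
    factor, and T 1 is the integral of this weight. *)
Record haar_functional (T : (M -> C) -> C) : Prop := HaarFunctional {
  haarD : forall f g, polyfun f -> polyfun g ->
    T (fun U => f U + g U) = T f + T g;
  haarZ : forall c f, polyfun f -> T (fun U => c * f U) = c * T f;
  haar_ext : forall f g, (forall U, U \is unitarymx -> f U = g U) -> T f = T g;
  haar_inv : forall f V, polyfun f -> V \is unitarymx ->
    T (fun U => f (V *m U)) = T f }.

(* The restriction of q to the orbit of U under w |-> 1 + (w - 1) P is a
   polynomial in w, whose derivative at w = 1 is dq P. *)
Lemma hder_orbit q dq (P : M) : hder q dq ->
  (forall w : C, w * w^* = 1 -> 1%:M + (w - 1) *: P \is unitarymx) ->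
  exists Q : M -> {poly C}, [/\
    exists N, forall U, (size (Q U) <= N)%N,
    forall k, polyfun (fun U => (Q U)`_k),
    forall U w, U \is unitarymx -> w * w^* = 1 ->
      q ((1%:M + (w - 1) *: P) *m U) = (Q U).[w],
    forall U, U \is unitarymx -> q U = (Q U).[1] &
    forall U, U \is unitarymx -> dq P U = (Q U)^`().[1]].
Proof.
move=> Hq Pu; elim: Hq => {q dq} [c|i j|f df g dg _ IHf _ IHg
  |f df g dg _ IHf _ IHg|f df g dg _ IHf fg dfg].
- exists (fun=> c%:P); split=> [|k|U w _ _|U _|U _].
  + by exists 1%N => U; apply: size_polyC_leq1.
  + exact: polyfun_cst.
  + by rewrite hornerC.
  + by rewrite hornerC.
  + by rewrite derivC hornerC.
- exists (fun U => ((U - P *m U) i j)%:P + (P *m U) i j *: 'X).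
  have Hp A : polyfun (fun U => (A *m U) i j).
    by have [] := hder_polyfun (hder_entry C i j).
  split=> [|k|U w _ _|U _|U _].
  + exists 2%N => U; apply: leq_trans (size_polyD _ _) _; rewrite geq_max.
    rewrite (leq_trans (size_polyC_leq1 _)) //=.
    by apply: leq_trans (size_scale_leq _ _) _; rewrite size_polyX.
  + have H1 := polyfun_mul (polyfun_add (Hp 1%:M) (Hp (- P))) (polyfun_cst (k == 0)%:R).
    have H2 := polyfun_mul (Hp P) (polyfun_cst (k == 1)%:R).
    apply: (polyfun_ext (polyfun_add H1 H2)) => U _.
    rewrite coefD coefC coefZ coefX mul1mx mulNmx.
    by case: k {H1 H2} => [|k]; rewrite /= ?mulr1 ?mulr0 !mxE.
  + rewrite mulmxDl mul1mx -scalemxAl !(hornerE, mxE); ring.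
  + by rewrite !(hornerE, mxE); ring.
  + by rewrite derivD derivC derivZ derivX add0r !hornerE.
- have [Q1 [[N1 s1] c1 e1 v1 d1]] := IHf; have [Q2 [[N2 s2] c2 e2 v2 d2]] := IHg.
  exists (fun U => Q1 U + Q2 U); split=> [|k|U w Uu w1|U Uu|U Uu].
  + exists (maxn N1 N2) => U; apply: leq_trans (size_polyD _ _) _.
    by rewrite geq_max !leq_max s1 s2 orbT.
  + apply: (polyfun_ext (polyfun_add (c1 k) (c2 k))) => U _; by rewrite coefD.
  + by rewrite hornerD e1 // e2.
  + by rewrite hornerD v1 // v2.
  + by rewrite derivD hornerD d1 // d2.
- have [Q1 [[N1 s1] c1 e1 v1 d1]] := IHf; have [Q2 [[N2 s2] c2 e2 v2 d2]] := IHg.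
  exists (fun U => Q1 U * Q2 U); split=> [|k|U w Uu w1|U Uu|U Uu].
  + exists (N1 + N2)%N => U; apply: leq_trans (size_polyMleq _ _) _.
    by apply: leq_trans (leq_pred _) _; rewrite leq_add.
  + have H := polyfun_sum (index_enum 'I_k.+1)
      (fun i => polyfun_mul (c1 i) (c2 (k - i)%N)).
    by apply: (polyfun_ext H) => U _; rewrite coefM.
  + by rewrite hornerM e1 // e2.
  + by rewrite hornerM v1 // v2.
  + by rewrite derivM hornerD !hornerM d1 // d2 // v1 // v2.
- have [Q [Qs c e v d]] := IHf; exists Q; split=> // [U w Uu w1|U Uu|U Uu].
  + by rewrite -fg ?e // mul_unitarymx // Pu.
  + by rewrite -fg // v.
  + by rewrite -dfg // d.
Qed.

End HaarFunctional.

Lemma deriv_horner1 (R : comNzRingType) (p : {poly R}) N : (size p <= N)%N ->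
  p^`().[1] = \sum_(m < N) m%:R * p`_m.
Proof.
move=> pN; rewrite -[in LHS](coefK p) (_ : \poly_(i < size p) p`_i = \poly_(i < N) p`_i).
  rewrite poly_def raddf_sum horner_sum; apply: eq_bigr => m _ /=.
  by rewrite derivZ derivXn hornerZ hornerMn hornerXn expr1n mulrC.
apply/polyP => i; rewrite !coef_poly; case: ifP => [ip|ip].
  by rewrite (leq_trans ip pN).
by case: ifP => // _; rewrite nth_default // leqNgt ip.
Qed.

(** * Integration by parts for invariant functionals *)

Section HaarDerivative.
Variables (C : numClosedFieldType) (n : nat).
Local Notation M := 'M[C]_n.
Local Open Scope sesquilinear_scope.
Variables (T : (M -> C) -> C) (HT : haar_functional T) (k : nat).

Local Notation bar U := ((char_coef U n)^* ^+ k).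

Lemma polyfun_bar : polyfun (fun U : M => bar U).
Proof. exact/polyfun_exp/polyfun_conj/polyfun_char_coef. Qed.

Lemma haar_sum (I : Type) (s : seq I) (c : I -> C) (f : I -> M -> C) :
  (forall i, polyfun (f i)) ->
  T (fun U => \sum_(i <- s) c i * f i U) = \sum_(i <- s) c i * T (f i).
Proof.
move=> Hf; elim: s => [|i s IHs].
  rewrite big_nil -[RHS](mul0r (T (fun=> 0))) -(haarZ HT); last exact: polyfun_cst.
  by apply: (haar_ext HT) => U _; rewrite big_nil mul0r.
rewrite big_cons -IHs -(haarZ HT) // -(haarD HT).
- by apply: (haar_ext HT) => U _; rewrite big_cons.
- by apply: polyfun_mul => //; apply: polyfun_cst.
- by apply: polyfun_sum => j; apply: polyfun_mul => //; apply: polyfun_cst.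
Qed.

Lemma haar_sum1 (I : Type) (s : seq I) (f : I -> M -> C) :
  (forall i, polyfun (f i)) ->
  T (fun U => \sum_(i <- s) f i U) = \sum_(i <- s) T (f i).
Proof.
move=> Hf; under eq_bigr do rewrite -[T _]mul1r.
rewrite -haar_sum //; apply: (haar_ext HT) => U _.
by apply: eq_bigr => i _; rewrite mul1r.
Qed.

(** For |w| = 1 the matrix 1 + (w - 1) P is unitary with determinant w, so it multiplies [bar] by
    w^(-k). By invariance the integral of q((1 + (w - 1) P) U) [bar U] is then t w^k, and the claim
    is its derivative at w = 1. *)
Lemma haar_deriv_proj q dq (g : M) i : hder q dq -> g \is unitarymx ->
  T (fun U => dq (g^t* *m delta_mx i i *m g) U * bar U) =
  k%:R * T (fun U => q U * bar U).
Proof.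
move=> Hq gu; set P := g^t* *m _ *m _.
have gg := unitarymxP gu; have gg' := mulmx1C gg.
pose D (w : C) : M := diag_mx (\row_j if j == i then w else 1).
have PE w : 1%:M + (w - 1) *: P = g^t* *m D w *m g.
  have -> : D w = 1%:M + (w - 1) *: delta_mx i i.
    apply/matrixP => a b; rewrite !mxE; case: (a =P b) => [<-|ab].
      by rewrite andbb; case: eqP => _ /=; rewrite ?mulr1n ?mulr0n; ring.
    rewrite mulr0n (_ : _ && _ = false) ?mulr0 ?addr0 //.
    by apply/negbTE/negP => /andP[/eqP ai /eqP bi]; apply: ab; rewrite ai bi.
  by rewrite mulmxDr mulmxDl mulmx1 gg' -scalemxAr -scalemxAl.
have Du w : w * w^* = 1 -> D w \is unitarymx.
  move=> w1; apply/unitarymxP; rewrite tr_diag_mx map_diag_mx mulmx_diag.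
  rewrite -diag_const_mx; congr diag_mx; apply/rowP => j; rewrite !mxE.
  by case: eqP => _ //; rewrite rmorph1 mulr1.
have Pu w : w * w^* = 1 -> 1%:M + (w - 1) *: P \is unitarymx.
  by move=> w1; rewrite PE !mul_unitarymx ?trmxC_unitary ?Du.
have Pd w U : w * w^* = 1 -> U \is unitarymx ->
    char_coef ((1%:M + (w - 1) *: P) *m U) n = w * char_coef U n.
  move=> w1 Uu; rewrite !char_coef_top ?mul_unitarymx ?Pu // det_mulmx PE.
  have -> : \det (g^t* *m D w *m g) = w; last by ring.
  rewrite !det_mulmx mulrAC -det_mulmx gg' det1 mul1r det_diag (bigD1 i) //=.
  by rewrite mxE eqxx big1 ?mulr1 => [|j /negbTE ji] //; rewrite mxE ji.
have [Q [[N sQ] cQ eQ vQ dQ]] := hder_orbit Hq Pu.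
pose f m U := (Q U)`_m * bar U; have Hf m : polyfun (f m).
  by apply: polyfun_mul => //; apply: polyfun_bar.
pose R : {poly C} := \poly_(m < N) T (f m).
pose t := T (fun U => q U * bar U).
have RE : R = t *: 'X^k.
  (* The order exceeds the degrees of both sides, so agreement at the powers of w suffices. *)
  have [w wm] := exists_prim_root C (ltn0Sn (maxn N k)).
  apply: (poly_eq_circle _ _ _ wm) => //.
  - by apply: leq_trans (size_poly _ _) _; rewrite leqW // leq_maxl.
  - apply: leq_trans (size_scale_leq _ _) _.
    by rewrite size_polyXn ltnS leq_maxr.
  move=> j; set v := w ^+ j; have v1 : v * v^* = 1 := prim_root_circle j wm.
  rewrite hornerZ hornerXn /t -(haar_inv HT _ (Pu v v1)); last first.
    by apply: polyfun_mul (hder_polyfun Hq).1 polyfun_bar.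
  have -> : T (fun U => q ((1%:M + (v - 1) *: P) *m U) *
                        bar ((1%:M + (v - 1) *: P) *m U)) =
            T (fun U => \sum_(m < N) (v ^+ m * v^* ^+ k) * f m U).
    apply: (haar_ext HT) => U Uu.
    rewrite eQ // Pd // (horner_coef_wide _ (sQ U)) rmorphM exprMn mulr_suml.
    by apply: eq_bigr => m _; rewrite /f; ring.
  rewrite haar_sum // mulr_suml horner_poly; apply: eq_bigr => m _.
  have vk : v^* ^+ k * v ^+ k = 1 by rewrite -exprMn mulrC v1 expr1n.
  by rewrite -[LHS]mulr1 -vk; move: (T _) (v ^+ m) (_ ^+ k) (_ ^+ k) => *; ring.
transitivity (R^`().[1]).
  rewrite (@deriv_horner1 _ _ N) ?size_poly //.
  rewrite (eq_bigr (fun m : 'I_N => m%:R * T (f m))); last first.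
    by move=> m _; rewrite coef_poly ltn_ord.
  rewrite -haar_sum //; apply: (haar_ext HT) => U Uu.
  rewrite dQ // (deriv_horner1 (sQ U)) mulr_suml; apply: eq_bigr => m _.
  by rewrite /f mulrA.
by rewrite RE derivZ derivXn hornerZ hornerMn hornerXn expr1n mulrC.
Qed.

(** Linearity in A extends the case of rank one projections to hermitian matrices by the spectral
    theorem, and then to every A as a sum H1 + i H2 with H1 and H2 hermitian. *)
Lemma haar_deriv q dq A : hder q dq ->
  T (fun U => dq A U * bar U) = k%:R * \tr A * T (fun U => q U * bar U).
Proof.
move=> Hq; set t := T (fun U => q U * bar U).
have pq B : polyfun (fun U => dq B U * bar U).
  by apply: polyfun_mul polyfun_bar; case: (hder_polyfun Hq).
have lin a B1 B2 : T (fun U => dq (a *: B1 + B2) U * bar U) =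
    a * T (fun U => dq B1 U * bar U) + T (fun U => dq B2 U * bar U).
  rewrite -(haarZ HT) // -(haarD HT) //.
    by apply: (haar_ext HT) => U Uu; rewrite (hder_linear Hq) //; ring.
  by apply: polyfun_mul => //; apply: polyfun_cst.
have lin0 : T (fun U => dq 0 U * bar U) = 0.
  have := lin (-1) 0 0; rewrite scaler0 addr0 mulN1r addNr => //.
have herm B : B^t* = B -> T (fun U => dq B U * bar U) = k%:R * \tr B * t.
  move=> HB; have /orthomx_spectralP : B \is normalmx by apply/normalmxP; rewrite HB.
  set g := spectralmx B; set d := spectral_diag B.
  have gu : g \is unitarymx := spectral_unitarymx B.
  rewrite (invmx_unitary gu) => BE.
  have {}BE : B = \sum_i d 0 i *: (g^t* *m delta_mx i i *m g).
    rewrite [LHS]BE diag_mx_sum_delta mulmx_sumr mulmx_suml.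
    by apply: eq_bigr => i _; rewrite -scalemxAr -scalemxAl.
  have -> : \tr B = \sum_i d 0 i.
    rewrite BE (raddf_sum (@mxtrace C n)); apply: eq_bigr => i _ /=.
    rewrite mxtraceZ mxtrace_mulC mulmxA (unitarymxP gu) mul1mx.
    by rewrite /mxtrace (bigD1 i) //= mxE !eqxx big1 ?addr0 ?mulr1 // => j /negbTE ji;
      rewrite mxE ji.
  rewrite BE; elim: (index_enum _) => [|i s IHs].
    by rewrite !big_nil lin0 mulr0 mul0r.
  by rewrite !big_cons lin IHs (haar_deriv_proj i Hq gu) -/t; ring.
pose H1 := 2^-1 *: (A + A^t*); pose H2 := - ('i / 2) *: (A - A^t*).
have AE : A = 'i *: H2 + H1.
  rewrite /H1 /H2 scalerA.
  have -> : 'i * - ('i / 2) = 2^-1 :> C.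
    by rewrite mulrN mulrA -expr2 sqrCi mulN1r opprK.
  rewrite -scalerDr addrACA addNr addr0 -[X in X + X]scale1r -scalerDl scalerA.
  by rewrite mulVf ?scale1r // pnatr_eq0.
have conj2 : (2^-1 : C)^* = 2^-1 by rewrite fmorphV rmorph_nat.
rewrite AE lin !herm.
- by rewrite mxtraceD [\tr ('i *: H2)]mxtraceZ; ring.
- apply/matrixP => i j; rewrite /H1 !mxE rmorphM rmorphD /=.
  by rewrite conj2 [X in _ * (_ + X)](conjCK (A i j)) addrC.
- apply/matrixP => i j.
  rewrite !mxE rmorphM rmorphB rmorphN rmorphM /= conj2 conjCi.
  by rewrite [X in _ * (_ - X)](conjCK (A i j)); ring.
Qed.

End HaarDerivative.

(** * Schwinger-Dyson equations and the uniqueness of their solution *)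

Definition del_nth (i : nat) (rs : seq nat) := take i rs ++ drop i.+1 rs.

Lemma perm_del_nth i rs : (i < size rs)%N ->
  perm_eq rs (nth 0%N rs i :: del_nth i rs).
Proof.
move=> ir; rewrite -{1}(cat_take_drop i rs) (drop_nth 0%N ir).
by rewrite /del_nth perm_catC /= perm_cons perm_catC.
Qed.

Section SchwingerDyson.
Variables (C : numClosedFieldType) (n : nat).

(* [tau rs k] stands for the integral of conj(c_n)^k \prod_(r <- rs) c_r, with
   c_r the coefficients of det(1 - X U); B bounds the total degrees concerned. *)
Record schwinger_dyson (B : nat) (tau : seq nat -> nat -> C) : Prop := {
  sd_perm : forall rs rs' k, perm_eq rs rs' -> tau rs k = tau rs' k;
  sd_gt : forall r rs k, (n < r)%N -> tau (r :: rs) k = 0;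
  sd_zero : forall rs k, tau (0%N :: rs) k = tau rs k;
  sd_top : forall rs k, tau (n :: rs) k.+1 = tau rs k;
  sd_eqn : forall r rs k, (sumn (r :: rs) + n * k <= B)%N ->
    r%:R * (n%:R - r%:R + 1) * tau (r :: rs) k +
    \sum_(i < size rs) Gam (fun a b => tau [:: a, b & del_nth i rs] k) r (nth 0%N rs i)
    = k%:R * r%:R * tau (r :: rs) k }.

(** The leading term of [Gam] is the only one with first index r; the others have a larger first
    index and the same total. *)
Lemma Gam_sub (F G : nat -> nat -> C) r s :
  (forall a b, (r < a)%N -> (a + b = r + s)%N -> F a b = G a b) ->
  Gam F r s - Gam G r s = s%:R * (F r s - G r s).
Proof.
case: s => [|s] FG /=; first by rewrite subrr mul0r.
have H : Gam F r.+1 s = Gam G r.+1 s.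
  have: forall a b, (r < a)%N -> (a + b = r.+1 + s)%N -> F a b = G a b.
    by move=> a b ra ab; apply: FG => //; rewrite ab addSnnS.
  elim: s {FG} r => [//|s IHs] r FG /=.
  rewrite !FG ?addSnnS // IHs // => a b ra ab; apply: FG; first exact: ltnW.
  by rewrite ab addSnnS.
by rewrite H (FG r.+1 s) ?addSnnS //; ring.
Qed.

(** This is the equation for the index n and the exponent k + 1. Beyond the leading term, every term
    of [Gam] contains an index above n and vanishes, so the equation reads (n + sum rs) tau = (k +
    1) n tau. The margin 2n is the degree added by c_n and one more conj(c_n). *)
Lemma sd_deg B tau rs k : schwinger_dyson B tau ->
  (sumn rs + n * k + n.*2 <= B)%N -> sumn rs <> (n * k)%N -> tau rs k = 0.
Proof.
move=> S bound neq.
have := @sd_eqn _ _ S n rs k.+1; rewrite /= mulnS => /(_ _)/wrap[]; first by lia.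
rewrite subrr add0r mulr1 (sd_top S).
have -> : \sum_(i < size rs)
    Gam (fun a b => tau [:: a, b & del_nth i rs] k.+1) n (nth 0%N rs i) =
    (sumn rs)%:R * tau rs k.
  rewrite sumnE (big_nth 0%N) big_mkord natr_sum mulr_suml.
  apply: eq_bigr => i _; have pi := perm_del_nth (ltn_ord i).
  have G0 r s : Gam (fun _ _ => 0 : C) r s = 0.
    by elim: s r => [//|s IHs] r /=; rewrite IHs !mulr0 subrr addr0.
  rewrite -[LHS]subr0 -(G0 n (nth 0%N rs i)) Gam_sub => [|a b na _].
    by rewrite subr0 (sd_top S) (sd_perm S _ pi).
  by rewrite (sd_gt S).
move/eqP; rewrite -mulrDl -subr_eq0 -mulrBl mulf_eq0 => /orP[|/eqP//].
rewrite -natrD -natrM -subr_eq0 subr0 subr_eq0 eqr_nat => /eqP e.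
by case: neq; rewrite mulSn mulnC in e; apply: (addnI e).
Qed.

Lemma schwinger_dyson_uniq B tau tau' :
  schwinger_dyson B tau -> schwinger_dyson B tau' ->
  tau [::] 0%N = tau' [::] 0%N ->
  forall rs k, (sumn rs + n * k + n.*2 <= B)%N -> tau rs k = tau' rs k.
Proof.
move=> S S' base rs k; elim: k rs => [|k IHk] rs bound.
  have [rs0|rs0] := eqVneq (sumn rs) 0%N; last first.
    by rewrite (sd_deg S) ?(sd_deg S') // muln0; apply/eqP.
  elim: rs rs0 {bound} => [//|r rs IHrs] /= /eqP.
  by rewrite addn_eq0 => /andP[/eqP-> /eqP ?]; rewrite !(sd_zero S, sd_zero S') IHrs.
have [rsk|rsk] := eqVneq (sumn rs) (n * k.+1)%N; last first.
  by rewrite (sd_deg S) ?(sd_deg S') //; apply/eqP.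
(* Induction on the gap m between n and some index of the list. In the step to m + 1 the index is r
   = n - m - 1, and its equation involves, apart from the moment itself, only lists with an index at
   least n - m. *)
have main m : forall rs, (sumn rs + n * k.+1 + n.*2 <= B)%N ->
    sumn rs = (n * k.+1)%N -> has (fun x => n - m <= x)%N rs ->
    tau rs k.+1 = tau' rs k.+1.
  elim: m => [|m IHm] {rsk bound}rs bound rsk /hasP[r /perm_to_rem rrs rm].
    set us := rem r rs in rrs *; rewrite (sd_perm S _ rrs) (sd_perm S' _ rrs).
    move: rm; rewrite subn0 leq_eqVlt => /predU1P[e|rm]; last first.
      by rewrite (sd_gt S) // (sd_gt S').
    rewrite -e (sd_top S) (sd_top S') IHk //.
    by move: bound; rewrite (perm_sumn rrs) /= mulnS; lia.
  have [/hasP ex|nex] := boolP (has (fun x => n - m <= x)%N rs).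
    by apply: IHm => //; apply/hasP.
  have rn : (r < n - m)%N.
    by rewrite ltnNge; apply: contraNN nex => ?; apply/hasP; exists r;
      rewrite // (perm_mem rrs) mem_head.
  rewrite (sd_perm S _ rrs) (sd_perm S' _ rrs); set us := rem r rs in rrs *.
  move: rsk bound; rewrite (perm_sumn rrs) => rsk bound.
  apply/eqP; rewrite -subr_eq0.
  have bound' : (sumn (r :: us) + n * k.+1 <= B)%N by lia.
  have := congr2 (fun x y => x - y) (sd_eqn S bound') (sd_eqn S' bound').
  rewrite -mulrBr opprD addrACA -mulrBr -sumrB.
  have -> : \sum_(i < size us)
      (Gam (fun a b => tau [:: a, b & del_nth i us] k.+1) r (nth 0%N us i) -
       Gam (fun a b => tau' [:: a, b & del_nth i us] k.+1) r (nth 0%N us i)) =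
      (sumn us)%:R * (tau (r :: us) k.+1 - tau' (r :: us) k.+1).
    rewrite sumnE (big_nth 0%N) big_mkord natr_sum mulr_suml.
    apply: eq_bigr => i _; have pi := perm_del_nth (ltn_ord i).
    rewrite Gam_sub => [|a b ra ab].
      have pe : perm_eq [:: r, nth 0%N us i & del_nth i us] (r :: us).
        by rewrite perm_cons perm_sym.
      by rewrite (sd_perm S _ pe) (sd_perm S' _ pe).
    have se : sumn [:: a, b & del_nth i us] = sumn (r :: us).
      by rewrite /= (perm_sumn pi) /= !addnA ab.
    apply: IHm; rewrite ?se //.
    by rewrite /= (_ : n - m <= a)%N //; lia.
  move: (tau _ _ - _) => D /eqP; rewrite -mulrDl -subr_eq0 -mulrBl mulf_eq0.
  (* Balanced degree gives sum us = n (k + 1) - r, and the coefficient of the unknown difference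
     factors. *)
  have -> : r%:R * (n%:R - r%:R + 1) + (sumn us)%:R - k.+1%:R * r%:R =
     ((n - r) * (r + k.+1))%:R :> C.
    have -> : (sumn us)%:R = n%:R * k.+1%:R - r%:R :> C.
      by rewrite -natrM -rsk /= natrD addrC addKr.
    rewrite natrM natrB ?natrD; last by lia.
    ring.
  rewrite pnatr_eq0 => /orP[|]; first by rewrite muln_eq0; lia.
  by [].
(* The empty list is balanced only if n = 0. Then c_0 is also c_n, and inserting it cancels one
   conj(c_n). *)
case: rs rsk bound => [|r rs] rsk bound.
  have n0 : n = 0%N by move: rsk => /= /esym/eqP; rewrite muln_eq0 orbF => /eqP.
  move: (sd_zero S [::] k.+1) (sd_zero S' [::] k.+1) => <- <-.
  have := sd_top S [::] k; have := sd_top S' [::] k; rewrite n0 => -> ->.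
  by apply: IHk; rewrite n0.
by apply: (main n) => //; rewrite subnn.
Qed.

End SchwingerDyson.

(** * Schwinger-Dyson equations for Haar moments *)

Section HaarSchwingerDyson.
Variables (C : numClosedFieldType) (n : nat).
Local Notation M := 'M[C]_n.
Local Open Scope sesquilinear_scope.

Definition char_mono (rs : seq nat) (U : M) : C := \prod_(r <- rs) char_coef U r.

Lemma hder_char_mono rs : hder (char_mono rs) (fun A U =>
  \sum_(i < size rs) \tr (A *m grad_coef U (nth 0%N rs i)) *
                     char_mono (del_nth i rs) U).
Proof.
elim: rs => [|r rs IHrs].
  by apply: (hder_ext (hder_cst n 1)) => *; rewrite ?big_ord0 /char_mono ?big_nil.
apply: (hder_ext (hder_mul (hder_char_coef C n r) IHrs)) => [U _|A U _].
  by rewrite /char_mono big_cons.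
rewrite big_ord_recl mulr_sumr /del_nth take0 /= drop0; congr (_ + _).
by apply: eq_bigr => i _; rewrite /char_mono big_cons mulrCA.
Qed.

Variables (T : (M -> C) -> C) (HT : haar_functional T).

Definition haar_moment rs k :=
  T (fun U => char_mono rs U * (char_coef U n)^* ^+ k).

Lemma unitary_char_coef_top (U : M) : U \is unitarymx ->
  char_coef U n * (char_coef U n)^* = 1.
Proof.
move=> Uu; have := conj_char_coef Uu (leq0n n).
by rewrite subn0 char_coef0 // rmorph1.
Qed.

Lemma haar_Gam f r s : polyfun f ->
  T (fun U => Gam (fun a b => char_coef U a * char_coef U b) r s * f U) =
  Gam (fun a b => T (fun U => char_coef U a * char_coef U b * f U)) r s.
Proof.
move=> Hf; have Hcc a b : polyfun (fun U => char_coef U a * char_coef U b * f U).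
  by do 2?apply: polyfun_mul => //; apply: polyfun_char_coef.
have HG s' r' : polyfun (fun U => Gam (fun a b => char_coef U a * char_coef U b) r' s' * f U).
  elim: s' r' => [|s' IHs] r'.
    by apply: (polyfun_ext (polyfun_cst n 0)) => U _; rewrite mul0r.
  have H1 := polyfun_mul (polyfun_cst n s'.+1%:R) (Hcc r' s'.+1).
  have H2 := polyfun_mul (polyfun_cst n (- r'.+1%:R)) (Hcc r'.+1 s').
  apply: (polyfun_ext (polyfun_add (polyfun_add H1 H2) (IHs r'.+1))) => U _ /=.
  by ring.
elim: s r => [|s IHs] r /=.
  rewrite -[RHS](mul0r (T f)) -(haarZ HT) //.
rewrite -IHs -mulNr -!(haarZ HT) // -!(haarD HT) //.
  by apply: (haar_ext HT) => U _; ring.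
all: by repeat first [exact: HG | exact: Hcc | exact: polyfun_cst
                     | apply: polyfun_add | apply: polyfun_mul].
Qed.

(** Integration by parts is applied to the (a, b) entry of G_r times the monomial, along the matrix
    unit E_ab, and summed over a and b. Differentiating G_r gives its Laplacian term,
    differentiating the monomial gives the traces tr(G_r G_s), that is [Gam], and on the right the
    factors tr E_ab collect k tr G_r. *)
Lemma haar_schwinger_dyson B : schwinger_dyson n B haar_moment.
Proof.
have pm rs : polyfun (char_mono rs) by case: (hder_polyfun (hder_char_mono rs)).
have pb k : polyfun (fun U : M => (char_coef U n)^* ^+ k) := polyfun_bar C n k.
have pmb rs k : polyfun (fun U => char_mono rs U * (char_coef U n)^* ^+ k).
  exact: polyfun_mul.
split=> [rs rs' k pe|r rs k nr|rs k|rs k|r rs k _].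
- by apply: (haar_ext HT) => U _; rewrite /char_mono (perm_big _ pe).
- have -> : haar_moment (r :: rs) k =
      T (fun U => 0 * (char_mono rs U * (char_coef U n)^* ^+ k)).
    by apply: (haar_ext HT) => U Uu; rewrite /char_mono big_cons char_coef_gt ?mul0r.
  by rewrite (haarZ HT) // mul0r.
- by apply: (haar_ext HT) => U Uu; rewrite /char_mono big_cons char_coef0 ?mul1r.
- apply: (haar_ext HT) => U Uu; rewrite /char_mono big_cons exprS mulrACA.
  by rewrite unitary_char_coef_top ?mul1r.
have pG s (a b : 'I_n) : polyfun (fun U : M => grad_coef U s a b).
  by have [dG [HG _]] := hderm_grad_coef C n s; case: (hder_polyfun (HG a b)).
have [dG [HG dGE]] := hderm_grad_coef C n r.
pose bar (U : M) : C := (char_coef U n)^* ^+ k.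
pose g (a b : 'I_n) (U : M) : C := grad_coef U r a b.
have pg (a b : 'I_n) : polyfun (g a b) by case: (hder_polyfun (HG a b)).
have pdg (a b : 'I_n) : polyfun (fun U => dG (delta_mx a b) U a b).
  by have [_] := hder_polyfun (HG a b); apply.
pose t (i : nat) (U : M) : C := \tr (grad_coef U r *m grad_coef U (nth 0%N rs i)) * (char_mono (del_nth i rs) U * bar U).
have pt i : polyfun (t i).
  have H := polyfun_sum (index_enum 'I_n) (fun a => polyfun_sum (index_enum 'I_n)
     (fun b => polyfun_mul (pg a b) (pG (nth 0%N rs i) b a))).
  apply: (polyfun_ext (polyfun_mul H (pmb (del_nth i rs) k))) => U _.
  by rewrite /t /mxtrace; congr (_ * _); apply: eq_bigr => a _; rewrite mxE.
have key : T (fun U => laplace dG U * (char_mono rs U * bar U) + \sum_(i < size rs) t i U) =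
    k%:R * T (fun U => \tr (grad_coef U r) * (char_mono rs U * bar U)).
  pose d (A U : M) : C := \sum_(i < size rs) \tr (A *m grad_coef U (nth 0%N rs i)) *
                     char_mono (del_nth i rs) U.
  have pd A : polyfun (d A) by have [_] := hder_polyfun (hder_char_mono rs); apply.
  pose S (a b : 'I_n) (U : M) : C := (dG (delta_mx a b) U a b * char_mono rs U + g a b U * d (delta_mx a b) U) * bar U.
  have pS (a b : 'I_n) : polyfun (S a b).
    exact: polyfun_mul (polyfun_add (polyfun_mul (pdg a b) (pm rs))
      (polyfun_mul (pg a b) (pd _))) (pb k).
  transitivity (T (fun U => \sum_a \sum_b S a b U)).
    apply: (haar_ext HT) => U Uu; rewrite /laplace mulr_suml.
    have -> : \sum_a \sum_b S a b U =
       \sum_a \sum_b dG (delta_mx a b) U a b * (char_mono rs U * bar U) +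
       \sum_a \sum_b g a b U * d (delta_mx a b) U * bar U.
      rewrite -big_split; apply: eq_bigr => a _; rewrite -big_split /=.
      by apply: eq_bigr => b _; rewrite /S; ring.
    congr (_ + _); first by apply: eq_bigr => a _; rewrite mulr_suml.
    under [RHS]eq_bigr do under eq_bigr do rewrite /d mulr_sumr mulr_suml.
    under [RHS]eq_bigr do rewrite exchange_big /=.
    rewrite exchange_big /=; apply: eq_bigr => i _; rewrite /t [\tr (grad_coef U r *m _)]/mxtrace mulr_suml.
    apply: eq_bigr => a _; rewrite mxE mulr_suml; apply: eq_bigr => b _.
    by rewrite mxtrace_delta_mul /g; ring.
  rewrite (haar_sum1 HT) => [|a]; last exact: polyfun_sum.
  have SE (a b : 'I_n) : T (S a b) = k%:R * (a == b)%:R *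
      T (fun U => g a b U * char_mono rs U * bar U).
    rewrite (haar_deriv HT k (delta_mx a b) (hder_mul (HG a b) (hder_char_mono rs))).
    by rewrite -[delta_mx a b]mulmx1 mxtrace_delta_mul mxE eq_sym.
  have pgm a : polyfun (fun U => g a a U * char_mono rs U * bar U).
    exact: polyfun_mul (polyfun_mul (pg a a) (pm rs)) (pb k).
  transitivity (k%:R * \sum_a T (fun U => g a a U * char_mono rs U * bar U)).
    rewrite mulr_sumr; apply: eq_bigr => a _; rewrite (haar_sum1 HT) //.
    rewrite (bigD1 a) //= big1 ?addr0 => [|b /negbTE ab]; rewrite SE ?eqxx ?mulr1 //.
    by rewrite eq_sym ab mulr0 mul0r.
  rewrite -(haar_sum1 HT) //; congr (_ * _); apply: (haar_ext HT) => U _.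
  by rewrite mulr_suml; apply: eq_bigr => a _; rewrite mulrA.
have sums : T (fun U => laplace dG U * (char_mono rs U * bar U) + \sum_(i < size rs) t i U) =
   r%:R * (n%:R - r%:R + 1) * haar_moment (r :: rs) k +
    \sum_(i < size rs) Gam (fun a b => haar_moment [:: a, b & del_nth i rs] k) r (nth 0%N rs i).
  rewrite (haarD HT); last 2 first.
  - have H := polyfun_sum (index_enum 'I_n) (fun a => polyfun_sum (index_enum 'I_n) (pdg a)).
    exact: polyfun_mul H (pmb rs k).
  - by apply: polyfun_sum => i; apply: pt.
  rewrite (haar_sum1 HT) => [|i]; last exact: pt.
  congr (_ + _).
    rewrite -(haarZ HT) //; apply: (haar_ext HT) => U Uu.
    by rewrite dGE // /char_mono big_cons /bar; ring.
  apply: eq_bigr => i _.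
  transitivity (T (fun U => Gam (fun a b => char_coef U a * char_coef U b) r (nth 0%N rs i)
      * (char_mono (del_nth i rs) U * bar U))).
    by apply: (haar_ext HT) => U Uu; rewrite /t tr_grad_coef_mul.
  rewrite haar_Gam; last exact: pmb.
  congr (Gam _ _ _); apply/funext => a; apply/funext => b.
  apply: (haar_ext HT) => U _; rewrite /char_mono !big_cons /bar; ring.
rewrite -sums key -mulrA; congr (_ * _).
rewrite -(haarZ HT) //; apply: (haar_ext HT) => U Uu.
by rewrite tr_grad_coef // /char_mono big_cons /bar; ring.
Qed.

End HaarSchwingerDyson.

(** * Torus averages and Weyl's integration formula *)

Section TorusDerivative.
Variables (C : numClosedFieldType) (n : nat).
Local Notation point := ('I_n -> C).

Definition scale_at (z : point) j w : point := fun i => if i == j then w * z i else z i.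

(* p is a polynomial of degree at most N in z_j, and p' = z_j dp/dz_j *)
Definition tder j N (p p' : point -> C) := exists Q : point -> {poly C},
  [/\ forall z, (size (Q z) <= N.+1)%N,
      forall z w, p (scale_at z j w) = (Q z).[w] &
      forall z, p' z = (Q z)^`().[1]].

Lemma scale_at1 z j : scale_at z j 1 = z.
Proof. by apply/funext => i; rewrite /scale_at mul1r; case: eqP. Qed.

Lemma tder_cst j c : tder j 0 (fun=> c) (fun=> 0).
Proof.
exists (fun=> c%:P); split=> [z|z w|z]; last by rewrite derivC hornerC.
  exact: size_polyC_leq1.
by rewrite hornerC.
Qed.

Lemma tder_coord j i : tder j 1 (fun z => z i) (fun z => (i == j)%:R * z i).
Proof.
exists (fun z => if i == j then z i *: 'X else (z i)%:P); split=> [z|z w|z].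
- case: ifP => _; last by apply: leq_trans (size_polyC_leq1 _) _.
  by apply: leq_trans (size_scale_leq _ _) _; rewrite size_polyX.
- by rewrite /scale_at; case: ifP => _; rewrite !hornerE 1?mulrC.
- by case: ifP => _; rewrite ?derivZ ?derivX ?derivC !hornerE.
Qed.

Lemma tder_add j N p p' q q' : tder j N p p' -> tder j N q q' ->
  tder j N (fun z => p z + q z) (fun z => p' z + q' z).
Proof.
move=> [Q1 [s1 e1 d1]] [Q2 [s2 e2 d2]]; exists (fun z => Q1 z + Q2 z).
split=> [z|z w|z]; last by rewrite derivD hornerD d1 d2.
  by apply: leq_trans (size_polyD _ _) _; rewrite geq_max s1 s2.
by rewrite hornerD e1 e2.
Qed.

Lemma tder_mul j N1 N2 p p' q q' : tder j N1 p p' -> tder j N2 q q' ->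
  tder j (N1 + N2) (fun z => p z * q z) (fun z => p' z * q z + p z * q' z).
Proof.
move=> [Q1 [s1 e1 d1]] [Q2 [s2 e2 d2]]; exists (fun z => Q1 z * Q2 z).
split=> [z|z w|z].
- apply: leq_trans (size_polyMleq _ _) _; rewrite -ltnS.
  have := s1 z; have := s2 z; lia.
- by rewrite hornerM e1 e2.
- rewrite derivM hornerD !hornerM d1 d2.
  by rewrite -[in LHS](scale_at1 z j) e1 -[in q _](scale_at1 z j) e2 !scale_at1.
Qed.

Lemma tder_ext j N p p' q q' : tder j N p p' -> p = q -> p' = q' -> tder j N q q'.
Proof. by move=> H <- <-. Qed.

Lemma tder_psi_coef j r :
  tder j r (fun z => psi_coef predT z r) (fun z => dpsi z j r).
Proof.
case: r => [|r].
  apply: tder_ext (tder_cst j 1) _ _; apply/funext => z.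
    by rewrite psi_coef0.
  by rewrite dpsi0.
have omit_scale z w s : psi_coef (omit j predT) (scale_at z j w) s =
    psi_coef (omit j predT) z s.
  rewrite /psi_coef; congr ((_ : {poly C})`_s); apply: eq_bigr => i.
  by rewrite /omit /= /scale_at => /negbTE ->.
exists (fun z => (psi_coef (omit j predT) z r.+1)%:P -
                 (z j * psi_coef (omit j predT) z r) *: 'X); split=> [z|z w|z].
- apply: leq_trans (size_polyD _ _) _; rewrite geq_max size_polyN.
  rewrite (leq_trans (size_polyC_leq1 _)) //=.
  by apply: leq_trans (size_scale_leq _ _) _; rewrite size_polyX.
- rewrite (@psi_coefS _ _ predT _ j) // !omit_scale !hornerE /scale_at eqxx.
  by ring.
- by rewrite derivB derivC derivZ derivX sub0r !hornerE dpsiS mulNr.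
Qed.

Lemma tder_dpsi j r : tder j r (fun z => dpsi z j r) (fun z => dpsi z j r).
Proof.
case: r => [|r].
  by apply: tder_ext (tder_cst j 0) _ _; apply/funext => z; rewrite dpsi0.
have omit_scale z w s : psi_coef (omit j predT) (scale_at z j w) s =
    psi_coef (omit j predT) z s.
  rewrite /psi_coef; congr ((_ : {poly C})`_s); apply: eq_bigr => i.
  by rewrite /omit /= /scale_at => /negbTE ->.
exists (fun z => dpsi z j r.+1 *: 'X); split=> [z|z w|z].
- by apply: leq_trans (size_scale_leq _ _) _; rewrite size_polyX.
- by rewrite !dpsiS omit_scale /scale_at eqxx !hornerE; ring.
- by rewrite derivZ derivX !hornerE.
Qed.

(** A vector field v acting on each factor by multiplication with kappa_i acts on the product by
    multiplication with their sum: logarithmic derivatives add. It serves for the discriminant. *)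
Lemma tder_prod (I : Type) (s : seq I) (P : pred I) (N : I -> nat)
    (F : I -> point -> C) (F' : I -> 'I_n -> point -> C)
    (v : 'I_n -> point -> C) (kappa : I -> point -> C) :
  (forall i j, tder j (N i) (F i) (F' i j)) ->
  (forall i z, P i -> \sum_j v j z * F' i j z = F i z * kappa i z) ->
  exists P' : 'I_n -> point -> C,
    (forall j, tder j (\sum_(i <- s | P i) N i) (fun z => \prod_(i <- s | P i) F i z) (P' j)) /\
    (forall z, \sum_j v j z * P' j z =
       (\prod_(i <- s | P i) F i z) * \sum_(i <- s | P i) kappa i z).
Proof.
move=> HF Hk; elim: s => [|i s [P' [HP Pk]]].
  exists (fun _ _ => 0); split=> [j|z].
    by rewrite big_nil; apply: tder_ext (tder_cst j 1) _ _ => //; apply/funext => z;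
      rewrite big_nil.
  by rewrite !big_nil mulr0 big1 // => j _; rewrite mulr0.
have [Pi|Pi] := boolP (P i); last first.
  exists P'; split=> [j|z]; last by rewrite !big_cons (negbTE Pi).
  rewrite big_cons (negbTE Pi); apply: tder_ext (HP j) _ _ => //.
  by apply/funext => z; rewrite big_cons (negbTE Pi).
exists (fun j z => F' i j z * \prod_(i <- s | P i) F i z + F i z * P' j z).
split=> [j|z].
  rewrite big_cons Pi; apply: tder_ext (tder_mul (HF i j) (HP j)) _ _ => //.
  by apply/funext => z; rewrite big_cons Pi.
transitivity ((\sum_j v j z * F' i j z) * (\prod_(i <- s | P i) F i z) +
              F i z * \sum_j v j z * P' j z).
  by rewrite mulr_suml mulr_sumr -big_split; apply: eq_bigr => j _ /=; ring.
by rewrite Hk // Pk !big_cons Pi; ring.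
Qed.

End TorusDerivative.

Section TorusMoments.
Variables (C : numClosedFieldType) (n m : nat) (w : C).
Hypothesis wm : m.+1.-primitive_root w.
Local Notation point := ('I_n -> C).
Local Notation index := {ffun 'I_n -> 'I_m.+1}.

Definition torus_pt (f : index) : point := fun j => w ^+ f j.

(** All negative powers of the coordinates are gathered in one power of the conjugate of their
    product: K will be k, from conj(c_n)^k, plus n - 1, from the weight. *)
Definition torus_sum K (p : point -> C) : C :=
  \sum_(f : index) p (torus_pt f) * (\prod_j torus_pt f j)^* ^+ K.

Lemma torus_pt_circle f j : torus_pt f j * (torus_pt f j)^* = 1.
Proof. exact: prim_root_circle wm. Qed.

(** Multiplying z_j by a power of w permutes the grid, so the argument of [haar_deriv_proj] applies.
    The bounds by m ensure that m + 1 points determine the polynomials in play. *)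
Lemma torus_sum_deriv j N p p' K : tder j N p p' -> (N <= m)%N -> (K <= m)%N ->
  torus_sum K p' = K%:R * torus_sum K p.
Proof.
move=> [Q [sQ eQ dQ]] Nm Km.
pose b (f : index) := (\prod_j torus_pt f j)^* ^+ K.
pose R : {poly C} := \sum_(f : index) b f *: Q (torus_pt f).
have RE : R = torus_sum K p *: 'X^K.
  apply: (poly_eq_circle _ _ _ wm) => // [||k].
  - apply: leq_trans (size_sum _ _ _) _; apply/bigmax_leqP => f _.
    apply: leq_trans (size_scale_leq _ _) _; apply: leq_trans (sQ _) _.
    by rewrite ltnS.
  - by apply: leq_trans (size_scale_leq _ _) _; rewrite size_polyXn ltnS.
  (* Exponents count modulo the order m + 1 of w, so adding t to one of them is a bijection of the
     grid. *)
  pose t : 'I_m.+1 := inZp k.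
  pose shift (f : index) : index := [ffun i => if i == j then f i + t else f i].
  have shift_bij : bijective shift.
    exists (fun f : index => [ffun i => if i == j then f i - t else f i]) => f;
    by apply/ffunP => i; rewrite !ffunE; case: eqP => // _; rewrite ?addrK ?subrK.
  have wt : w ^+ t = w ^+ k by rewrite /t /= prim_expr_mod.
  have pts f : torus_pt (shift f) = scale_at (torus_pt f) j (w ^+ k).
    apply/funext => i; rewrite /torus_pt /scale_at ffunE; case: eqP => // _.
    by rewrite /= (prim_expr_mod wm) exprD wt mulrC.
  have ptb f : b (shift f) = (w ^+ k)^* ^+ K * b f.
    rewrite /b pts -exprMn -rmorphM; congr (_^* ^+ K).
    rewrite (bigD1 j) //= [in RHS](bigD1 j) //= mulrA /scale_at eqxx; congr (_ * _).
    by apply: eq_bigr => i /negbTE ->.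
  rewrite hornerZ hornerXn /torus_sum (reindex _ (onW_bij _ shift_bij)) /=.
  rewrite mulr_suml horner_sum; apply: eq_bigr => f _.
  rewrite hornerZ -/(b _) ptb pts eQ.
  have v1 : (w ^+ k)^* ^+ K * (w ^+ k) ^+ K = 1.
    by rewrite -exprMn mulrC (prim_root_circle _ wm) expr1n.
  by rewrite -[LHS]mulr1 -v1; ring.
transitivity (R^`().[1]); last first.
  by rewrite RE derivZ derivXn hornerZ hornerMn hornerXn expr1n mulrC.
rewrite /R raddf_sum horner_sum; apply: eq_bigr => f _ /=.
by rewrite derivZ hornerZ dQ mulrC.
Qed.

Definition psi_mono (rs : seq nat) (z : point) : C := \prod_(r <- rs) psi_coef predT z r.

(** On the torus (z_a - z_b) conj(z_a) = 1 - z_b conj(z_a), so [discr] times conj(z_1 ... z_n)^(n-1)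
    is the squared modulus of the Vandermonde determinant. In this form the part to be
    differentiated is polynomial. *)
Definition discr (z : point) : C :=
  \prod_(p : 'I_n * 'I_n | p.1 != p.2) (z p.1 - z p.2).

Definition torus_moment rs k :=
  \sum_(f : index) psi_mono rs (torus_pt f) * (psi_coef predT (torus_pt f) n)^* ^+ k *
    (discr (torus_pt f) * (\prod_j torus_pt f j)^* ^+ n.-1).

Lemma psi_coef_top (z : point) : psi_coef predT z n = (-1) ^+ n * \prod_j z j.
Proof.
rewrite psi_coef_sum (big_pred1 [set: 'I_n]%SET) => [|J].
  by congr (_ * _); apply: eq_bigl => i; rewrite inE.
have Jn : (#|J| <= n)%N by rewrite -[X in (_ <= X)%N]card_ord max_card.
rewrite (introT fintype.subsetP) => [|i _]; last by rewrite inE.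
by rewrite /= eqEcard finset.subsetT cardsT card_ord eqn_leq Jn.
Qed.

Lemma torus_momentE rs k : torus_moment rs k =
  (-1) ^+ (n * k) * torus_sum (k + n.-1) (fun z => psi_mono rs z * discr z).
Proof.
rewrite mulr_sumr; apply: eq_bigr => f _.
rewrite psi_coef_top rmorphM rmorphXn rmorphN1 exprMn -exprM exprD; ring.
Qed.

Lemma tder_psi_mono j rs : tder j (sumn rs) (psi_mono rs)
  (fun z => \sum_(i < size rs) dpsi z j (nth 0%N rs i) * psi_mono (del_nth i rs) z).
Proof.
elim: rs => [|r rs IHrs].
  apply: (tder_ext (tder_cst j (1 : C))); apply/funext => z;
    by rewrite /psi_mono ?big_nil ?big_ord0.
apply: (tder_ext (tder_mul (tder_psi_coef C j r) IHrs)); apply/funext => z.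
  by rewrite /psi_mono big_cons.
rewrite big_ord_recl mulr_sumr /del_nth take0 /= drop0; congr (_ + _).
by apply: eq_bigr => i _; rewrite /psi_mono big_cons mulrCA.
Qed.

Lemma torus_sumD K p q :
  torus_sum K (fun z => p z + q z) = torus_sum K p + torus_sum K q.
Proof. by rewrite -big_split; apply: eq_bigr => f _; rewrite mulrDl. Qed.

Lemma torus_sumZ K c p : torus_sum K (fun z => c * p z) = c * torus_sum K p.
Proof. by rewrite mulr_sumr; apply: eq_bigr => f _; rewrite mulrA. Qed.

Lemma torus_sum_sum K (I : Type) (s : seq I) p :
  torus_sum K (fun z => \sum_(i <- s) p i z) = \sum_(i <- s) torus_sum K (p i).
Proof.
rewrite exchange_big; apply: eq_bigr => f _ /=; exact: mulr_suml.
Qed.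

Lemma torus_sum_Gam K p r s :
  torus_sum K (fun z => Gam (fun a b => psi_coef predT z a * psi_coef predT z b) r s * p z) =
  Gam (fun a b => torus_sum K (fun z => psi_coef predT z a * psi_coef predT z b * p z)) r s.
Proof.
elim: s r => [|s IHs] r /=.
  by rewrite -[RHS](mul0r (torus_sum K p)) -torus_sumZ.
rewrite -IHs -mulNr -!torus_sumZ -!torus_sumD; apply: eq_bigr => f _.
by congr (_ * _); ring.
Qed.

(** The vector field with components [dpsi z j r] plays the role of G_r. Its divergence contributes
    r, the discriminant 2nr - r - r^2, and the exponent n - 1 in the weight takes away (n - 1) r.
    Together this is r (n - r + 1), the factor found for the Laplacian in [hderm_grad_coef]. *)
Lemma torus_schwinger_dyson B : (B + n * n + n <= m)%N ->
  schwinger_dyson n B torus_moment.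
Proof.
move=> Bm; split=> [rs rs' k pe|r rs k nr|rs k|rs k|r rs k bound].
- by apply: eq_bigr => f _; rewrite /psi_mono (perm_big _ pe).
- apply: big1 => f _; rewrite /psi_mono big_cons psi_coef_gt ?card_ord //.
  by rewrite !mul0r.
- by apply: eq_bigr => f _; rewrite /psi_mono big_cons psi_coef0 mul1r.
- apply: eq_bigr => f _; congr (_ * _).
  rewrite /psi_mono big_cons exprS mulrACA.
  have := conj_psi_coef (torus_pt_circle f) (leq0n n).
  by rewrite subn0 psi_coef0 rmorph1 => <-; rewrite mul1r.
pose K := (k + n.-1)%N.
(* A crude bound for the degree of [discr] in one variable, one for each ordered pair. It accounts
   for n * n in the condition on m; the further n covers the exponent n - 1 in K. *)
pose N : nat := \sum_(p : 'I_n * 'I_n | p.1 != p.2) 1.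
have Nn : (N <= n * n)%N.
  have := max_card [pred p : 'I_n * 'I_n | p.1 != p.2].
  by rewrite card_prod !card_ord -sum1_card.
pose kappa (p : 'I_n * 'I_n) (z : point) : C := psi_coef predT z r -
   psi_coef (omit p.2 (omit p.1 predT)) z r.
pose F (p : 'I_n * 'I_n) (z : point) := z p.1 - z p.2.
pose F' (p : 'I_n * 'I_n) j (z : point) : C := (p.1 == j)%:R * z p.1 - (p.2 == j)%:R * z p.2.
have HF p j : tder j 1 (F p) (F' p j).
  have H := tder_mul (tder_cst j (-1 : C)) (tder_coord C j p.2).
  apply: tder_ext (tder_add (tder_coord C j p.1) H) _ _; apply/funext => z.
    by rewrite /F mulN1r.
  by rewrite /F' mul0r add0r mulN1r.
have Hk p z : p.1 != p.2 -> \sum_j dpsi z j r * F' p j z = F p z * kappa p z.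
  move=> p12; rewrite /kappa /F -dpsi_sub //.
  under eq_bigr do rewrite /F' mulrBr; rewrite sumrB.
  rewrite (bigD1 p.1) //= eqxx big1 ?addr0 => [|j /negbTE]; last first.
    by rewrite eq_sym => ->; rewrite mul0r mulr0.
  rewrite (bigD1 p.2) //= eqxx big1 ?addr0 => [|j /negbTE]; last first.
    by rewrite eq_sym => ->; rewrite mul0r mulr0.
  by rewrite !mul1r; ring.
have [D' [HD' Dk]] := tder_prod (index_enum _) HF Hk.
have HD j : tder j N discr (D' j) := HD' j.
pose p' j := fun z => dpsi z j r * (psi_mono rs z * discr z) +
  dpsi z j r * ((\sum_(i < size rs) dpsi z j (nth 0%N rs i) * psi_mono (del_nth i rs) z) *
                 discr z + psi_mono rs z * D' j z).
have key : torus_sum K (fun z => \sum_j p' j z) =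
    K%:R * torus_sum K (fun z => \sum_j dpsi z j r * (psi_mono rs z * discr z)).
  rewrite !torus_sum_sum mulr_sumr; apply: eq_bigr => j _.
  have n0 : (0 < n)%N := leq_ltn_trans (leq0n j) (ltn_ord j).
  apply: torus_sum_deriv (tder_mul (tder_dpsi C j r) (tder_mul (tder_psi_mono j rs) (HD j))) _ _.
    by move: bound => /=; lia.
  by rewrite /K; move: bound; nia.
have E1 : torus_sum K (fun z => \sum_j p' j z) =
  (r%:R + (n%:R * (n%:R - 1) - (n%:R - r%:R) * (n%:R - 1 - r%:R))) *
    torus_sum K (fun z => psi_mono (r :: rs) z * discr z) +
  \sum_(i < size rs) Gam (fun a b =>
    torus_sum K (fun z => psi_mono [:: a, b & del_nth i rs] z * discr z)) r (nth 0%N rs i).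
  pose gam (z : point) (i : nat) : C := Gam (fun a b => psi_coef predT z a * psi_coef predT z b) r (nth 0%N rs i).
  transitivity (torus_sum K (fun z =>
      (r%:R + (n%:R * (n%:R - 1) - (n%:R - r%:R) * (n%:R - 1 - r%:R))) *
        (psi_mono (r :: rs) z * discr z) +
      \sum_(i < size rs) gam z i * (psi_mono (del_nth i rs) z * discr z))).
    apply: eq_bigr => f _; congr (_ * _); move: (torus_pt f) => z.
    have -> : \sum_j p' j z = (\sum_j dpsi z j r) * (psi_mono rs z * discr z) +
      ((\sum_j dpsi z j r *
         \sum_(i < size rs) dpsi z j (nth 0%N rs i) * psi_mono (del_nth i rs) z) * discr z +
       psi_mono rs z * \sum_j dpsi z j r * D' j z).
      rewrite !mulr_suml mulr_sumr -!big_split /=.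
      by apply: eq_bigr => j _; rewrite /p'; ring.
    have -> : \sum_j dpsi z j r *
         \sum_(i < size rs) dpsi z j (nth 0%N rs i) * psi_mono (del_nth i rs) z =
         \sum_(i < size rs) gam z i * psi_mono (del_nth i rs) z.
      under eq_bigr do rewrite mulr_sumr.
      rewrite exchange_big; apply: eq_bigr => i _ /=.
      by rewrite /gam -sum_dpsi_mul mulr_suml; apply: eq_bigr => j _; ring.
    have -> : \sum_(i < size rs) gam z i * (psi_mono (del_nth i rs) z * discr z) =
        (\sum_(i < size rs) gam z i * psi_mono (del_nth i rs) z) * discr z.
      by rewrite mulr_suml; apply: eq_bigr => i _; rewrite mulrA.
    have Dsum : \sum_j dpsi z j r * D' j z = discr z * ((n%:R * (n%:R - 1) -
        (n%:R - r%:R) * (n%:R - 1 - r%:R)) * psi_coef predT z r).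
      rewrite Dk -/(discr z); congr (_ * _); rewrite /kappa.
      rewrite -sum_psi_coef_omit2 -(pair_big_dep predT (fun a b => a != b) (fun a b =>
        psi_coef predT z r - psi_coef (omit b (omit a predT)) z r)) /=.
      by apply: eq_bigr => a _; apply: eq_bigl => b; rewrite eq_sym.
    by rewrite Dsum sum_dpsi /psi_mono big_cons; ring.
  rewrite torus_sumD torus_sumZ torus_sum_sum; congr (_ + _).
  apply: eq_bigr => i _; rewrite torus_sum_Gam; congr (Gam _ _ _).
  apply/funext => a; apply/funext => b; apply: eq_bigr => f _; congr (_ * _).
  by rewrite /psi_mono !big_cons !mulrA.
have E2 : torus_sum K (fun z => \sum_j dpsi z j r * (psi_mono rs z * discr z)) =
    r%:R * torus_sum K (fun z => psi_mono (r :: rs) z * discr z).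
  rewrite -torus_sumZ; apply: eq_bigr => f _; congr (_ * _).
  by rewrite -mulr_suml sum_dpsi /psi_mono big_cons !mulrA.
pose s : C := (-1) ^+ (n * k).
have tE us : torus_moment us k = s * torus_sum K (fun z => psi_mono us z * discr z).
  exact: torus_momentE.
have GE i : Gam (fun a b => torus_moment [:: a, b & del_nth i rs] k) r (nth 0%N rs i) =
    s * Gam (fun a b => torus_sum K
      (fun z => psi_mono [:: a, b & del_nth i rs] z * discr z)) r (nth 0%N rs i).
  elim: (nth _ _ _) (r) => [|q IHq] p /=; first by rewrite mulr0.
  by rewrite IHq !tE; ring.
under eq_bigr do rewrite GE; rewrite -mulr_sumr tE.
move: key; rewrite E1 E2 => /(canRL (addKr _)) ->.
set x := torus_sum K _.
(* For n = 0 the truncated [n.-1] is not n - 1, but then c_r = 0 for r > 0 and both sides vanish. *)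
have Kx : K%:R * (r%:R * x) = (k%:R + n%:R - 1) * (r%:R * x).
  case: (posnP n) => [n0|n0]; last first.
    by rewrite /K natrD -subn1 natrB // addrA.
  have -> : r%:R * x = 0.
    case: (r) @x => [|r'] x; first by rewrite mul0r.
    suff -> : x = 0 by rewrite mulr0.
    apply: big1 => f _; rewrite /psi_mono big_cons psi_coef_gt ?card_ord ?n0 //.
    by rewrite !mul0r.
  by rewrite !mulr0.
by rewrite Kx; ring.
Qed.

End TorusMoments.

(** * Coefficients of inverse power series *)

Section InverseSeries.
Variable R : comNzRingType.
Implicit Type p : {poly R}.

Definition inv_coef p k : R := (\sum_(i < k.+1) (1 - p) ^+ i)`_k.

Lemma coef_exp0 p i k : p`_0 = 0 -> (k < i)%N -> (p ^+ i)`_k = 0.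
Proof.
move=> p0; elim: i k => // i IHi k ki; rewrite exprS coefM big1 // => j _.
case: (posnP j) => [->|j0]; first by rewrite p0 mul0r.
by rewrite IHi ?mulr0 //; have := ltn_ord j; lia.
Qed.

Lemma inv_coef_wide p k K : p`_0 = 1 -> (k <= K)%N ->
  (\sum_(i < K.+1) (1 - p) ^+ i)`_k = inv_coef p k.
Proof.
move=> p0 kK; rewrite /inv_coef -(big_mkord predT (fun i => (1 - p) ^+ i)).
rewrite (@big_cat_nat _ _ _ k.+1) //= big_mkord coefD [X in _ + X]coef_sum.
rewrite [X in _ + X]big1_seq ?addr0 // => i /andP[_]; rewrite mem_index_iota.
by case/andP=> ki _; rewrite coef_exp0 // coefB coef1 p0 subrr.
Qed.

Lemma inv_coefP p : p`_0 = 1 -> forall k,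
  \sum_(i < k.+1) p`_i * inv_coef p (k - i) = (k == 0%N)%:R.
Proof.
move=> p0 k; pose S := \sum_(i < k.+1) (1 - p) ^+ i.
transitivity ((p * S)`_k).
  rewrite coefM; apply: eq_bigr => i _.
  by rewrite /S inv_coef_wide // leq_subr.
have -> : p * S = 1 - (1 - p) ^+ k.+1.
  by rewrite -[RHS]opprB subrX1 -mulNr opprB subKr.
rewrite coefB coef1 coef_exp0 ?subr0 //.
by rewrite coefB coef1 p0 subrr.
Qed.

End InverseSeries.

(** * Comparison of Haar moments with torus moments *)

Section WeylIntegration.
Variables (C : numClosedFieldType) (n : nat).
Local Notation M := 'M[C]_n.
Local Open Scope sesquilinear_scope.

Local Notation term := (C * seq nat * nat)%type.

Definition eval_term (t : term) (U : M) : C :=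
  t.1.1 * (char_mono t.1.2 U * (char_coef U n)^* ^+ t.2).

(** Powers of conj(c_n) are the only conjugates needed, since conj(c_r) = c_(n-r) conj(c_n). The
    integrands det H(V; x) conj(det H(V; y)) thus belong here, and their integrals are combinations
    of [haar_moment]. *)
Definition char_span (f : M -> C) := exists L : seq term,
  forall U, U \is unitarymx -> f U = \sum_(t <- L) eval_term t U.

Lemma char_span_ext f g : char_span f ->
  (forall U, U \is unitarymx -> f U = g U) -> char_span g.
Proof. by move=> [L HL] fg; exists L => U Uu; rewrite -fg // HL. Qed.

Lemma char_span_cst c : char_span (fun=> c).
Proof.
exists [:: (c, [::], 0%N)] => U _.
by rewrite big_seq1 /eval_term /char_mono big_nil !mulr1.
Qed.

Lemma char_span_coef r : char_span (fun U => char_coef U r).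
Proof.
exists [:: (1, [:: r], 0%N)] => U _.
by rewrite big_seq1 /eval_term /char_mono big_seq1 mul1r mulr1.
Qed.

Lemma char_span_add f g : char_span f -> char_span g ->
  char_span (fun U => f U + g U).
Proof.
move=> [L HL] [L' HL']; exists (L ++ L') => U Uu.
by rewrite big_cat /= HL // HL'.
Qed.

Lemma char_span_mul f g : char_span f -> char_span g ->
  char_span (fun U => f U * g U).
Proof.
move=> [L HL] [L' HL'].
exists [seq (t.1.1 * t'.1.1, t.1.2 ++ t'.1.2, (t.2 + t'.2)%N) | t <- L, t' <- L'].
move=> U Uu; rewrite HL // HL' // big_allpairs_dep mulr_suml.
apply: eq_bigr => t _; rewrite mulr_sumr; apply: eq_bigr => t' _.
by rewrite /eval_term /char_mono /= big_cat exprD /=; ring.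
Qed.

Lemma char_span_sum (I : Type) (s : seq I) f : (forall i : I, char_span (f i)) ->
  char_span (fun U => \sum_(i <- s) f i U).
Proof.
move=> H; elim: s => [|i s IHs].
  by apply: (char_span_ext (char_span_cst 0)) => *; rewrite big_nil.
by apply: (char_span_ext (char_span_add (H i) IHs)) => *; rewrite big_cons.
Qed.

Lemma char_span_prod (I : Type) (s : seq I) f : (forall i : I, char_span (f i)) ->
  char_span (fun U => \prod_(i <- s) f i U).
Proof.
move=> H; elim: s => [|i s IHs].
  by apply: (char_span_ext (char_span_cst 1)) => *; rewrite big_nil.
by apply: (char_span_ext (char_span_mul (H i) IHs)) => *; rewrite big_cons.
Qed.

Lemma char_span_conj_coef r : char_span (fun U => (char_coef U r)^*).
Proof.
have [rn|nr] := leqP r n.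
  exists [:: (1, [:: (n - r)%N], 1%N)] => U Uu.
  rewrite big_seq1 /eval_term /char_mono big_seq1 mul1r expr1.
  exact: conj_char_coef.
apply: (char_span_ext (char_span_cst 0)) => U Uu.
by rewrite char_coef_gt ?rmorph0.
Qed.

Lemma char_span_conj f : char_span f -> char_span (fun U => (f U)^*).
Proof.
move=> [L HL]; pose g (t : term) (U : M) : C :=
  t.1.1^* * (\prod_(r <- t.1.2) (char_coef U r)^* * \prod_(i < t.2) char_coef U n).
have Hg t : char_span (g t).
  apply: char_span_mul; first exact: char_span_cst.
  apply: char_span_mul; apply: char_span_prod => i.
    exact: char_span_conj_coef.
  exact: char_span_coef.
apply: (char_span_ext (char_span_sum L Hg)) => U Uu.
rewrite HL // rmorph_sum; apply: eq_bigr => t _.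
rewrite /g /eval_term /char_mono /= !rmorphM rmorph_prod rmorphXn /=.
rewrite [X in _ * (_ * X ^+ _)](conjCK (char_coef U n)).
by rewrite prodr_const card_ord.
Qed.

Lemma char_mono_diag (z : 'rV[C]_n) rs :
  char_mono rs (diag_mx z) = psi_mono rs (z 0).
Proof. by apply: eq_bigr => r _; rewrite char_coef_diag. Qed.

Definition torus_mx m (w : C) (f : {ffun 'I_n -> 'I_m.+1}) : M :=
  diag_mx (\row_j torus_pt w f j).

Definition torus_weight m (w : C) (f : {ffun 'I_n -> 'I_m.+1}) : C :=
  discr (torus_pt w f) * (\prod_j torus_pt w f j)^* ^+ n.-1.

Lemma unitary_torus_mx m (w : C) (f : {ffun 'I_n -> 'I_m.+1}) :
  m.+1.-primitive_root w ->
  torus_mx w f \is unitarymx.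
Proof.
move=> wm; apply/unitarymxP; rewrite tr_diag_mx map_diag_mx mulmx_diag.
rewrite -diag_const_mx; congr diag_mx; apply/rowP => j; rewrite !mxE.
exact: torus_pt_circle wm _ _.
Qed.

Lemma schwinger_dysonZ B tau c : schwinger_dyson n B tau ->
  schwinger_dyson n B (fun rs k => c * tau rs k : C).
Proof.
move=> S; split=> [rs rs' k pe|r rs k nr|rs k|rs k|r rs k bound].
- by rewrite (sd_perm S _ pe).
- by rewrite (sd_gt S) ?mulr0.
- by rewrite (sd_zero S).
- by rewrite (sd_top S).
have GE F p q : Gam (fun a b => c * F a b) p q = c * Gam F p q.
  by elim: q p => [|q IHq] p /=; rewrite ?mulr0 // IHq; ring.
under eq_bigr do rewrite GE.
by rewrite -mulr_sumr mulrCA -mulrDr (sd_eqn S bound) mulrCA.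
Qed.

(* Weyl's integration formula; the integral over the diagonal torus is replaced
   by a sum over roots of unity of large order. *)
Theorem weyl_integration f : char_span f -> exists m0, forall m (w : C),
  (m0 <= m)%N -> m.+1.-primitive_root w -> forall T, haar_functional T ->
  T f * (\sum_(p : {ffun 'I_n -> 'I_m.+1}) torus_weight w p) =
  T (fun=> 1) * \sum_(p : {ffun 'I_n -> 'I_m.+1}) f (torus_mx w p) * torus_weight w p.
Proof.
move=> [L HL].
(* The margin 2n is that of [schwinger_dyson_uniq]; n * n + n below is that of
   [torus_schwinger_dyson]. *)
pose B := (\max_(t <- L) (sumn t.1.2 + n * t.2) + n.*2)%N.
exists (B + n * n + n)%N => m w Bm wm T HT.
set om := @torus_moment C n m w.
have om0 : \sum_(p : {ffun 'I_n -> 'I_m.+1}) torus_weight w p = om [::] 0%N.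
  by apply: eq_bigr => p _; rewrite /psi_mono big_nil expr0 !mul1r.
have T0 : T (fun=> 1) = haar_moment T [::] 0.
  by apply: (haar_ext HT) => U _; rewrite /char_mono big_nil expr0 mulr1.
have pmb rs k : polyfun (fun U : M => char_mono rs U * (char_coef U n)^* ^+ k).
  exact: polyfun_mul (hder_polyfun (hder_char_mono C n rs)).1 (polyfun_bar C n k).
have main t : t \in L -> haar_moment T t.1.2 t.2 * om [::] 0%N =
    T (fun=> 1) * om t.1.2 t.2.
  move=> tL; rewrite mulrC T0.
  (* Each family is scaled by the empty moment of the other, so that the two solutions have the same
     initial value. *)
  have S1 := schwinger_dysonZ (om [::] 0%N) (haar_schwinger_dyson HT B).
  have S2 := schwinger_dysonZ (haar_moment T [::] 0) (torus_schwinger_dyson wm Bm).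
  apply: (schwinger_dyson_uniq S1 S2); first by rewrite mulrC.
  rewrite leq_add2r.
  exact: (leq_bigmax_seq (F := fun t : term => (sumn t.1.2 + n * t.2)%N) t).
have -> : T f = \sum_(t <- L) t.1.1 * haar_moment T t.1.2 t.2.
  rewrite -(haar_sum HT) //; exact: (haar_ext HT).
rewrite om0 mulr_suml.
have -> : \sum_(p : {ffun 'I_n -> 'I_m.+1}) f (torus_mx w p) * torus_weight w p =
    \sum_(t <- L) t.1.1 * om t.1.2 t.2.
  under [RHS]eq_bigr do rewrite mulr_sumr.
  rewrite exchange_big; apply: eq_bigr => p _ /=.
  rewrite HL ?unitary_torus_mx // mulr_suml; apply: eq_bigr => t _.
  rewrite /eval_term char_mono_diag char_coef_diag -!mulrA /torus_weight.
  have -> : (\row_j torus_pt w p j) 0 = torus_pt w p.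
    by apply/funext => j; rewrite mxE.
  by [].
rewrite mulr_sumr big_seq [RHS]big_seq; apply: eq_bigr => t tL.
by rewrite -mulrA main // mulrCA.
Qed.

Lemma inv_det_coef_rec (U : M) k : U \is unitarymx ->
  \sum_(i < k.+1) char_coef U i * inv_det_coef U (k - i) = (k == 0%N)%:R.
Proof. by move=> Uu; apply: inv_coefP; apply: char_coef0. Qed.

(** As c_0 = 1, [inv_det_coef_rec] can be solved for the coefficient of highest index in terms of
    lower ones and the c_i. *)
Lemma char_span_inv_det k : char_span (fun U => inv_det_coef U k).
Proof.
have [m] := ubnP k; elim: m k => // m IHm [|k] km.
  apply: (char_span_ext (char_span_cst 1)) => U Uu.
  by have := inv_det_coef_rec 0 Uu; rewrite big_ord1 char_coef0 // mul1r => ->.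
have H (i : 'I_k.+1) := char_span_mul (char_span_coef i.+1)
  (IHm (k - i)%N (leq_ltn_trans (leq_subr i k) km)).
apply: (char_span_ext (char_span_mul (char_span_cst (-1))
  (char_span_sum (index_enum 'I_k.+1) H))) => U Uu.
have := inv_det_coef_rec k.+1 Uu; rewrite big_ord_recl char_coef0 // mul1r subn0.
by move/eqP; rewrite addr_eq0 mulN1r => /eqP ->.
Qed.

Lemma char_span_detH a : char_span (fun U => detH U a).
Proof. by apply: char_span_prod => j; apply: char_span_inv_det. Qed.

End WeylIntegration.

(** * Alternants and the Pieri rule *)

(** Modulo X^D, q is c times the inverse of p, and [S] represents this inverse up to degree k. *)
Lemma inv_coef_quotient (R : comNzRingType) (p q r : {poly R}) c D k :
  p`_0 = 1 -> p * q = c%:P + 'X^D * r -> (k < D)%N -> q`_k = inv_coef p k * c.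
Proof.
move=> p0 pq kD; pose S := \sum_(i < k.+1) (1 - p) ^+ i.
have SpE : S * p = 1 - (1 - p) ^+ k.+1.
  by rewrite -[RHS]opprB subrX1 -mulNr opprB subKr mulrC.
have low : ((1 - p) ^+ k.+1 * q)`_k = 0.
  rewrite coefM big1 // => i _; rewrite coef_exp0 ?mul0r //.
  by rewrite coefB coef1 p0 subrr.
have : (S * (p * q))`_k = (S * (c%:P + 'X^D * r))`_k by rewrite pq.
rewrite mulrA SpE mulrBl mul1r coefB low subr0 => ->.
by rewrite mulrDr mulrCA coefD coefMC coefXnM kD addr0.
Qed.

Lemma det_row_sum (R : comNzRingType) n (J : finType) (G : 'I_n -> J -> 'I_n -> R) :
  \det (\matrix_(i, j) \sum_b G i b j) =
  \sum_(f : {ffun 'I_n -> J}) \det (\matrix_(i, j) G i (f i) j).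
Proof.
rewrite /determinant exchange_big; apply: eq_bigr => s _ /=.
rewrite -mulr_sumr; congr (_ * _).
under eq_bigr do rewrite mxE.
rewrite bigA_distr_bigA; apply: eq_bigr => f _.
by apply: eq_bigr => i _; rewrite mxE.
Qed.

Definition alternant (R : comNzRingType) n (al : 'I_n -> nat) (z : 'I_n -> R) : R :=
  \det (\matrix_(i, j) z j ^+ al i).

Definition strict_decr n (al : 'I_n -> nat) :=
  forall i j : 'I_n, (i < j)%N -> (al j < al i)%N.

Section Pieri.
Variables (C : fieldType) (n : nat) (z : 'I_n -> C).

(** Row i of A holds the geometric sums of z_j^(al i) (z_j X)^b, cut off at the gap d_i to the
    exponent of the previous row. Multiplying column j by 1 - z_j X telescopes its entry to z_j^(al
    i) - X^(d i) z_j^(al i + d i), and al i + d i is that previous exponent. Row operations then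
    give back the alternant modulo X^D, while expanding det A by multilinearity in the rows gives
    the sum over f. *)
Lemma pieri (al : 'I_n -> nat) D k :
  strict_decr al -> (forall i, al i < D)%N -> (k < D)%N ->
  inv_coef (psi predT z) k * alternant al z =
  \sum_(f : {ffun 'I_n -> 'I_D} |
      [forall i : 'I_n, forall j : 'I_n, (j == i.+1 :> nat) ==> (al j + f j < al i)%N] &&
      (\sum_i f i == k)%N) alternant (fun i => al i + f i)%N z.
Proof.
move=> aldec alD kD.
(* Row 0 has no exponent above it; the default D puts its cut-off beyond the degree k. *)
pose d (i : 'I_n) := if [pick j : 'I_n | i == j.+1 :> nat] is Some j
  then (al j - al i)%N else D.
have dP (i j : 'I_n) : j = i.+1 :> nat -> d j = (al i - al j)%N.
  move=> ji; rewrite /d; case: pickP => [i' /eqP|/(_ i)]; last by rewrite ji eqxx.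
  by rewrite ji => -[/val_inj ->].
have dD i : (d i <= D)%N.
  rewrite /d; case: pickP => // j _; apply: leq_trans (leq_subr _ _) _; exact: ltnW.
pose G (i : 'I_n) (b : 'I_D) (j : 'I_n) : {poly C} :=
  if (b < d i)%N then z j ^+ (al i + b) *: 'X^b else 0.
pose A := \matrix_(i, j) \sum_b G i b j.
have AE i j : (1 - z j *: 'X) * A i j =
    (z j ^+ al i)%:P - 'X^(d i) * (z j ^+ (al i + d i))%:P.
  have -> : A i j = (z j ^+ al i)%:P * \sum_(b < d i) (z j *: 'X) ^+ b.
    rewrite mxE /G -big_mkcond /= (big_ord_widen D) // mulr_sumr.
    by apply: eq_bigr => b _; rewrite exprD exprZn -mul_polyC -mul_polyC polyCM mulrA.
  rewrite mulrCA -[1 - _]opprB mulNr -subrX1 opprB exprZn mulrBr mulr1.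
  by rewrite exprD polyCM -mul_polyC; ring.
have [r detE] : exists r : {poly C},
    psi predT z * \det A = (alternant al z)%:P + 'X^D * r.
  pose P := \matrix_(i < n, j < n) (z j ^+ al i)%:P.
  have PE : \det P = (alternant al z)%:P.
    have -> : P = map_mx polyC (\matrix_(i, j) z j ^+ al i).
      by apply/matrixP => i j; rewrite !mxE.
    by rewrite det_map_mx.
  (* Unitriangular row operations: [L *m P] agrees with B except in row 0, where B has an extra term
     carrying X^D. *)
  pose L : 'M[{poly C}]_n := \matrix_(i, j)
    ((i == j)%:R - if (i == j.+1 :> nat) then 'X^(d i) else 0).
  have detL : \det L = 1.
    rewrite det_trig; first by rewrite big1 // => i _; rewrite mxE eqxx ltn_eqF ?subr0.
    apply/is_trig_mxP => i j ij; rewrite mxE -val_eqE ltn_eqF //=.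
    by rewrite ltn_eqF ?subr0 // ltnW.
  pose B := \matrix_(i < n, j < n) ((1 - z j *: 'X) * A i j).
  have -> : psi predT z * \det A = \det B.
    have -> : B = A *m diag_mx (\row_j (1 - z j *: 'X)).
      by apply/matrixP => i j; rewrite mul_mx_diag !mxE mulrC.
    rewrite det_mulmx det_diag mulrC /psi; congr (_ * _).
    by apply: eq_bigr => j _; rewrite mxE.
  pose N := L *m P.
  have NE (i j : 'I_n) : N i j = (z j ^+ al i)%:P -
      \sum_(h < n) (if (i == h.+1 :> nat) then 'X^(d i) * (z j ^+ al h)%:P else 0).
    rewrite !mxE; under eq_bigr do rewrite !mxE mulrBl.
    rewrite sumrB (bigD1 i) //= eqxx mul1r big1 ?addr0 => [|h /negbTE]; last first.
      by rewrite eq_sym => ->; rewrite mul0r.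
    by congr (_ - _); apply: eq_bigr => h _; case: ifP => _; rewrite ?mul0r.
  have BN (i j : 'I_n) : (0 < i)%N -> B i j = N i j.
    move=> i0; pose h := Ordinal (leq_ltn_trans (leq_pred i) (ltn_ord i)).
    have ih : i = h.+1 :> nat by rewrite /= prednK.
    rewrite NE mxE AE (bigD1 h) //= -ih eqxx big1 ?addr0 => [|h' h'h]; last first.
      by rewrite ifF //; apply/negbTE; apply: contraNneq h'h => e; apply/eqP/val_inj/succn_inj; rewrite -ih e.
    by rewrite (dP h i ih) subnKC // ltnW // aldec // ih.
  have detN : \det N = (alternant al z)%:P by rewrite det_mulmx detL mul1r.
  case: (pickP (fun i : 'I_n => i == 0%N :> nat)) => [i0 /eqP i00|no0]; last first.
    exists 0; rewrite mulr0 addr0 -detN; congr (\det _); apply/matrixP => i j.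
    by apply: BN; rewrite lt0n no0.
  pose B2 := \matrix_(i < n, j < n)
    (if i == i0 then (z j ^+ (al i0 + D))%:P else N i j).
  exists (- \det B2).
  have di0 : d i0 = D by rewrite /d; case: pickP => // j; rewrite i00.
  rewrite mulrN -mulNr -detN -[\det N]mul1r; apply: (determinant_multilinear (i0 := i0)).
  - apply/rowP => j; rewrite [LHS]mxE [LHS]mxE AE di0 [RHS]mxE [X in _ = X + _]mxE.
    rewrite [X in _ = _ * X + _]mxE [X in _ = _ + X]mxE [X in _ = _ + _ * X]mxE.
    rewrite [X in _ = _ + _ * X]mxE eqxx mul1r mulNr; congr (_ - _).
    by rewrite NE big1 ?subr0 // => h _; rewrite i00.
  - apply/matrixP => i j; rewrite [LHS]mxE [RHS]mxE BN //.
    by have := neq_lift i0 i; rewrite -val_eqE /= i00 lt0n eq_sym.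
  - apply/matrixP => i j; rewrite [LHS]mxE [RHS]mxE BN ?mxE; last first.
      by have := neq_lift i0 i; rewrite -val_eqE /= i00 lt0n eq_sym.
    by rewrite eq_sym (negbTE (neq_lift _ _)).
rewrite -(inv_coef_quotient _ detE kD); last exact: psi_coef0.
rewrite det_row_sum coef_sum [RHS]big_mkcond /=; apply: eq_bigr => f _.
have condE : [forall i : 'I_n, forall j : 'I_n, (j == i.+1 :> nat) ==> (al j + f j < al i)%N]
    = [forall i, (f i < d i)%N].
  apply/forallP/forallP => [H j|H i].
    rewrite /d; case: pickP => // i ji.
    by move/forallP/(_ j): (H i); rewrite ji /= -ltn_subRL.
  apply/forallP => j; apply/implyP => /eqP ji.
  by move: (H j); rewrite (dP i j ji) -ltn_subRL.
rewrite condE; case: forallP => /= [fd|/forallP]; last first.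
  rewrite negb_forall => /existsP[i0 fi0]; rewrite /determinant big1 ?coef0 // => s _.
  by rewrite (bigD1 i0) //= mxE /G (negbTE fi0) mul0r mulr0.
have -> : \matrix_(i, j) G i (f i) j =
    diag_mx (\row_i 'X^(f i)) *m map_mx polyC (\matrix_(i, j) z j ^+ (al i + f i)).
  by apply/matrixP => i j; rewrite mul_diag_mx !mxE /G fd -mul_polyC mulrC.
rewrite det_mulmx det_map_mx det_diag.
under eq_bigr do rewrite mxE.
rewrite -expr_sum coefMC coefXn eq_sym -/(alternant _ z).
by case: eqP => _; rewrite ?mul1r ?mul0r.
Qed.

End Pieri.

(** Both s and its inverse preserve the order of the indices, and an increasing permutation u
    satisfies i <= u i. *)
Lemma strict_decr_perm n (al be : 'I_n -> nat) (s : {perm 'I_n}) :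
  strict_decr al -> strict_decr be -> (forall i, al (s i) = be i) -> s = 1%g.
Proof.
move=> Hal Hbe E.
have incr (u : {perm 'I_n}) : (forall i j : 'I_n, (i < j)%N -> (u i < u j)%N) ->
    forall i : 'I_n, (i <= u i)%N.
  move=> Hu i; have [m] := ubnP (i : nat); elim: m i => // m IHm i im.
  case: (posnP i) => [->//|i0].
  pose h := Ordinal (leq_ltn_trans (leq_pred i) (ltn_ord i)).
  have hi : (h < i)%N by rewrite /= prednK.
  have := IHm h (leq_trans hi im); have := Hu h i hi; rewrite /=; lia.
have cmp (u : {perm 'I_n}) (al' be' : 'I_n -> nat) : strict_decr al' -> strict_decr be' ->
    (forall i, al' (u i) = be' i) -> forall i j : 'I_n, (i < j)%N -> (u i < u j)%N.
  move=> H1 H2 E' i j ij; have := H2 i j ij; rewrite -!E'.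
  case: (ltngtP (u i) (u j)) => // [ji|/val_inj ->]; last by rewrite ltnn.
  by move=> h; have := H1 _ _ ji; rewrite ltnNge ltnW.
apply/permP => i; rewrite perm1; apply/val_inj/eqP; rewrite eqn_leq.
rewrite (incr s (cmp _ _ _ Hal Hbe E)) andbT.
have E' j : be ((s^-1)%g j) = al j by rewrite -E permKV.
by have := incr _ (cmp _ _ _ Hbe Hal E') (s i); rewrite permK.
Qed.

(** * Orthogonality of alternants on the finite torus *)

Section TorusOrthogonality.
Variables (C : numClosedFieldType) (n m : nat) (w : C).
Hypothesis wm : m.+1.-primitive_root w.
Local Notation index := {ffun 'I_n -> 'I_m.+1}.

Lemma prim_root_orthogonality a b : (a <= m)%N -> (b <= m)%N ->
  \sum_(x < m.+1) (w ^+ x) ^+ a * ((w ^+ x) ^+ b)^* = m.+1%:R * (a == b)%:R.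
Proof.
move=> am bm; pose u := w ^+ a * (w ^+ b)^*.
have uE (x : 'I_m.+1) : (w ^+ x) ^+ a * ((w ^+ x) ^+ b)^* = u ^+ x.
  by rewrite exprMn -rmorphXn -!exprM !(mulnC x).
under eq_bigr do rewrite uE.
have wb : (w ^+ b)^* * w ^+ b = 1 by rewrite mulrC (prim_root_circle _ wm).
case: eqP => [ab|ab].
  have u1 : u = 1 by rewrite /u ab mulrC.
  by under eq_bigr do rewrite u1 expr1n; rewrite sumr_const card_ord mulr1.
have u1 : u != 1.
  apply/eqP => u1; apply: ab; apply/eqP.
  rewrite -(modn_small (m := a) (d := m.+1)) ?ltnS // -(modn_small (m := b) (d := m.+1)) ?ltnS //.
  rewrite -(eq_prim_root_expr wm); apply/eqP.
  by rewrite -[LHS]mulr1 -wb mulrA -/u u1 mul1r.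
have um : u ^+ m.+1 = 1.
  rewrite exprMn -rmorphXn -!exprM !(mulnC _ m.+1) !exprM (prim_expr_order wm).
  by rewrite !expr1n rmorph1 mulr1.
have := subrX1 u m.+1; rewrite um subrr mulr0 => /esym/eqP.
by rewrite mulf_eq0 subr_eq0 (negbTE u1) /= => /eqP.
Qed.

(** Expanding both determinants leaves products of character sums. Strict decrease forces the two
    permutations to agree, and the remaining sum over one permutation gives n!. *)
Lemma alternant_orthogonality (al be : 'I_n -> nat) :
  strict_decr al -> strict_decr be ->
  (forall i, al i <= m)%N -> (forall i, be i <= m)%N ->
  \sum_(f : index) alternant al (torus_pt w f) * (alternant be (torus_pt w f))^* =
  (m.+1 ^ n * n`!)%:R * [forall i, al i == be i]%:R.
Proof.
move=> Hal Hbe alm bem.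
have altE (ga : 'I_n -> nat) (z : 'I_n -> C) : alternant ga z =
    \sum_(s : {perm 'I_n}) (-1) ^+ s * \prod_j z j ^+ ga ((s^-1)%g j).
  apply: eq_bigr => s _; congr (_ * _); rewrite [RHS](reindex_inj (@perm_inj _ s)).
  by apply: eq_bigr => i _; rewrite mxE permK.
transitivity (\sum_(s : {perm 'I_n}) \sum_(t : {perm 'I_n}) (-1) ^+ s * (-1) ^+ t *
   ((m.+1 ^ n)%:R * [forall j, al ((s^-1)%g j) == be ((t^-1)%g j)]%:R) : C).
  transitivity (\sum_(f : index) \sum_(s : {perm 'I_n}) \sum_(t : {perm 'I_n})
     (-1) ^+ s * (-1) ^+ t * \prod_j ((w ^+ f j) ^+ al ((s^-1)%g j) *
        ((w ^+ f j) ^+ be ((t^-1)%g j))^*)).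
    apply: eq_bigr => f _; rewrite !altE rmorph_sum mulr_suml; apply: eq_bigr => s _.
    rewrite mulr_sumr; apply: eq_bigr => t _.
    by rewrite rmorphM rmorph_prod rmorphXn rmorphN1 mulrACA big_split.
  rewrite exchange_big; apply: eq_bigr => s _; rewrite exchange_big; apply: eq_bigr => t _.
  rewrite -mulr_sumr; congr (_ * _).
  rewrite -(bigA_distr_bigA (fun j (x : 'I_m.+1) => (w ^+ x) ^+ al ((s^-1)%g j) *
        ((w ^+ x) ^+ be ((t^-1)%g j))^*)).
  under eq_bigr do rewrite prim_root_orthogonality //.
  rewrite big_split /= prodr_const card_ord natrX; congr (_ * _).
  case: forallP => [H|]; first by rewrite big1 // => j _; rewrite H.
  move/forallP; rewrite negb_forall => /existsP[j /negbTE jE].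
  by rewrite (bigD1 j) //= jE mul0r.
have key (s t : {perm 'I_n}) : [forall j, al ((s^-1)%g j) == be ((t^-1)%g j)] =
    (s == t) && [forall i, al i == be i].
  apply/forallP/andP => [H|[/eqP -> /forallP H] j]; last exact: H.
  have st : (t * s^-1)%g = 1%g.
    apply: (strict_decr_perm Hal Hbe) => i.
    by rewrite permM; apply/eqP; rewrite -[in be i](permK t i).
  have {}st : s = t by apply/esym/eqP; rewrite eq_mulgV1 st.
  split; first exact/eqP.
  by apply/forallP => i; have := H (t i); rewrite st permK.
under eq_bigr do under eq_bigr do rewrite key.
transitivity (\sum_(s : {perm 'I_n}) (m.+1 ^ n)%:R * [forall i, al i == be i]%:R : C).
  apply: eq_bigr => s _; rewrite (bigD1 s) //= eqxx big1 ?addr0 => [|t /negbTE st].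
    by rewrite -signr_addb addbb mul1r.
  by rewrite eq_sym st /= !mulr0.
rewrite sumr_const -[#|_|]/(#|'S_n|) card_Sn natrM -[LHS]mulr_natr; ring.
Qed.

Definition rho n (i : 'I_n) : nat := (n - i.+1)%N.

(** The alternant of the staircase is the Vandermonde determinant with its rows reversed, and the
    sign of the reversal occurs twice. The factors for (a, b) and (b, a) combine to |z_b -
    z_a|^2. *)
Lemma torus_weightE (f : index) : torus_weight w f =
  alternant (@rho n) (torus_pt w f) * (alternant (@rho n) (torus_pt w f))^*.
Proof.
set z := torus_pt w f; have z1 j : z j * (z j)^* = 1 := torus_pt_circle wm f j.
pose V : 'M[C]_n := Vandermonde n (\row_j z j).
have altV : alternant (@rho n) z = (-1) ^+ perm (@rev_ord_inj n) * \det V.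
  rewrite -det_perm -det_mulmx -row_permE; congr (\det _); apply/matrixP => i j.
  by rewrite !mxE permE.
rewrite altV rmorphM rmorphXn rmorphN1 mulrACA -signr_addb addbb mul1r.
rewrite /torus_weight -/z.
have -> : discr z * (\prod_j z j)^* ^+ n.-1 =
    \prod_(p : 'I_n * 'I_n | p.1 != p.2) (1 - z p.2 * (z p.1)^*).
  have -> : (\prod_j z j)^* ^+ n.-1 = \prod_(p : 'I_n * 'I_n | p.1 != p.2) (z p.1)^*.
    rewrite -(pair_big_dep predT (fun a b => a != b) (fun a b => (z a)^*)) /=.
    rewrite rmorph_prod -prodrXl; apply: eq_bigr => a _.
    rewrite prodr_const (_ : #|_| = n.-1) // -[in RHS](card_ord n) -(cardC1 a).
    by apply: eq_card => b; rewrite !inE eq_sym.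
  by rewrite /discr -big_split; apply: eq_bigr => p _ /=; rewrite mulrBl z1.
rewrite (bigID (fun p : 'I_n * 'I_n => (p.1 < p.2)%N)) /=.
rewrite [X in X * _](eq_bigl (fun p : 'I_n * 'I_n => p.1 < p.2)%N); last first.
  by move=> p; rewrite -val_eqE /=; case: ltngtP.
pose swap (p : 'I_n * 'I_n) := (p.2, p.1).
have swapK : involutive swap by case.
rewrite [X in _ * X](reindex_inj (inv_inj swapK)) /=.
rewrite [X in _ * X](eq_bigl (fun p : 'I_n * 'I_n => p.1 < p.2)%N); last first.
  by move=> p; rewrite -val_eqE /=; case: ltngtP.
rewrite -big_split /= det_Vandermonde rmorph_prod -big_split /=.
rewrite -(pair_big_dep predT (fun a b : 'I_n => a < b)%N (fun a b =>
  (1 - z b * (z a)^*) * (1 - z a * (z b)^*))) /=.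
apply: eq_bigr => a _; rewrite rmorph_prod -big_split; apply: eq_bigr => b _ /=.
rewrite !mxE rmorphB /=.
transitivity (1 - z a * (z b)^* - z b * (z a)^* + (z b * (z b)^*) * (z a * (z a)^*)).
  by ring.
rewrite !z1 mulr1 -[X in X - _ - _](z1 b) -(z1 a); ring.
Qed.

End TorusOrthogonality.

(** * Tableaux and Schur functions *)

Section Tableaux.
Variables (n d : nat) (a : nat -> nat).
(* A partition with at most n parts, padded with zeros. *)
Local Notation shp := {ffun 'I_n -> 'I_d.+1}.

(** The interlacing form of a horizontal strip; by itself it makes [la] weakly decreasing. *)
Definition hstrip (mu la : shp) : bool :=
  [forall i, mu i <= la i]%N &&
  [forall i : 'I_n, forall j : 'I_n, (j == i.+1 :> nat) ==> (la j <= mu i)%N].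

Definition weight (la : shp) : nat := (\sum_i la i)%N.

Definition trow (T : seq (seq nat)) (i : nat) := nth [::] T i.

Definition add_strip N (mu la : shp) (T : seq (seq nat)) :=
  [seq trow T i ++ nseq (la i - mu i) N | i : 'I_n].

Definition substrips N (la : shp) : seq shp :=
  [seq mu <- enum [the finType of shp] | hstrip mu la && (weight la == weight mu + a N)%N].

(* The tableaux of shape la, entries < N and content a; they have exactly n
   rows, possibly empty. *)
Fixpoint tabs N (la : shp) : seq (seq (seq nat)) :=
  if N is N'.+1 then
    [seq add_strip N' mu la T | mu <- substrips N' la, T <- tabs N' mu]
  else if weight la == 0%N then [:: nseq n [::]] else [::].

(** [tab_col] expresses strictness of columns by counting. For sorted rows it is equivalent to the
    entrywise form ([sorted_column]), it applies to empty rows as well, and it survives the removal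
    of the largest entries. *)
Record is_tab N (la : shp) (T : seq (seq nat)) : Prop := IsTab {
  tab_size : size T = n;
  tab_sorted : forall i : 'I_n, sorted leq (trow T i);
  tab_row : forall i : 'I_n, size (trow T i) = la i;
  tab_lt : forall i : 'I_n, all (fun x => x < N)%N (trow T i);
  tab_col : forall i j : 'I_n, j = i.+1 :> nat -> forall v,
    (count (fun x => x <= v) (trow T j) <= count (fun x => x < v) (trow T i))%N;
  tab_content : forall v, (v < N)%N ->
    (\sum_(i < n) count_mem v (trow T i))%N = a v }.

Lemma row_add_strip N mu la T (i : 'I_n) :
  trow (add_strip N mu la T) i = trow T i ++ nseq (la i - mu i) N.
Proof.
rewrite /trow /add_strip /image_mem (nth_map i) ?size_enum_ord // nth_ord_enum //.
Qed.

Lemma size_add_strip N mu la T : size (add_strip N mu la T) = n.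
Proof. by rewrite size_map size_enum_ord. Qed.

Lemma count_nseq_ge (P : pred nat) k x : P x = false -> count P (nseq k x) = 0%N.
Proof. by rewrite count_nseq => ->. Qed.

Lemma count_all_lt N (s : seq nat) v : all (fun x => x < N)%N s -> (N <= v)%N ->
  count (fun x => x < v)%N s = size s.
Proof.
move=> /allP sN Nv; apply/eqP; rewrite -all_count; apply/allP => x /sN xN.
exact: leq_trans xN Nv.
Qed.

Lemma tabs_is_tab N la T : T \in tabs N la -> is_tab N la T.
Proof.
elim: N la T => [|N IHN] la T /=.
  case: eqP => // w0; rewrite inE => /eqP ->.
  have la0 i : la i = 0%N :> nat.
    by move/eqP: w0; rewrite sum_nat_eq0 => /forallP/(_ i)/= /eqP.
  have row0 i : trow (nseq n [::]) i = [::] by rewrite /trow nth_nseq; case: ifP.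
  by split=> [|i|i|i|i j _ v|//]; rewrite ?size_nseq ?row0 ?la0.
case/allpairsPdep => mu [T' []]; rewrite mem_filter => /andP[/andP[]].
case/andP=> /forallP mula /forallP lamu /eqP wla _ /IHN T't ->.
have sizeE (i : 'I_n) : (size (trow T' i) + (la i - mu i))%N = la i.
  by rewrite (tab_row T't) subnKC // mula.
have strip (i j : 'I_n) : j = i.+1 :> nat -> (la j <= mu i)%N.
  by move=> ji; have /forallP/(_ j) := lamu i; rewrite ji eqxx.
have rowE := row_add_strip N mu la T'.
split=> [|i|i|i|i j ji v|v].
- exact: size_add_strip.
- rewrite rowE (sorted_pairwise leq_trans) pairwise_cat -!(sorted_pairwise leq_trans).
  rewrite (tab_sorted T't) /= andbC; apply/andP; split.
    by elim: (la i - mu i)%N => // -[|k] //= ->; rewrite leqnn.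
  apply/allrelP => x y /(allP (tab_lt T't i)) xN /nseqP[-> _]; exact: ltnW.
- by rewrite rowE size_cat size_nseq sizeE.
- rewrite rowE all_cat all_nseq ltnSn orbT andbT.
  by apply: sub_all (tab_lt T't i) => x xN; apply: ltnW.
(* Below N the new entries are not counted. From N on, row j is counted by at most its length, and
   the strip condition la_j <= mu_i concludes. *)
- rewrite !rowE !count_cat; case: (ltngtP v N) => [vN|Nv|->].
  + rewrite !count_nseq_ge ?addn0; first exact: (tab_col T't).
      by apply/negbTE; rewrite -leqNgt ltnW.
    by apply/negbTE; rewrite -ltnNge.
  + have -> : (count (fun x => x < v) (trow T' i) + count (fun x => x < v) (nseq (la i - mu i) N) = la i)%N.
      by rewrite (count_all_lt (tab_lt T't i)) ?(ltnW Nv) // count_nseq Nv mul1n sizeE.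
    rewrite -count_cat; apply: leq_trans (count_size _ _) _.
    rewrite size_cat size_nseq sizeE.
    exact: leq_trans (strip _ _ ji) (mula _).
  + rewrite (count_all_lt (tab_lt T't i)) // (tab_row T't).
    rewrite -count_cat; apply: leq_trans (count_size _ _) _.
    rewrite size_cat size_nseq sizeE.
    by apply: leq_trans (strip _ _ ji) _; apply: leq_addr.
- rewrite ltnS leq_eqVlt => /predU1P[->|vN].
    rewrite (eq_bigr (fun i : 'I_n => (la i - mu i)%N)) => [|i _].
      by rewrite sumnB // -/(weight la) -/(weight mu) wla addKn.
    rewrite rowE count_cat count_nseq /= eqxx mul1n (_ : count _ _ = 0%N) //.
    apply/count_memPn; apply/negP => /(allP (tab_lt T't i)); by rewrite ltnn.
  rewrite -(tab_content T't vN); apply: eq_bigr => i _.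
  by rewrite rowE count_cat count_nseq_ge ?addn0 //=; apply/negbTE; rewrite neq_ltn vN orbT.
Qed.

Lemma sorted_count (P : pred nat) (s : seq nat) p :
  (forall x y, (x <= y)%N -> P y -> P x) -> sorted leq s -> (p < size s)%N ->
  P (nth 0%N s p) = (p < count P s)%N.
Proof.
move=> Pd; elim: s p => [//|x s IHs] p /= xs ps.
have := xs; rewrite (path_sortedE leq_trans) => /andP[/allP xall ss].
have [Px|nPx] := boolP (P x); last first.
  have -> : count P s = 0%N.
    apply/eqP; rewrite -leqn0 leqNgt -has_count; apply/hasPn => y ys.
    by apply: contraNN nPx; apply: Pd; apply: xall.
  case: p ps => [|p] ps /=; first exact/negbTE.
  by apply/negbTE; apply: contraNN nPx; apply: Pd; apply: xall; apply: mem_nth.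
by case: p ps => [|p] ps //=; rewrite IHs.
Qed.

Lemma sorted_split N (s : seq nat) : sorted leq s -> all (fun x => x < N.+1)%N s ->
  s = [seq x <- s | x < N]%N ++ nseq (size s - count (fun x => x < N)%N s) N.
Proof.
move=> ss sN; set P := fun x => (x < N)%N; set k := count P s.
have ks : (k <= size s)%N := count_size _ _.
apply: (@eq_from_nth _ 0%N) => [|p ps].
  by rewrite size_cat size_filter size_nseq subnKC.
have Pd x y : (x <= y)%N -> P y -> P x by apply: leq_ltn_trans.
have Pp q : (q < size s)%N -> P (nth 0%N s q) = (q < k)%N by apply: sorted_count.
have tk : [seq x <- s | P x] = take k s.
  rewrite -{1}(cat_take_drop k s) filter_cat.
  rewrite (all_filterP _); last first.
    apply/(all_nthP 0%N) => q; rewrite size_takel // => qk.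
    by rewrite nth_take // Pp // (leq_trans qk).
  rewrite (_ : [seq x <- drop k s | P x] = [::]) ?cats0 //.
  apply/eqP; rewrite -[_ == _]negbK -has_filter; apply/hasPn => x /(nthP 0%N)[q qk <-].
  by move: qk; rewrite size_drop nth_drop => qk; rewrite Pp -?leqNgt ?leq_addr // -ltn_subRL.
rewrite nth_cat tk size_takel //; case: ltnP => [pk|kp]; first by rewrite nth_take.
rewrite nth_nseq ltn_sub2r //; last exact: leq_ltn_trans kp ps.
have := allP sN _ (mem_nth 0%N ps); have := Pp p ps; rewrite ltnNge kp /P /=; lia.
Qed.

(** Deleting the entries with the largest value N leaves a smaller tableau, and the column condition
    at v = N says that the deleted cells form a horizontal strip. *)
Lemma is_tab_tabs N la T : is_tab N la T -> T \in tabs N la.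
Proof.
elim: N la T => [|N IHN] la T Tt /=.
  have row0 (i : 'I_n) : trow T i = [::].
    by case: (trow T i) (tab_lt Tt i).
  have -> : weight la == 0%N.
    by rewrite /weight big1 // => i _; rewrite -(tab_row Tt) row0.
  rewrite inE; apply/eqP/(@eq_from_nth _ [::]); rewrite (tab_size Tt) ?size_nseq //.
  by move=> i ni; rewrite nth_nseq ni; apply: (row0 (Ordinal ni)).
pose cl (i : 'I_n) := count (fun x => x < N)%N (trow T i).
have cl_le i : (cl i <= la i)%N by rewrite -(tab_row Tt) count_size.
pose mu : shp := [ffun i => inord (cl i)].
have muE i : mu i = cl i :> nat.
  by rewrite ffunE inordK //; apply: leq_ltn_trans (cl_le i) (ltn_ord _).
pose T' := [seq [seq x <- r | x < N]%N | r <- T].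
have rowE (i : 'I_n) : trow T' i = [seq x <- trow T i | x < N]%N.
  by rewrite /trow /T' (nth_map [::]) // (tab_size Tt).
have split (i : 'I_n) : trow T i = trow T' i ++ nseq (la i - mu i) N.
  by rewrite rowE muE -(tab_row Tt); apply: sorted_split (tab_sorted Tt i) (tab_lt Tt i).
have cnt (P : pred nat) (i : 'I_n) : P N = false -> count P (trow T i) = count P (trow T' i).
  by move=> PN; rewrite split count_cat count_nseq PN addn0.
have T't : is_tab N mu T'.
  split=> [|i|i|i|i j ji v|v vN].
  - by rewrite size_map (tab_size Tt).
  - by rewrite rowE; apply: sorted_filter leq_trans _ _ (tab_sorted Tt i).
  - by rewrite rowE size_filter muE.
  - by rewrite rowE filter_all.
  - have [vN|Nv] := ltnP v N.
      rewrite -!cnt; first exact: (tab_col Tt).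
        by apply/negbTE; rewrite -leqNgt ltnW.
      by apply/negbTE; rewrite -ltnNge.
    apply: leq_trans (count_size _ _) _.
    rewrite (count_all_lt _ Nv); last by rewrite rowE filter_all.
    rewrite !rowE !size_filter; apply: leq_trans (leq_trans _ (tab_col Tt ji N)) _ => //.
    by apply: sub_count => x /= /ltnW.
  - rewrite -(tab_content Tt (ltnW vN)); apply: eq_bigr => i _; rewrite cnt //.
    by apply/negbTE; rewrite /= neq_ltn vN orbT.
apply/allpairsPdep; exists mu, T'; split; last 1 first.
- apply: (@eq_from_nth _ [::]); rewrite (tab_size Tt) ?size_add_strip // => i ni.
  rewrite -[RHS]/(trow _ (Ordinal ni)) row_add_strip.
  exact: (split (Ordinal ni)).
- rewrite mem_filter mem_enum andbT; apply/andP; split.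
    apply/andP; split; first by apply/forallP => i; rewrite muE.
    apply/forallP => i; apply/forallP => j; apply/implyP => /eqP ji.
    rewrite muE; apply: leq_trans (tab_col Tt ji N); rewrite -(tab_row Tt).
    rewrite (_ : count _ _ = size (trow T j)) //.
    by apply/eqP; rewrite -all_count; apply: sub_all (tab_lt Tt j).
  rewrite -(tab_content Tt (ltnSn N)) /weight -big_split; apply/eqP/eq_bigr => i _ /=.
  rewrite split count_cat count_nseq /= eqxx mul1n (_ : count_mem N (trow T' i) = 0%N).
    by rewrite add0n subnKC // muE.
  by apply/count_memPn; rewrite rowE mem_filter ltnn.
- exact: IHN.
Qed.

Lemma uniq_tabs N la : uniq (tabs N la).
Proof.
elim: N la => [|N IHN] la /=; first by case: ifP.
apply: allpairs_uniq_dep => [|mu _|]; first by rewrite filter_uniq ?enum_uniq.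
  exact: IHN.
move=> _ _ /allpairsPdep[mu1 [T1 [s1 t1 ->]]] /allpairsPdep[mu2 [T2 [s2 t2 ->]]] /= E.
have {}t1 := tabs_is_tab t1; have {}t2 := tabs_is_tab t2.
have rowE (i : 'I_n) : trow T1 i = trow T2 i.
  have := congr1 (fun T => [seq x <- trow T i | x < N]%N) E.
  rewrite !row_add_strip !filter_cat.
  rewrite (all_filterP (tab_lt t1 i)) (all_filterP (tab_lt t2 i)).
  have f0 k : [seq x <- nseq k N | x < N]%N = [::].
    by elim: k => //= k ->; rewrite ltnn.
  by rewrite !f0 !cats0.
have T12 : T1 = T2.
  apply: (@eq_from_nth _ [::]); rewrite (tab_size t1) ?(tab_size t2) // => i ni.
  exact: rowE (Ordinal ni).
have mu12 : mu1 = mu2.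
  by apply/ffunP => i; apply: val_inj; rewrite /= -(tab_row t1) -(tab_row t2) rowE.
by rewrite T12 mu12.
Qed.

End Tableaux.

(** * Iterated Pieri rule and Kostka numbers *)

Section ShapePieri.
Variables (C : fieldType) (n d : nat) (a : nat -> nat) (z : 'I_n -> C).
Local Notation shp := {ffun 'I_n -> 'I_d.+1}.

Definition shape_alternant (la : shp) : C :=
  alternant (fun i => la i + rho i)%N z.

Lemma decr_shape (la : shp) :
  (forall i j : 'I_n, j = i.+1 :> nat -> (la j <= la i)%N) ->
  strict_decr (fun i => la i + rho i)%N.
Proof.
move=> dec i j ij; rewrite /rho.
suff : (la j <= la i)%N by have := ltn_ord j; lia.
have [m jm] : exists m, (j = i + m :> nat)%N by exists (j - i)%N; lia.
elim: m j jm {ij} => [|m IHm] j jm.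
  by rewrite (_ : j = i) //; apply: val_inj; rewrite /= jm addn0.
have hn : (i + m < n)%N by have := ltn_ord j; lia.
apply: leq_trans (IHm (Ordinal hn) _) => //.
by apply: dec; rewrite /= jm addnS.
Qed.

(** This is [pieri] for the exponents mu_i + rho_i. Since rho drops by one from row to row, the
    strict inequality there becomes la_j <= mu_i. The bound by d ensures that no shape of the sum is
    cut off. *)
Lemma shape_pieri (mu : shp) k :
  (forall i j : 'I_n, j = i.+1 :> nat -> (mu j <= mu i)%N) ->
  (weight mu + k <= d)%N ->
  inv_coef (psi predT z) k * shape_alternant mu =
  \sum_(la : shp | hstrip mu la && (weight la == weight mu + k)%N) shape_alternant la.
Proof.
move=> dec bound; pose D := (d + n).+1.
have mud i : (mu i <= weight mu)%N by rewrite /weight (bigD1 i) //= leq_addr.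
rewrite (pieri z (decr_shape dec) (D := D)); first last.
- by rewrite /D ltnS; lia.
- by move=> i; rewrite /D /rho; have := mud i; lia.
pose h (la : shp) : {ffun 'I_n -> 'I_D} := [ffun i => inord (la i - mu i)%N].
pose h' (f : {ffun 'I_n -> 'I_D}) : shp := [ffun i => inord (mu i + f i)%N].
have hE la i : h la i = (la i - mu i)%N :> nat.
  by rewrite ffunE inordK //; have := ltn_ord (la i); rewrite /D; lia.
have h'E (f : {ffun 'I_n -> 'I_D}) i : (\sum_i f i = k)%N -> h' f i = (mu i + f i)%N :> nat.
  move=> fk; rewrite ffunE inordK // ltnS.
  have fi : (f i <= k)%N by rewrite -fk (bigD1 i) //= leq_addr.
  by have := mud i; lia.
rewrite (reindex_onto h h') /=; last first.
  move=> f /andP[_ /eqP fk]; apply/ffunP => i; apply: ord_inj.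
  by rewrite hE h'E // addKn.
have sumE (la : shp) : (forall i, mu i <= la i)%N -> weight la = (weight mu + \sum_i h la i)%N.
  move=> le; rewrite /weight -big_split; apply: eq_bigr => i _ /=.
  by rewrite hE subnKC.
have eqn (la : shp) : (forall i, mu i <= la i)%N -> h' (h la) = la.
  move=> le; apply/ffunP => i; apply: ord_inj.
  by rewrite ffunE hE subnKC //= inord_val.
have cond (la : shp) : [forall i, mu i <= la i]%N ->
  [forall i : 'I_n, forall j : 'I_n, (j == i.+1 :> nat) ==>
     (mu j + rho j + h la j < mu i + rho i)%N] =
  [forall i : 'I_n, forall j : 'I_n, (j == i.+1 :> nat) ==> (la j <= mu i)%N].
  move/forallP => le; apply: eq_forallb => i; apply: eq_forallb => j.
  case: eqP => //= ji; rewrite hE /rho ji.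
  by apply/idP/idP; have := le j; have := ltn_ord j; lia.
apply: eq_big => la; last first.
  case/andP=> /andP[_ /eqP hk] /eqP hla; rewrite /shape_alternant; congr (alternant _ z).
  apply/funext => i; rewrite -{2}hla h'E //; lia.
rewrite /hstrip; have [le|nle] := boolP [forall i, mu i <= la i]%N.
  rewrite cond // eqn ?eqxx ?andbT; last exact/forallP.
  by rewrite (sumE la (forallP le)) eqn_add2l.
apply/negbTE; apply: contraNN nle => /andP[/andP[_ /eqP hk] /eqP hla].
by apply/forallP => i; rewrite -hla h'E // leq_addr.
Qed.

Lemma tabs_weight N (la : shp) T : T \in tabs a N la ->
  weight la = (\sum_(j < N) a j)%N.
Proof.
elim: N la T => [|N IHN] la T /=.
  by rewrite big_ord0; case: eqP.
case/allpairsPdep => mu [T' [+ /IHN wmu _]].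
by rewrite mem_filter big_ord_recr /= -wmu => /andP[/andP[_ /eqP]].
Qed.

Lemma tabs_decr N (la : shp) T : T \in tabs a N la ->
  forall i j : 'I_n, j = i.+1 :> nat -> (la j <= la i)%N.
Proof.
move=> /tabs_is_tab Tt i j ji.
rewrite -!(tab_row Tt) -(count_all_lt (tab_lt Tt i) (leqnn N)).
apply: leq_trans (tab_col Tt ji N); rewrite (_ : count _ _ = size (trow T j)) //.
by apply/eqP; rewrite -all_count; apply: sub_all (tab_lt Tt j) => x /ltnW.
Qed.

(** A tableau is a chain of horizontal strips, one for each entry, so the numbers of tableaux are
    Kostka numbers K and this is h_a a_rho = sum of K(la, a) a_(la + rho). *)
Lemma iter_pieri N : (\sum_(j < N) a j <= d)%N ->
  (\prod_(j < N) inv_coef (psi predT z) (a j)) * alternant (@rho n) z =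
  \sum_(la : shp) (size (tabs a N la))%:R * shape_alternant la.
Proof.
elim: N => [_|N IHN]; last first.
  rewrite !big_ord_recr /= => bound.
  rewrite mulrAC IHN; last exact: leq_trans (leq_addr _ _) bound.
  rewrite mulr_suml.
  transitivity (\sum_(mu : shp) \sum_(la : shp | hstrip mu la && (weight la == weight mu + a N)%N)
     (size (tabs a N mu))%:R * shape_alternant la).
    apply: eq_bigr => mu _; rewrite -mulr_sumr -mulrA.
    (* A shape with a tableau is decreasing and has the weight that [shape_pieri] asks for; other
       shapes have coefficient 0. *)
    case E: (tabs a N mu) => [|T s]; first by rewrite /= !mul0r.
    have Tmu : T \in tabs a N mu by rewrite E mem_head.
    rewrite [_ * inv_coef _ _]mulrC shape_pieri //; first exact: tabs_decr Tmu.
    by rewrite (tabs_weight Tmu).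
  rewrite (exchange_big_dep xpredT) //=; apply: eq_bigr => la _.
  rewrite -mulr_suml -natr_sum size_allpairs_dep sumnE big_map /substrips big_filter.
  congr (_%:R * _); rewrite big_enum_cond /=; exact: eq_bigl.
rewrite big_ord0 mul1r (bigD1 [ffun=> ord0]) //= big1 ?addr0 => [|la la0].
  rewrite /shape_alternant /weight big1 => [|i _]; last by rewrite ffunE.
  by rewrite mul1r; congr (alternant _ z); apply/funext => i; rewrite ffunE.
case: eqP => [w0|]; last by rewrite mul0r.
case/eqP: la0; apply/ffunP => i; rewrite ffunE; apply: ord_inj.
by move/eqP: w0; rewrite sum_nat_eq0 => /forallP/(_ i)/= /eqP.
Qed.

End ShapePieri.

(** * Coefficients of Schur functions as numbers of tableaux *)

Section SchurTabs.
Variables (C : comNzRingType) (n d : nat).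
Local Notation shp := {ffun 'I_n -> 'I_d.+1}.

Definition shape_of (la : seq nat) : shp := [ffun i : 'I_n => inord (nth 0%N la i)].

(** In a sorted list the entry at position p is below v iff more than p entries are. The converse
    takes v to be the entry of s in question. *)
Lemma sorted_column (r s : seq nat) : sorted leq r -> sorted leq s ->
  (size s <= size r)%N ->
  [forall j : 'I_(size s), nth 0%N r j < nth 0%N s j]%N <->
  (forall v, count (fun x => x <= v) s <= count (fun x => x < v) r)%N.
Proof.
move=> sr ss le_sr.
have leP v p : (p < size s)%N -> (nth 0%N s p <= v)%N = (p < count (fun x => x <= v)%N s)%N.
  by apply: (sorted_count (P := fun x => (x <= v)%N)) => // x y; apply: leq_trans.
have ltP v p : (p < size r)%N -> (nth 0%N r p < v)%N = (p < count (fun x => x < v)%N r)%N.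
  by apply: (sorted_count (P := fun x => (x < v)%N)) => // x y; apply: leq_ltn_trans.
split=> [/forallP H v|H].
  case E: (count _ s) => [//|c].
  have cs : (c < size s)%N by rewrite -E count_size.
  rewrite -ltP ?(leq_trans cs) //; apply: leq_trans (H (Ordinal cs)) _ => /=.
  by rewrite leP // E.
apply/forallP => j; rewrite ltP; last exact: leq_trans (ltn_ord j) le_sr.
by apply: leq_trans (H _); rewrite -leP.
Qed.

(** Tableaux in [schur] have one row for each part, those in [tabs] have n rows; adding and dropping
    empty rows is the bijection. Entries stay below N because the content a vanishes from N on. *)
Lemma schur_tabs la (a : monom) N : is_part la -> (size la <= n)%N ->
  (forall i, nth 0%N la i <= d)%N -> (forall j, (N <= j)%N -> a j = 0%N) ->
  schur C la a = (size (tabs a N (shape_of la)))%:R.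
Proof.
move=> /andP[las la0] lan lad aN.
have shE (i : 'I_n) : shape_of la i = nth 0%N la i :> nat.
  by rewrite ffunE inordK // ltnS.
pose cut (T : seq (seq nat)) := take (size la) T.
have rowz T (i : 'I_n) : is_tab a N (shape_of la) T -> (size la <= i)%N -> trow T i = [::].
  by move=> Tt lai; apply/eqP; rewrite -size_eq0 (tab_row Tt) shE nth_default.
have laS i : (nth 0%N la i.+1 <= nth 0%N la i)%N.
  have [il|li] := ltnP i.+1 (size la); last by rewrite nth_default.
  by have /(sortedP 0%N)/(_ i il) := las.
pose pad (T : seq (seq nat)) := T ++ nseq (n - size la)%N [::].
have padE T (i : nat) : trow (pad T) i = trow T i.
  rewrite /trow nth_cat nth_nseq; case: ltnP => // Ti.
  by rewrite nth_default //; case: ifP.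
have cutK T : is_tab a N (shape_of la) T -> pad (cut T) = T.
  move=> Tt; rewrite /pad /cut -[RHS](cat_take_drop (size la)); congr (_ ++ _).
  apply: (@eq_from_nth _ [::]); rewrite size_nseq ?size_drop ?(tab_size Tt) // => i il.
  rewrite nth_nseq il nth_drop.
  have ni : (size la + i < n)%N by rewrite -ltn_subRL.
  exact/esym/(rowz T (Ordinal ni) Tt)/leq_addr.
have padK T : size T = size la -> cut (pad T) = T.
  by move=> sT; rewrite /cut /pad take_size_cat.
have core T : size T = size la ->
    (is_ssyt la T /\ forall j, count_mem j (flatten T) = a j) <->
    is_tab a N (shape_of la) (pad T).
  move=> sT.
  have cntE v : (\sum_(i < n) count_mem v (trow T i))%N = count_mem v (flatten T).
    rewrite count_flatten sumnE big_map (big_nth [::]) big_mkord sT.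
    rewrite (big_ord_widen _ (fun i => count_mem v (nth [::] T i)) lan) [RHS]big_mkcond.
    apply: eq_bigr => i _; case: ltnP => // li.
    by rewrite /trow nth_default // sT.
  have trow0 i : (size la <= i)%N -> trow T i = [::].
    by move=> li; rewrite /trow nth_default // sT.
  split=> [[/and3P[/eqP shT /allP soT /(sortedP [::]) colT] cT]|Tt].
    have szT i : size (trow T i) = nth 0%N la i.
      have [il|li] := ltnP i (size la); last by rewrite trow0 // nth_default.
      by rewrite -shT (nth_map [::]) // sT.
    have srt i : sorted leq (trow T i).
      have [il|li] := ltnP i (size la); last by rewrite trow0.
      by apply: soT; apply: mem_nth; rewrite sT.
    split=> [|i|i|i|i j ji v|v vN].
    - by rewrite size_cat size_nseq sT subnKC.
    - by rewrite padE.
    - by rewrite padE szT shE.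
    - rewrite padE; apply/allP => x xi; rewrite ltnNge; apply/negP => Nx.
      have := cntE x; rewrite cT aN // => /eqP; rewrite sum_nat_eq0 => /forallP/(_ i)/=.
      by move/eqP/count_memPn; rewrite xi.
    - rewrite !padE ji.
      have [jl|lj] := ltnP i.+1 (size la); last by rewrite trow0.
      move: v; apply/sorted_column => //; first by rewrite !szT.
      by apply: colT; rewrite sT.
    - by rewrite -cT -cntE; apply: eq_bigr => i _; rewrite padE.
  have szT (i : 'I_n) : size (trow T i) = nth 0%N la i.
    by rewrite -padE (tab_row Tt) shE.
  split; last first.
    move=> j; rewrite -cntE; have [Nj|jN] := leqP N j; last first.
      by rewrite -(tab_content Tt jN); apply: eq_bigr => i _; rewrite padE.
    rewrite aN // big1 // => i _; apply/count_memPn; apply/negP.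
    rewrite -padE => /(allP (tab_lt Tt i)); by rewrite ltnNge Nj.
  apply/and3P; split.
  - apply/eqP/(@eq_from_nth _ 0%N); rewrite size_map sT // => i il.
    by rewrite (nth_map [::]) ?sT // -(szT (Ordinal (leq_trans il lan))).
  - apply/(all_nthP [::]) => i; rewrite sT => il.
    by have := tab_sorted Tt (Ordinal (leq_trans il lan)); rewrite padE.
  - apply/(sortedP [::]) => i; rewrite sT => il.
    have ni := leq_trans il lan; have ni' := ltnW ni.
    apply/sorted_column.
    + by have := tab_sorted Tt (Ordinal ni'); rewrite padE.
    + by have := tab_sorted Tt (Ordinal ni); rewrite padE.
    + by have := szT (Ordinal ni); have := szT (Ordinal ni'); rewrite /trow /= => -> ->.
    + move=> v; have := tab_col Tt (i := Ordinal ni') (j := Ordinal ni) erefl v.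
      by rewrite !padE.
pose S := [seq cut T | T <- tabs a N (shape_of la)].
have uS : uniq S.
  rewrite map_inj_in_uniq ?uniq_tabs // => T1 T2 /tabs_is_tab t1 /tabs_is_tab t2 E.
  by rewrite -(cutK _ t1) E cutK.
have memS T : (T \in S) <-> (is_ssyt la T /\ forall j, count_mem j (flatten T) = a j).
  split=> [/mapP[T0 /tabs_is_tab t0 ->]|H].
    by apply/core; rewrite ?cutK // size_takel // (tab_size t0).
  have sT : size T = size la.
    by case: H => /and3P[/eqP <- _ _] _; rewrite size_map.
  apply/mapP; exists (pad T); last by rewrite padK.
  by apply: is_tab_tabs; apply/core.
rewrite /schur (_ : mkset _ = [set` S]); last first.
  by apply/seteqP; split=> T /= H; apply/memS.
by rewrite -fsbig_seq // -(size_map cut) -/S -(sum1_size S) natr_sum.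
Qed.

End SchurTabs.

Definition degree (a : monom) : nat := (\sum_(j <- finsupp a) a j)%N.

Lemma monom_bound (a : monom) : exists N, forall j, (N <= j)%N -> a j = 0%N.
Proof.
exists (\max_(j <- finsupp a) j)%N.+1 => j jN; apply: fsfun_dflt; apply/negP => ja.
by have := leq_bigmax_seq (F := id) j ja erefl; rewrite leqNgt jN.
Qed.

Lemma degreeE (a : monom) N : (forall j, (N <= j)%N -> a j = 0%N) ->
  (\sum_(j < N) a j)%N = degree a.
Proof.
move=> aN; rewrite /degree -(big_mkord xpredT (fun j => a j)).
rewrite (bigID (mem (finsupp a))) /= [X in (_ + X)%N]big1 ?addn0; last first.
  by move=> j; apply: fsfun_dflt.
rewrite -big_filter; apply: perm_big; apply: uniq_perm.
- by rewrite filter_uniq ?iota_uniq.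
- exact: fset_uniq.
move=> j; rewrite mem_filter mem_index_iota /=; case: (boolP (j \in _)) => //= ja.
by rewrite ltnNge; apply/negP => /aN aj0; move: ja; rewrite mem_finsupp aj0 eqxx.
Qed.

Lemma sorted_nonzero_cat (s : seq nat) : sorted geq s ->
  s = [seq x <- s | x != 0%N] ++ nseq (size s - size [seq x <- s | x != 0%N]) 0%N.
Proof.
have gt_tr : transitive geq by move=> x y z yx xz; apply: leq_trans xz yx.
elim: s => [|x s IHs] //= xs.
have := xs; rewrite (path_sortedE gt_tr) => /andP[/allP xall ss].
case: eqP => [x0|_] /=; last by rewrite subSS -IHs.
have s0 : s = nseq (size s) 0%N.
  by apply/all_pred1P/allP => y /xall; rewrite x0 /= -leqn0.
have -> : [seq x <- s | x != 0%N] = [::] by rewrite s0; elim: (size s).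
by rewrite x0 [in LHS]s0.
Qed.

Lemma detH_wide (R : comNzRingType) n (U : 'M[R]_n) (a : monom) N :
  (forall j, (N <= j)%N -> a j = 0%N) ->
  detH U a = \prod_(j < N) inv_det_coef U (a j).
Proof.
move=> aN; rewrite -(big_mkord xpredT (fun j => inv_det_coef U (a j))).
rewrite (bigID (mem (finsupp a))) /= [X in _ * X]big1 ?mulr1; last first.
  by move=> j /fsfun_dflt ->; rewrite /inv_det_coef big_ord1 expr0 coef1.
rewrite -big_filter /detH; apply/esym/perm_big; apply: uniq_perm.
- by rewrite filter_uniq ?iota_uniq.
- exact: fset_uniq.
move=> j; rewrite mem_filter mem_index_iota /=; case: (boolP (j \in _)) => //= ja.
by rewrite ltnNge; apply/negP => /aN aj0; move: ja; rewrite mem_finsupp aj0 eqxx.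
Qed.

(** * Orthogonality of Schur functions on the unitary group *)

Section SchurOrthogonality.
Variables (C : numClosedFieldType) (n : nat).
Local Notation M := 'M[C]_n.
Local Open Scope sesquilinear_scope.

Lemma inv_det_torus m (w : C) (p : {ffun 'I_n -> 'I_m.+1}) k :
  inv_det_coef (torus_mx w p) k = inv_coef (psi predT (torus_pt w p)) k.
Proof.
rewrite /inv_det_coef /inv_coef.
suff -> : \det (1%:M - 'X *: map_mx polyC (torus_mx w p)) = psi predT (torus_pt w p) by [].
apply/polyP => r; have := char_coef_diag (\row_j torus_pt w p j) r.
rewrite /char_coef /psi_coef => ->; congr ((psi _ _)`_r).
by apply/funext => j; rewrite mxE.
Qed.

Lemma detH_torus m (w : C) (p : {ffun 'I_n -> 'I_m.+1}) (a : monom) N :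
  (forall j, (N <= j)%N -> a j = 0%N) ->
  detH (torus_mx w p) a = \prod_(j < N) inv_coef (psi predT (torus_pt w p)) (a j).
Proof.
by move=> aN; rewrite (detH_wide _ aN); apply: eq_bigr => j _; rewrite inv_det_torus.
Qed.

(** On the torus the weight is a_rho conj(a_rho), so each factor det H takes one alternant and is
    expanded by [iter_pieri]; orthogonality of alternants leaves the diagonal terms. *)
Lemma haar_detH_tabs (T : (M -> C) -> C) (a b : monom) N d : haar_functional T ->
  (forall j, (N <= j)%N -> a j = 0%N) -> (forall j, (N <= j)%N -> b j = 0%N) ->
  (degree a <= d)%N -> (degree b <= d)%N ->
  T (fun V => detH V a * (detH V b)^*) = T (fun=> 1) *
  \sum_(la : {ffun 'I_n -> 'I_d.+1}) (size (tabs a N la))%:R * (size (tabs b N la))%:R.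
Proof.
move=> HT aN bN ad bd.
have Hf := char_span_mul (char_span_detH C n a) (char_span_conj (char_span_detH C n b)).
have [m0 weyl] := weyl_integration Hf.
(* Large enough for the integration formula and for every exponent la_i + rho_i. *)
pose m := (m0 + d + n)%N; have [w wm] := exists_prim_root C (ltn0Sn m).
have m0m : (m0 <= m)%N by rewrite /m -addnA leq_addr.
have := weyl m w m0m wm T HT.
pose c : C := (m.+1 ^ n * n`!)%:R.
have c0 : c != 0 by rewrite pnatr_eq0 -lt0n muln_gt0 expn_gt0 fact_gt0.
have rhom (i : 'I_n) : (rho i <= m)%N by rewrite /rho /m; have := ltn_ord i; lia.
have rhod : strict_decr (@rho n).
  move=> i j ij; rewrite /rho; have := ltn_ord j; lia.
have -> : \sum_(p : {ffun 'I_n -> 'I_m.+1}) torus_weight w p = c.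
  under eq_bigr do rewrite (torus_weightE wm).
  rewrite (alternant_orthogonality wm) // (introT forallP) ?mulr1 // => i; exact: eqxx.
pose K (e : monom) (la : {ffun 'I_n -> 'I_d.+1}) : C := (size (tabs e N la))%:R.
pose al (la : {ffun 'I_n -> 'I_d.+1}) (i : 'I_n) : nat := (la i + rho i)%N.
have ald la i : (al la i <= m)%N.
  have le1 : (la i <= d)%N by rewrite -ltnS.
  apply: leq_trans (leq_add le1 (leq_subr _ _)) _.
  by rewrite /m -addnA leq_addl.
have KE (e : monom) (p : {ffun 'I_n -> 'I_m.+1}) : (forall j, (N <= j)%N -> e j = 0%N) ->
    (degree e <= d)%N ->
    detH (torus_mx w p) e * alternant (@rho n) (torus_pt w p) =
    \sum_la K e la * alternant (al la) (torus_pt w p).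
  move=> eN ed; rewrite (detH_torus _ _ eN) (iter_pieri _ (d := d)) //.
  by rewrite degreeE.
have -> : \sum_(p : {ffun 'I_n -> 'I_m.+1})
     (detH (torus_mx w p) a * (detH (torus_mx w p) b)^*) * torus_weight w p =
    c * \sum_la K a la * K b la.
  transitivity (\sum_(p : {ffun 'I_n -> 'I_m.+1}) \sum_la \sum_mu K a la * K b mu *
     (alternant (al la) (torus_pt w p) * (alternant (al mu) (torus_pt w p))^*)).
    apply: eq_bigr => p _; rewrite (torus_weightE wm) mulrACA -rmorphM !KE //.
    rewrite rmorph_sum mulr_suml; apply: eq_bigr => la _; rewrite mulr_sumr.
    by apply: eq_bigr => mu _; rewrite rmorphM rmorph_nat mulrACA.
  rewrite exchange_big mulr_sumr; apply: eq_bigr => la _ /=.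
  rewrite exchange_big /=.
  transitivity (\sum_mu K a la * K b mu * (c * (la == mu)%:R)).
    apply: eq_bigr => mu _; rewrite -mulr_sumr.
    (* A shape without tableaux contributes 0; one with tableaux is decreasing, as orthogonality
       requires. *)
    case Ea : (tabs a N la) => [|T1 s1]; first by rewrite /K Ea !mul0r.
    case Eb : (tabs b N mu) => [|T2 s2]; first by rewrite /K Eb mulr0 !mul0r.
    have t1 : T1 \in tabs a N la by rewrite Ea mem_head.
    have t2 : T2 \in tabs b N mu by rewrite Eb mem_head.
    rewrite (alternant_orthogonality wm).
    - congr (_ * (_ * _%:R)); congr (nat_of_bool _).
      apply/forallP/eqP => [H|-> //]; apply/ffunP => i; apply: ord_inj.
      by apply/eqP; have := H i; rewrite /al eqn_add2r.
    - exact: decr_shape (tabs_decr t1).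
    - exact: decr_shape (tabs_decr t2).
    - exact: ald.
    - exact: ald.
  rewrite (bigD1 la) //= eqxx mulr1 big1 ?addr0 => [|mu /negbTE mula].
    by rewrite mulrC.
  by rewrite eq_sym mula !mulr0.
by rewrite mulrCA mulrC => /(mulfI c0).
Qed.

Definition shape_part d (la : {ffun 'I_n -> 'I_d.+1}) : seq nat :=
  [seq x <- [seq (la i : nat) | i : 'I_n] | x != 0%N].

Lemma shape_partK d (la : {ffun 'I_n -> 'I_d.+1}) :
  (forall i j : 'I_n, j = i.+1 :> nat -> (la j <= la i)%N) ->
  [/\ is_part (shape_part la), (size (shape_part la) <= n)%N &
      shape_of n d (shape_part la) = la].
Proof.
move=> dec; set s := [seq (la i : nat) | i : 'I_n].
have sn : size s = n by rewrite size_map size_enum_ord.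
have snth (i : 'I_n) : nth 0%N s i = la i.
  by rewrite (nth_map i) ?size_enum_ord // nth_ord_enum.
have ss : sorted geq s.
  apply/(sortedP 0%N) => i; rewrite sn => ni.
  rewrite (snth (Ordinal (ltnW ni))) (snth (Ordinal ni)); exact: dec.
have gt_tr : transitive geq by move=> x y z yx xz; apply: leq_trans xz yx.
have sE : s = shape_part la ++ nseq (n - size (shape_part la)) 0%N.
  by rewrite -[X in (X - _)%N]sn; apply: sorted_nonzero_cat.
have le_n : (size (shape_part la) <= n)%N by rewrite size_filter (leq_trans (count_size _ _)) ?sn.
split=> //.
  apply/andP; split; first exact: sorted_filter gt_tr _ _ ss.
  by rewrite mem_filter eqxx.
apply/ffunP => i; apply: ord_inj; rewrite ffunE.
have -> : nth 0%N (shape_part la) i = la i.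
  rewrite -snth sE nth_cat; case: ltnP => // ?.
  by rewrite nth_nseq if_same nth_default.
by rewrite inord_val.
Qed.

Lemma shape_ofK d la : is_part la -> (size la <= n)%N ->
  (forall i, nth 0%N la i <= d)%N ->
  shape_part (shape_of n d la) = la.
Proof.
move=> /andP[_ la0] lan lad; rewrite /shape_part.
have -> : [seq (shape_of n d la i : nat) | i : 'I_n] = la ++ nseq (n - size la) 0%N.
  apply: (@eq_from_nth _ 0%N).
    by rewrite size_map size_enum_ord size_cat size_nseq subnKC.
  rewrite size_map size_enum_ord => i ni.
  rewrite (nth_map (Ordinal ni)) ?size_enum_ord // nth_cat nth_nseq if_same.
  rewrite (nth_ord_enum _ (Ordinal ni)) ffunE inordK ?ltnS //=.
  by case: ltnP => // li; rewrite nth_default.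
rewrite filter_cat (all_filterP _); last first.
  by apply/allP => x xla; apply: contraNneq la0 => <-.
by rewrite (_ : [seq x <- nseq _ _ | _] = [::]) ?cats0 //; elim: (n - _)%N.
Qed.

Definition parts_upto d : seq (seq nat) :=
  [seq shape_part la | la : {ffun 'I_n -> 'I_d.+1} <- enum [the finType of {ffun 'I_n -> 'I_d.+1}] &
     [forall i : 'I_n, forall j : 'I_n, (j == i.+1 :> nat) ==> (la j <= la i)%N]].

Lemma schur_degree (R : comNzRingType) la (a : monom) : is_part la -> schur R la a <> 0 ->
  sumn la = degree a.
Proof.
move=> la_part; have [N aN] := monom_bound a.
pose d := (\max_(x <- la) x)%N.
have lad i : (nth 0%N la i <= d)%N.
  have [il|li] := ltnP i (size la); last by rewrite nth_default.
  by apply: (leq_bigmax_seq (F := id)) => //; apply: mem_nth.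
rewrite (schur_tabs R la_part (leqnn _) lad aN).
case E : (tabs _ _ _) => [|T s] // _.
have tT : T \in tabs a N (shape_of (size la) d la) by rewrite E mem_head.
rewrite -(degreeE aN) -(tabs_weight tT) /weight sumnE (big_nth 0%N) big_mkord.
by apply: eq_bigr => i _; rewrite ffunE inordK // ltnS.
Qed.

Lemma nth_sumn (s : seq nat) i : (nth 0%N s i <= sumn s)%N.
Proof.
elim: s i => [|x s IHs] [|i] //=; first exact: leq_addr.
exact: leq_trans (IHs i) (leq_addl _ _).
Qed.

Lemma mem_parts_upto d la : la \in parts_upto d <->
  [/\ is_part la, (size la <= n)%N & forall i, (nth 0%N la i <= d)%N].
Proof.
split=> [/mapP[sh]|[pa sz le]].
  rewrite mem_filter => /andP[/forallP dec _] ->.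
  have [|pa sz E] := shape_partK (la := sh).
    by move=> i j /eqP ji; have /forallP/(_ j) := dec i; rewrite ji.
  split=> // i; have [il|li] := ltnP i (size (shape_part sh)); last by rewrite nth_default.
  have : nth 0%N (shape_part sh) i \in shape_part sh by apply: mem_nth.
  by rewrite mem_filter => /andP[_ /mapP[j _ ->]]; rewrite -ltnS.
apply/mapP; exists (shape_of n d la); last by rewrite shape_ofK.
rewrite mem_filter mem_enum andbT; apply/forallP => i; apply/forallP => j.
apply/implyP => /eqP ji; rewrite !ffunE !inordK ?ltnS // ji.
have [il|li] := ltnP i.+1 (size la); last by rewrite nth_default.
by case/andP: pa => /(sortedP 0%N)/(_ i il).
Qed.

Lemma uniq_parts_upto d : uniq (parts_upto d).
Proof.
rewrite map_inj_in_uniq; first by apply/filter_uniq/enum_uniq.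
move=> s1 s2.
rewrite !mem_filter => /andP[/forallP d1 _] /andP[/forallP d2 _] E.
have [|_ _ <-] := shape_partK (la := s1).
  by move=> i j /eqP ji; have /forallP/(_ j) := d1 i; rewrite ji.
have [|_ _ <-] := shape_partK (la := s2).
  by move=> i j /eqP ji; have /forallP/(_ j) := d2 i; rewrite ji.
by rewrite E.
Qed.

Theorem haar_schur_orthogonality (T : (M -> C) -> C) (a b : monom) d :
  haar_functional T -> (degree a <= d)%N -> (degree b <= d)%N ->
  T (fun V => detH V a * (detH V b)^*) =
  T (fun=> 1) * \sum_(la <- parts_upto d) schur C la a * schur C la b.
Proof.
move=> HT ad bd; have [Na aN] := monom_bound a; have [Nb bN] := monom_bound b.
pose N := maxn Na Nb.
have {}aN j : (N <= j)%N -> a j = 0%N by rewrite geq_max => /andP[/aN].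
have {}bN j : (N <= j)%N -> b j = 0%N by rewrite geq_max => /andP[_ /bN].
rewrite (haar_detH_tabs HT aN bN ad bd); congr (_ * _).
rewrite big_map big_filter big_enum_cond /=.
rewrite (bigID (fun la : {ffun 'I_n -> 'I_d.+1} =>
  [forall i : 'I_n, forall j : 'I_n, (j == i.+1 :> nat) ==> (la j <= la i)%N])) /=.
rewrite [X in _ + X]big1 ?addr0 => [|la nd]; last first.
  case E : (tabs a N la) => [|T1 s1]; first by rewrite mul0r.
  have t1 : T1 \in tabs a N la by rewrite E mem_head.
  case/negP: nd; apply/forallP => i; apply/forallP => j; apply/implyP => /eqP.
  exact: tabs_decr t1 i j.
apply: eq_big => // la /forallP dec.
have [|pa sz E] := shape_partK (la := la).
  by move=> i j /eqP ji; have /forallP/(_ j) := dec i; rewrite ji.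
have le i : (nth 0%N (shape_part la) i <= d)%N.
  have /mem_parts_upto[_ _] : shape_part la \in parts_upto d; last exact.
  by apply: map_f; rewrite mem_filter mem_enum andbT; apply/forallP.
by rewrite (schur_tabs C pa sz le aN) (schur_tabs C pa sz le bN) E.
Qed.

End SchurOrthogonality.

(** * 2-quotients *)

Section TwoQuotient.
Implicit Types (la mu nu B : seq nat).

(** [beta_runner] with a free number m of beta-numbers, so that all partitions with at most 2l parts
    can be treated with the same m = 2l. *)
Definition run (r : bool) m la : seq nat :=
  [seq b./2 | b <- beta_set m la & odd b == r].

Lemma is_part_nth la i j : is_part la -> (i <= j)%N -> (nth 0%N la j <= nth 0%N la i)%N.
Proof.
case/andP=> las _ ij; have [jl|lj] := ltnP j (size la); last by rewrite nth_default.
have gt_tr : transitive geq by move=> x y z yx xz; apply: leq_trans xz yx.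
by apply: (sorted_leq_nth gt_tr (fun x => leqnn x) 0%N las) => //;
  rewrite inE // (leq_ltn_trans ij).
Qed.

Lemma size_beta_set m la : size (beta_set m la) = m.
Proof. exact: size_mkseq. Qed.

Lemma beta_setS m la : (size la <= m)%N ->
  beta_set m.+1 la = rcons (map succn (beta_set m la)) 0%N.
Proof.
move=> lam; rewrite /beta_set mkseqS nth_default // subnn addn0; congr rcons.
rewrite /mkseq -map_comp; apply/eq_in_map => i; rewrite mem_iota /= => im.
by rewrite -addnS subnSK.
Qed.

Lemma beta_set_cons m p la : beta_set m.+1 (p :: la) = (p + m)%N :: beta_set m la.
Proof.
rewrite /beta_set /mkseq /= subSS subn0; congr (_ :: _).
rewrite -[1%N]addn0 iotaDl -map_comp; apply/eq_map => i /=.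
by rewrite subSS.
Qed.

Lemma sorted_beta_set m la : is_part la -> sorted gtn (beta_set m la).
Proof.
move=> pla; apply/(sortedP 0%N) => i; rewrite size_beta_set => im.
rewrite /beta_set !nth_mkseq ?(ltnW im) //=.
by have := is_part_nth pla (leqnSn i); lia.
Qed.

Lemma part_of_beta_set m la : is_part la -> (size la <= m)%N ->
  part_of_beta (beta_set m la) = la.
Proof.
move=> /andP[_ la0] lam; rewrite /part_of_beta size_beta_set.
have -> : mkseq (fun i => nth 0 (beta_set m la) i - (m - i.+1))%N m =
    la ++ nseq (m - size la) 0%N.
  apply: (@eq_from_nth _ 0%N).
    by rewrite size_mkseq size_cat size_nseq subnKC.
  rewrite size_mkseq => i im; rewrite nth_mkseq // /beta_set nth_mkseq // addnK.
  by rewrite nth_cat nth_nseq if_same; case: ltnP => // ?; rewrite nth_default.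
rewrite filter_cat (all_filterP _); last first.
  by apply/allP => x xla; apply: contraNneq la0 => <-.
by rewrite (_ : [seq x <- nseq _ _ | _] = [::]) ?cats0 //; elim: (m - _)%N.
Qed.

Lemma sorted_gtn_nth B i j : sorted gtn B -> (i < j)%N -> (j < size B)%N ->
  (nth 0%N B j + (j - i) <= nth 0%N B i)%N.
Proof.
move=> /(sortedP 0%N) sB; elim: j => // j IHj; rewrite ltnS leq_eqVlt.
case/predU1P=> [->|ij] jB; first by have := sB j jB; rewrite /=; lia.
by have := IHj ij (ltnW jB); have := sB j jB; rewrite /=; lia.
Qed.

Lemma sorted_gtn_ge B i : sorted gtn B -> (i < size B)%N ->
  (size B - i.+1 <= nth 0%N B i)%N.
Proof.
move=> sB iB; have [e|iB'] := eqVneq i.+1 (size B); first by rewrite e subnn.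
have := @sorted_gtn_nth B i (size B).-1 sB; lia.
Qed.

Lemma part_of_betaP B : sorted gtn B ->
  [/\ is_part (part_of_beta B), (size (part_of_beta B) <= size B)%N &
      beta_set (size B) (part_of_beta B) = B].
Proof.
move=> sB; set P := mkseq (fun i => nth 0 B i - (size B - i.+1))%N (size B).
have gt_tr : transitive geq by move=> x y z yx xz; apply: leq_trans xz yx.
have sP : sorted geq P.
  apply/(sortedP 0%N) => i; rewrite size_mkseq => iB.
  rewrite !nth_mkseq ?(ltnW iB) //=; have := sorted_gtn_nth sB (ltnSn i) iB.
  have := sorted_gtn_ge sB iB; have := sorted_gtn_ge sB (ltnW iB); lia.
have PE := sorted_nonzero_cat sP.
have nthP i : nth 0%N (part_of_beta B) i = nth 0%N P i.
  rewrite [in RHS]PE nth_cat -/(part_of_beta B) nth_nseq if_same.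
  by case: ltnP => // ?; rewrite nth_default.
split.
- apply/andP; split; first exact: sorted_filter gt_tr _ _ sP.
  by rewrite mem_filter eqxx.
- by rewrite size_filter (leq_trans (count_size _ _)) ?size_mkseq.
- apply: (@eq_from_nth _ 0%N); rewrite size_beta_set // => i iB.
  rewrite /beta_set nth_mkseq // nthP nth_mkseq // subnK //.
  exact: sorted_gtn_ge.
Qed.

Lemma part_of_beta_rcons B : part_of_beta (rcons (map succn B) 0%N) = part_of_beta B.
Proof.
rewrite /part_of_beta size_rcons size_map mkseqS filter_rcons subnn.
rewrite nth_rcons size_map ltnn eqxx subn0 /=; congr (seq.filter _ _).
apply/eq_in_map => i; rewrite mem_iota /= => iB.
by rewrite nth_rcons size_map iB (nth_map 0%N) // subSS -(subnSK iB) subSS.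
Qed.

(** Two more beta-numbers shift the old ones by 2, hence the halves by 1, and add the numbers 1 and
    0, that is a bead at 0 on each runner. Hence the quotients depend only on the parity of m. *)
Lemma runS r m la : (size la <= m)%N ->
  run r m.+2 la = rcons (map succn (run r m la)) 0%N.
Proof.
move=> lam; rewrite /run beta_setS ?leqW // beta_setS //.
rewrite map_rcons -!cats1 -catA filter_cat map_cat /=; congr (_ ++ _); last by case: r.
rewrite -map_comp filter_map -!map_comp.
rewrite (@eq_filter _ _ (fun b => odd b == r)); last by move=> b /=; rewrite negbK.
by apply: eq_map => b /=.
Qed.

Lemma run_double r m k la : (size la <= m)%N ->
  part_of_beta (run r (m + k.*2) la) = part_of_beta (run r m la) /\
  size (run r (m + k.*2) la) = (size (run r m la) + k)%N.
Proof.
move=> lam; elim: k => [|k [IH1 IH2]]; first by rewrite !addn0.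
rewrite doubleS !addnS runS; last exact: leq_trans lam (leq_addr _ _).
by rewrite part_of_beta_rcons size_rcons size_map IH1 IH2.
Qed.

Lemma two_quotient_run r m la : (size la <= m.*2)%N ->
  two_quotient r la = part_of_beta (run r m.*2 la).
Proof.
move=> lam; rewrite /two_quotient /beta_runner -/(run r (size la).*2 la).
have le2 : (size la <= (size la).*2)%N by rewrite -addnn leq_addr.
have [<- _] := run_double r m le2; have [<- _] := run_double r (size la) lam.
by rewrite addnC.
Qed.

Lemma size_run m la : (size (run false m la) + size (run true m la))%N = m.
Proof.
rewrite /run !size_map !size_filter -[RHS](size_beta_set m la).
rewrite -(count_predC (fun b => odd b == false)); congr (_ + _)%N.
by apply: eq_count => b /=; case: odd.
Qed.

Lemma run_nil r m : size (run r m.*2 [::]) = m.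
Proof.
have [_] := run_double r m (leqnn 0%N : (size (Nil nat) <= 0)%N).
by rewrite add0n => ->; rewrite /run.
Qed.

Definition beads (R0 R1 : seq nat) : seq nat :=
  sort geq ([seq x.*2 | x <- R0] ++ [seq x.*2.+1 | x <- R1]).

Lemma size_beads R0 R1 : size (beads R0 R1) = (size R0 + size R1)%N.
Proof. by rewrite size_sort size_cat !size_map. Qed.

Lemma sorted_beads R0 R1 : uniq R0 -> uniq R1 -> sorted gtn (beads R0 R1).
Proof.
move=> u0 u1; have dblI : injective double by move=> x y /(congr1 half); rewrite !doubleK.
have tot : total geq by move=> x y; apply: leq_total.
rewrite gtn_sorted_uniq_geq sort_sorted // andbT sort_uniq.
rewrite cat_uniq !map_inj_uniq //=; last by move=> x y [/dblI].
rewrite u0 u1 andbT; apply/hasPn => _ /mapP[s _ ->]; apply/mapP => -[t _ /(congr1 odd)].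
by rewrite /= !odd_double.
Qed.

Lemma perm_beads_runner r R0 R1 :
  perm_eq [seq b./2 | b <- beads R0 R1 & odd b == r] (if r then R1 else R0).
Proof.
have/(perm_map half) := perm_filter (fun b => odd b == r) (permEl (perm_sort geq
  ([seq x.*2 | x <- R0] ++ [seq x.*2.+1 | x <- R1]))).
move=> /perm_trans; apply; rewrite filter_cat map_cat !filter_map -!map_comp.
have f0 (R : seq nat) : [seq i <- R | preim double (fun b => odd b == r) i] =
    if r then [::] else R.
  by case: r; elim: R => //= x R ->; rewrite odd_double.
have f1 (R : seq nat) : [seq i <- R | preim (fun x => x.*2.+1) (fun b => odd b == r) i] =
    if r then R else [::].
  by case: r {f0}; elim: R => //= x R ->; rewrite odd_double.
rewrite f0 f1; case: r {f0 f1} => /=; rewrite ?cats0.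
  by rewrite (eq_map (g := id)) ?map_id // => x /=; rewrite uphalf_double.
by rewrite (eq_map (g := id)) ?map_id // => x /=; rewrite doubleK.
Qed.

Lemma sorted_runner r B : sorted gtn B ->
  sorted gtn [seq b./2 | b <- B & odd b == r].
Proof.
have gt_tr : transitive gtn by move=> x y z yx xz; apply: ltn_trans xz yx.
move=> sB; rewrite sorted_map.
apply: (@sub_in_sorted _ (fun b => odd b == r) gtn); last exact: sorted_filter.
  by move=> x y /= /eqP ox /eqP oy; rewrite -{1}(odd_double_half x)
    -{1}(odd_double_half y) ox oy ltn_add2l ltn_double.
exact: filter_all.
Qed.

Lemma beads_runner r R0 R1 : sorted gtn R0 -> sorted gtn R1 ->
  [seq b./2 | b <- beads R0 R1 & odd b == r] = if r then R1 else R0.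
Proof.
move=> s0 s1; have gt_tr : transitive gtn by move=> x y z yx xz; apply: ltn_trans xz yx.
have gt_irr : irreflexive gtn by move=> x; apply: ltnn.
have u0 := sorted_uniq gt_tr gt_irr s0; have u1 := sorted_uniq gt_tr gt_irr s1.
apply: (irr_sorted_eq gt_tr gt_irr); first exact/sorted_runner/sorted_beads.
  by case: r.
exact/perm_mem/perm_beads_runner.
Qed.

Lemma beads_of_runners B : sorted gtn B ->
  beads [seq b./2 | b <- B & odd b == false] [seq b./2 | b <- B & odd b == true] = B.
Proof.
move=> sB; have gt_tr : transitive gtn by move=> x y z yx xz; apply: ltn_trans xz yx.
have gt_irr : irreflexive gtn by move=> x; apply: ltnn.
apply: (irr_sorted_eq gt_tr gt_irr) => //.
  by apply: sorted_beads; apply: (sorted_uniq gt_tr gt_irr); apply: sorted_runner.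
move=> x; rewrite mem_sort mem_cat; apply/orP/idP => [[]|xB].
- move=> /mapP[_ /mapP[b + ->] ->]; rewrite mem_filter => /andP[/eqP ob bB].
  by have := odd_double_half b; rewrite ob add0n => ->.
- move=> /mapP[_ /mapP[b + ->] ->]; rewrite mem_filter => /andP[/eqP ob bB].
  by have := odd_double_half b; rewrite ob add1n => ->.
case ox : (odd x); [right|left]; apply/mapP; exists x./2.
- by apply: map_f; rewrite mem_filter ox.
- by rewrite -{1}(odd_double_half x) ox.
- by apply: map_f; rewrite mem_filter ox.
- by rewrite -{1}(odd_double_half x) ox.
Qed.

(** In the core the beads are pushed down on both runners. It is empty iff they fill an initial
    segment of even length, that is iff the runners carry equally many. *)
Lemma two_core_beads la : (two_core la == [::]) =
  (size (beta_runner false la) == size (beta_runner true la)).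
Proof.
set s0 := size (beta_runner false la); set s1 := size (beta_runner true la).
have s01 : (s0 + s1 = (size la).*2)%N := size_run _ _.
set B := beads (iota 0 s0) (iota 0 s1); rewrite -[two_core la]/(part_of_beta B).
have sB : sorted gtn B by apply: sorted_beads; apply: iota_uniq.
have szB : size B = (size la).*2 by rewrite size_beads !size_iota.
apply/eqP/eqP => [B0|e].
  have [_ _ BE] := part_of_betaP sB.
  have cnt r : size (if r then iota 0 s1 else iota 0 s0) = size la.
    rewrite -(perm_size (perm_beads_runner r _ _)) -/B -BE B0 szB; exact: run_nil.
  by have := cnt true; have := cnt false; rewrite /= !size_iota => -> ->.
(* With equal numbers the largest bead is below the number of beads, so the strictly decreasing
   beads are the staircase itself and every part is 0. *)
apply/eqP; rewrite -[_ == _]negbK -has_filter; apply/hasPn => _ /mapP[i + ->].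
rewrite mem_iota /= add0n => iB; rewrite negbK subn_eq0.
have n0 : (0 < size B)%N := leq_ltn_trans (leq0n i) iB.
have B0s : (nth 0%N B 0 < size B)%N.
  move: (mem_nth 0%N n0); rewrite {1}/B mem_sort mem_cat => /orP[] /mapP[x]; rewrite mem_iota add0n => /andP[_ xs] ->.
    by rewrite szB; move: xs; rewrite -/s0; lia.
  by rewrite szB; move: xs; rewrite -/s1; lia.
case: i iB => [|i] iB; first by lia.
by have := sorted_gtn_nth sB (ltn0Sn i) iB; lia.
Qed.

Lemma two_core_run m la : (size la <= m.*2)%N ->
  (two_core la == [::]) = (size (run false m.*2 la) == size (run true m.*2 la)).
Proof.
move=> lam; rewrite two_core_beads /beta_runner -/(run false (size la).*2 la) -/(run true (size la).*2 la).
have le2 : (size la <= (size la).*2)%N by rewrite -addnn leq_addr.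
have e r : (size (run r (size la).*2 la) + m = size (run r m.*2 la) + size la)%N.
  have [_ <-] := run_double r m le2; have [_ <-] := run_double r (size la) lam.
  by rewrite addnC.
by apply/eqP/eqP; have := e true; have := e false; lia.
Qed.

(* The inverse of la |-> (two_quotient false la, two_quotient true la) on
   partitions with at most 2l parts and trivial core *)
Definition unquotient l mu nu : seq nat :=
  part_of_beta (beads (beta_set l mu) (beta_set l nu)).

Lemma unquotientP l mu nu : is_part mu -> (size mu <= l)%N -> is_part nu ->
  (size nu <= l)%N -> let la := unquotient l mu nu in
  [/\ is_part la, (size la <= l.*2)%N, two_core la = [::],
      two_quotient false la = mu & two_quotient true la = nu].
Proof.
move=> pmu lmu pnu lnu la.
have gt_tr : transitive gtn by move=> x y z yx xz; apply: ltn_trans xz yx.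
have gt_irr : irreflexive gtn by move=> x; apply: ltnn.
have s0 := sorted_beta_set l pmu; have s1 := sorted_beta_set l pnu.
have sB := sorted_beads (sorted_uniq gt_tr gt_irr s0) (sorted_uniq gt_tr gt_irr s1).
have [pla]:= part_of_betaP sB; rewrite size_beads !size_beta_set addnn => szla BE.
have runE r : run r l.*2 la = beta_set l (if r then nu else mu).
  by rewrite /run BE beads_runner //; case: r.
split=> //.
- by apply/eqP; rewrite (two_core_run szla) !runE !size_beta_set.
- by rewrite (two_quotient_run _ szla) runE part_of_beta_set.
- by rewrite (two_quotient_run _ szla) runE part_of_beta_set.
Qed.

Lemma two_quotientP l la : is_part la -> (size la <= l.*2)%N -> two_core la = [::] ->
  [/\ is_part (two_quotient false la), (size (two_quotient false la) <= l)%N,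
      is_part (two_quotient true la), (size (two_quotient true la) <= l)%N &
      unquotient l (two_quotient false la) (two_quotient true la) = la].
Proof.
move=> pla szla /eqP; rewrite (two_core_run szla) => /eqP e.
(* Trivial core means equally many beads on the two runners, hence l on each. *)
have := size_run l.*2 la; rewrite -e addnn => /(congr1 half); rewrite !doubleK => e0.
have {}e1 : size (run true l.*2 la) = l by rewrite -e.
have sB := sorted_beta_set l.*2 pla.
have [p0 z0] := part_of_betaP (sorted_runner false sB).
have [p1 z1] := part_of_betaP (sorted_runner true sB).
rewrite -/(run true l.*2 la) -/(run false l.*2 la) e0 e1 in p0 z0 p1 z1 * => E1 E0.
rewrite !(two_quotient_run _ szla) /unquotient E0 E1; split=> //.
by rewrite beads_of_runners // part_of_beta_set.
Qed.

Lemma size_dbl_part la : size (dbl_part la) = (size la).*2.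
Proof. by rewrite /dbl_part; elim: la => //= p la ->. Qed.

(** Two parts 2p in front of the doubled [la] give the beta-numbers 2(p + size la) + 1 and 2(p +
    size la): one bead on each runner, both at p + size la, which is the first beta-number of
    [p :: la]. *)
Lemma dbl_part_quotient la : is_part la ->
  two_core (dbl_part la) = [::] /\ forall r, two_quotient r (dbl_part la) = la.
Proof.
move=> pla; have sz := leqnn (size (dbl_part la)); rewrite [X in (_ <= X)%N]size_dbl_part in sz.
have runE r : run r (size la).*2 (dbl_part la) = beta_set (size la) la.
  rewrite /run; elim: la {pla sz} => [|p la IHla]; first by case: r.
  have -> : beta_set (size (p :: la)).*2 (dbl_part (p :: la)) =
     [:: (p + size la).*2.+1, (p + size la).*2 & beta_set (size la).*2 (dbl_part la)].
    rewrite -[(size (p :: la)).*2]/((size la).*2.+2).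
    rewrite -[dbl_part (p :: la)]/[:: p.*2, p.*2 & dbl_part la] !beta_set_cons.
    by rewrite addnS -doubleD.
  rewrite beta_set_cons /= odd_double.
  by case: r IHla => /= IHla; rewrite ?uphalf_double ?doubleK IHla.
split=> [|r].
  by apply/eqP; rewrite (two_core_run sz) !runE.
by rewrite (two_quotient_run _ sz) runE part_of_beta_set.
Qed.

End TwoQuotient.

(** * Products of series *)

(** The product of the truncated inverses of p and q inverts p q modulo X^(k+1). *)
Lemma inv_coef_mul (R : comNzRingType) (p q : {poly R}) k : p`_0 = 1 -> q`_0 = 1 ->
  inv_coef (p * q) k = \sum_(i < k.+1) inv_coef p i * inv_coef q (k - i).
Proof.
move=> p0 q0; pose S (t : {poly R}) := \sum_(i < k.+1) (1 - t) ^+ i.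
have SE (t : {poly R}) : t`_0 = 1 -> exists r : {poly R}, t * S t = 1 - 'X^(k.+1) * r.
  move=> t0; exists ((drop_poly 1 (1 - t)) ^+ k.+1).
  have -> : t * S t = 1 - (1 - t) ^+ k.+1.
    by rewrite -[RHS]opprB subrX1 -mulNr opprB subKr.
  rewrite -exprMn mulrC -[in LHS](poly_take_drop 1 (1 - t)).
  rewrite [X in (X + _) ^+ _](_ : _ = 0) ?add0r //.
  apply/polyP => i; rewrite coef_take_poly coef0; case: i => //=.
  by rewrite coefB coef1 t0 subrr.
have [r1 e1] := SE p p0; have [r2 e2] := SE q q0.
have pq0 : (p * q)`_0 = 1 by rewrite coef0M p0 q0 mulr1.
have E : p * q * (S p * S q) = 1%:P + 'X^(k.+1) * ('X^(k.+1) * r1 * r2 - r1 - r2).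
  by rewrite mulrACA e1 e2 polyC1; ring.
have := inv_coef_quotient pq0 E (ltnSn k); rewrite mulr1 => <-.
rewrite coefM; apply: eq_bigr => i _.
by rewrite /S !inv_coef_wide // ?leq_subr // -ltnS.
Qed.

Section Splits.

Definition mk_monom N (g : nat -> nat) : monom :=
  [fsfun j in seq_fset tt (iota 0 N) => g j].

Lemma mk_monomE N g j : mk_monom N g j = if (j < N)%N then g j else 0%N.
Proof. by rewrite fsfunE seq_fsetE mem_iota. Qed.

Definition split_set (a : monom) : set (monom * monom) :=
  [set bc : monom * monom | forall j, (bc.1 j + bc.2 j)%N = a j].

Section SplitEnum.
Variables (a : monom) (N d : nat).
Hypotheses (aN : forall j, (N <= j)%N -> a j = 0%N) (ad : forall j, (a j <= d)%N).
Local Notation code := {ffun 'I_N -> 'I_d.+1}.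

Definition code_fun (g : code) (j : nat) : nat := oapp (fun i => g i : nat) 0%N (insub j).

Lemma code_funE (g : code) (i : 'I_N) : code_fun g i = g i.
Proof. by rewrite /code_fun valK. Qed.

Definition split_of (g : code) : monom * monom :=
  (mk_monom N (code_fun g), mk_monom N (fun j => a j - code_fun g j)%N).

(** A factorization of the monomial a is coded by the exponents of its first factor, bounded by d
    and supported below N. This turns the sum in [fps_mul] into a sum over a list. *)
Definition splits : seq (monom * monom) :=
  [seq split_of g | g : code <- enum [the finType of code] & [forall j, g j <= a j]%N].

Lemma uniq_splits : uniq splits.
Proof.
rewrite map_inj_uniq; first by apply/filter_uniq/enum_uniq.
move=> g1 g2 [E _]; apply/ffunP => i; apply: ord_inj.
have := congr1 (fun h : monom => h i) E.
by rewrite !mk_monomE ltn_ord !code_funE.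
Qed.

Lemma mem_splits bc : bc \in splits <-> split_set a bc.
Proof.
split=> [/mapP[g]|bcE].
  rewrite mem_filter => /andP[/forallP Hg _] -> j /=; rewrite !mk_monomE.
  case: ltnP => jN; last by rewrite aN.
  by rewrite -[j]/(Ordinal jN : nat) code_funE subnKC.
pose g : code := [ffun i : 'I_N => inord (bc.1 i)].
have gE (i : 'I_N) : g i = bc.1 i :> nat.
  by rewrite ffunE inordK // ltnS (leq_trans _ (ad i)) // -(bcE i) leq_addr.
apply/mapP; exists g.
  rewrite mem_filter mem_enum andbT; apply/forallP => i.
  by rewrite gE -(bcE i) leq_addr.
have bc0 j : (N <= j)%N -> bc.1 j = 0%N /\ bc.2 j = 0%N.
  by move=> jN; have := bcE j; rewrite aN // => /eqP; rewrite addn_eq0 => /andP[/eqP-> /eqP->].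
rewrite [LHS]surjective_pairing /split_of; congr pair; apply/fsfunP => j;
  rewrite mk_monomE; case: ltnP => jN; try by have [] := bc0 j jN.
  by rewrite -[j]/(Ordinal jN : nat) code_funE gE.
by rewrite -[j]/(Ordinal jN : nat) code_funE gE -(bcE j) addKn.
Qed.

Lemma fps_mulE (R : comNzRingType) (f g : monom -> R) :
  fps_mul f g a = \sum_(bc <- splits) f bc.1 * g bc.2.
Proof.
rewrite /fps_mul (_ : mkset _ = [set` splits]); last first.
  by apply/seteqP; split=> bc /= H; apply/mem_splits.
by rewrite -fsbig_seq // uniq_splits.
Qed.

(** The hypothesis is the identity in one variable. Distributing the product over the variables
    chooses an exponent for each of them, that is a splitting of a. *)
Lemma detH_mul (R : comNzRingType) n n1 n2 (U : 'M[R]_n) (V1 : 'M[R]_n1) (V2 : 'M[R]_n2) :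
  (forall k, inv_det_coef U k =
     \sum_(i < k.+1) inv_det_coef V1 i * inv_det_coef V2 (k - i)) ->
  detH U a = \sum_(bc <- splits) detH V1 bc.1 * detH V2 bc.2.
Proof.
move=> mulE; rewrite (detH_wide U aN).
pose F (j : 'I_N) (i : 'I_d.+1) := inv_det_coef V1 i * inv_det_coef V2 (a j - i)%N.
rewrite (eq_bigr (fun j : 'I_N => \sum_(i : 'I_d.+1 | (i <= a j)%N) F j i)); last first.
  move=> j _; rewrite mulE /F.
  rewrite (big_ord_widen d.+1 (fun i => inv_det_coef V1 i * inv_det_coef V2 (a j - i)%N)) //.
  by rewrite ltnS.
rewrite (bigA_distr_big_dep (fun (j : 'I_N) (i : 'I_d.+1) => (i <= a j)%N)).
rewrite big_map big_filter big_enum_cond /=.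
apply: eq_big => [g|g /familyP Hg].
  by apply/familyP/forallP => H j; have := H j.
rewrite (detH_wide V1 (N := N)); last by move=> j jN; rewrite mk_monomE ltnNge jN.
rewrite (detH_wide V2 (N := N)); last by move=> j jN; rewrite mk_monomE ltnNge jN.
rewrite -big_split; apply: eq_bigr => j _ /=.
by rewrite !mk_monomE ltn_ord code_funE.
Qed.

End SplitEnum.

Lemma degree_split (a b c : monom) : split_set a (b, c) ->
  (degree b <= degree a)%N /\ (degree c <= degree a)%N.
Proof.
move=> bc; have [N aN] := monom_bound a.
have bc0 j : (N <= j)%N -> b j = 0%N /\ c j = 0%N.
  by move=> jN; have := bc j; rewrite aN //= => /eqP; rewrite addn_eq0 => /andP[/eqP-> /eqP->].
rewrite -(degreeE aN) -(degreeE (fun j jN => (bc0 j jN).1)) -(degreeE (fun j jN => (bc0 j jN).2)).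
by split; apply: leq_sum => j _; rewrite -(bc j) ?leq_addr ?leq_addl.
Qed.

Lemma monom_le_degree (a : monom) j : (a j <= degree a)%N.
Proof.
have [N aN] := monom_bound a; rewrite -(degreeE aN).
have [jN|Nj] := ltnP j N; last by rewrite aN.
by rewrite (bigD1 (Ordinal jN)) //= leq_addr.
Qed.

End Splits.

Lemma inv_coef_map (R S : comNzRingType) (f : {rmorphism R -> S}) (p : {poly R}) k :
  inv_coef (map_poly f p) k = f (inv_coef p k).
Proof.
rewrite /inv_coef -coef_map rmorph_sum /=; congr ((_ : {poly S})`_k); apply: eq_bigr => i _.
by rewrite rmorphXn rmorphB rmorph1.
Qed.

Lemma detH_adjoint (C : numClosedFieldType) n (U : 'M[C]_n) (a : monom) :
  detH (U ^t*)%sesqui a = (detH U a)^*.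
Proof.
rewrite /detH rmorph_prod; apply: eq_bigr => j _.
rewrite -[LHS]/(inv_coef _ (a j)) -[inv_det_coef U _]/(inv_coef _ (a j)) -inv_coef_map.
congr (inv_coef _ _); rewrite -det_map_mx -[RHS]det_tr; congr (\det _).
apply/matrixP => i k; rewrite !mxE rmorphB rmorphM /= map_polyX map_polyC rmorph_nat /=.
by rewrite eq_sym.
Qed.

(** * Integration against Haar measures *)

Lemma normc_ge_Im (R : rcfType) (x : R[i]) : `|complex.Im x|%:C%C <= `|x|.
Proof.
by rewrite normc_def lecR -sqrtr_sqr ler_wsqrtr // lerDr sqr_ge0.
Qed.

Section BorelMatrices.
Variables (R : realType) (n : nat).
Local Notation C := (Cplx R).
Local Notation M := 'M[C]_n.

Lemma open_Re_gt (x : R) : open [set z : C | x < complex.Re z].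
Proof.
rewrite openE => z /= xz; apply/nbhs_ballP; exists (complex.Re z - x)%:C%C => /=.
  by rewrite ltcR subr_gt0.
move=> y; rewrite /ball /= => zy.
have := le_lt_trans (normc_ge_Re (z - y)) zy; rewrite ltcR.
move=> /(le_lt_trans (ler_norm _)); rewrite raddfB /=; lra.
Qed.

Lemma open_Im_gt (x : R) : open [set z : C | x < complex.Im z].
Proof.
rewrite openE => z /= xz; apply/nbhs_ballP; exists (complex.Im z - x)%:C%C => /=.
  by rewrite ltcR subr_gt0.
move=> y; rewrite /ball /= => zy.
have := le_lt_trans (normc_ge_Im (z - y)) zy; rewrite ltcR.
move=> /(le_lt_trans (ler_norm _)); rewrite raddfB /=; lra.
Qed.

Lemma measurable_Re_entry i j :
  measurable_fun [set: borel_mx R n] (fun U : borel_mx R n => complex.Re ((U : M) i j)).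
Proof.
apply: (measurability _ (measurable_realfun.RGenOInfty.measurableE R)) => _ [_ [x ->] <-].
rewrite setTI; apply: sub_sigma_algebra.
have -> : (fun U : M => complex.Re (U i j)) @^-1` `]x, +oo[%classic =
    (fun U : M => U i j) @^-1` [set z : C | x < complex.Re z].
  by apply/seteqP; split=> U /=; rewrite in_itv /= andbT.
by apply: open_comp; [move=> U _; apply: coord_continuous|apply: open_Re_gt].
Qed.

Lemma measurable_Im_entry i j :
  measurable_fun [set: borel_mx R n] (fun U : borel_mx R n => complex.Im ((U : M) i j)).
Proof.
apply: (measurability _ (measurable_realfun.RGenOInfty.measurableE R)) => _ [_ [x ->] <-].
rewrite setTI; apply: sub_sigma_algebra.
have -> : (fun U : M => complex.Im (U i j)) @^-1` `]x, +oo[%classic =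
    (fun U : M => U i j) @^-1` [set z : C | x < complex.Im z].
  by apply/seteqP; split=> U /=; rewrite in_itv /= andbT.
by apply: open_comp; [move=> U _; apply: coord_continuous|apply: open_Im_gt].
Qed.

Lemma continuous_mulmx_entry (g : M) i j : continuous (fun U : M => (g *m U) i j).
Proof.
move=> U; have -> : (fun U : M => (g *m U) i j) = (fun U : M => \sum_k g i k * U k j).
  by apply/funext => V; rewrite mxE.
suff H s : (fun V : M => \sum_(k <- s) g i k * V k j) @ U --> (\sum_(k <- s) g i k * U k j : C).
  exact: H.
elim: s => [|k s IHs].
  rewrite big_nil (_ : (fun V : M => _) = fun=> 0); first by apply: cvg_cst; apply: nbhs_filter.
  by apply/funext => V; rewrite big_nil.
rewrite big_cons (_ : (fun V : M => _) =
  (fun V : M => g i k * V k j) \+ (fun V : M => \sum_(k <- s) g i k * V k j)).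
  apply: (@cvgD _ C) IHs.
  apply: cvgM; [by apply: cvg_cst; apply: nbhs_filter|exact: coord_continuous].
by apply/funext => V; rewrite big_cons.
Qed.

Lemma continuous_mulmx (g : M) : continuous (fun U : M => g *m U).
Proof.
move=> U A [P PU PA]; rewrite /nbhs /=.
have FU : Filter (nbhs U) := nbhs_filter U.
have H : \forall V \near U, forall i j, P i j ((g *m V) i j).
  apply: (filter_forall FU) => i; apply: (filter_forall FU) => j.
  by apply: continuous_mulmx_entry; apply: PU.
by apply: filterS H => V HV; apply: PA.
Qed.

Lemma measurable_mulmx (g : M) :
  measurable_fun [set: borel_mx R n] (fun U : borel_mx R n => g *m U : borel_mx R n).
Proof.
apply: (@measurability _ _ (borel_mx R n) (borel_mx R n) setT _ (@open M) erefl) => _ [A oA <-].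
rewrite setTI; apply: sub_sigma_algebra.
by apply: open_comp => // U _; apply: continuous_mulmx.
Qed.

End BorelMatrices.

(** * Bounded measurable functions and invariance of the integral *)

Section HaarIntegral.
Variables (R : realType) (n : nat).
Local Notation C := (Cplx R).
Local Notation M := 'M[C]_n.
Local Notation Re := complex.Re.
Local Notation Im := complex.Im.
Definition cmeasurable (D : set M) (F : M -> C) : Prop :=
  measurable_fun (D : set (borel_mx R n)) (fun U : borel_mx R n => Re (F U)) /\
  measurable_fun (D : set (borel_mx R n)) (fun U : borel_mx R n => Im (F U)).

Lemma eq_measurable_on (D : set M) (f g : borel_mx R n -> R) :
  (forall U, D U -> f U = g U) ->
  measurable_fun (D : set (borel_mx R n)) f -> measurable_fun (D : set (borel_mx R n)) g.
Proof. by move=> fg; apply: eq_measurable_fun => U /set_mem /fg. Qed.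

Lemma cmeasurable_cst D c : cmeasurable D (fun=> c).
Proof. by split; apply: measurable_cst. Qed.

Lemma cmeasurable_entry D i j : cmeasurable D (fun U => U i j).
Proof.
split; apply: measurable_funTS; first exact: measurable_Re_entry.
exact: measurable_Im_entry.
Qed.

Lemma cmeasurable_ext D F F' :
  cmeasurable D F -> (forall U, D U -> F U = F' U) -> cmeasurable D F'.
Proof.
move=> [mRe mIm] FF'; split.
  by apply: (eq_measurable_on _ mRe) => U /FF' ->.
by apply: (eq_measurable_on _ mIm) => U /FF' ->.
Qed.

Lemma ReV (z : C) : Re z^* = Re z.
Proof. by case: z. Qed.

Lemma ImV (z : C) : Im z^* = - Im z.
Proof. by case: z. Qed.

Lemma ReM (z w : C) : Re (z * w) = Re z * Re w - Im z * Im w.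
Proof. by case: z => ? ?; case: w. Qed.

Lemma ImM (z w : C) : Im (z * w) = Re z * Im w + Im z * Re w.
Proof. by case: z => ? ?; case: w. Qed.

Lemma cmeasurable_conj D F : cmeasurable D F -> cmeasurable D (fun U => (F U)^*).
Proof.
move=> [mRe mIm]; split.
  by apply: (eq_measurable_on _ mRe) => U _; rewrite ReV.
by apply: (eq_measurable_on _ (measurable_funN mIm)) => U _; rewrite ImV.
Qed.

Lemma cmeasurableD D F F' :
  cmeasurable D F -> cmeasurable D F' -> cmeasurable D (fun U => F U + F' U).
Proof.
move=> [mRe mIm] [mRe' mIm']; split.
  by apply: (eq_measurable_on _ (measurable_funD mRe mRe')) => U _; rewrite raddfD.
by apply: (eq_measurable_on _ (measurable_funD mIm mIm')) => U _; rewrite raddfD.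
Qed.

Lemma cmeasurableM D F F' :
  cmeasurable D F -> cmeasurable D F' -> cmeasurable D (fun U => F U * F' U).
Proof.
move=> [mRe mIm] [mRe' mIm']; split.
  apply: (eq_measurable_on _ (measurable_funB (measurable_funM mRe mRe') (measurable_funM mIm mIm'))).
  by move=> U _; rewrite ReM.
apply: (eq_measurable_on _ (measurable_funD (measurable_funM mRe mIm') (measurable_funM mIm mRe'))).
by move=> U _; rewrite ImM.
Qed.

Lemma cmeasurable_sum D (I : Type) (s : seq I) (F : I -> M -> C) :
  (forall i, cmeasurable D (F i)) -> cmeasurable D (fun U => \sum_(i <- s) F i U).
Proof.
move=> mF; elim: s => [|i s IHs].
  by apply: (cmeasurable_ext (cmeasurable_cst D 0)) => U _; rewrite big_nil.
by apply: (cmeasurable_ext (cmeasurableD (mF i) IHs)) => U _; rewrite big_cons.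
Qed.

Lemma measurable_zeros (I : finType) (F : I -> M -> C) :
  (forall i, cmeasurable setT (F i)) ->
  measurable ([set U | forall i, F i U = 0] : set (borel_mx R n)).
Proof.
move=> mF; rewrite (_ : mkset _ = \bigcap_(i in [set: I])
  (((fun U : borel_mx R n => Re (F i U)) @^-1` [set 0]) `&`
   ((fun U : borel_mx R n => Im (F i U)) @^-1` [set 0]))).
  apply: fin_bigcap_measurable => // i _; have [mRe mIm] := mF i.
  by apply: measurableI; rewrite -[X in measurable X]setTI; [apply: mRe|apply: mIm].
apply/seteqP; split=> U /= H i; first by move=> _; rewrite /= H.
by have /= [] := H i Logic.I; case: (F i U) => x y /= -> ->.
Qed.

Variables (G : set M) (mu : probability (borel_mx R n) R).

(** Boundedness rather than integrability, because it is stable under products; the entries of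
    unitary matrices are bounded. *)
Definition tame (F : M -> C) : Prop :=
  cmeasurable G F /\ exists c, forall U, G U -> `|Re (F U)| <= c /\ `|Im (F U)| <= c.

(** [expect_fps] with the monomial absorbed into F; the two are convertible. *)
Definition cint (F : M -> C) : C :=
  Complex (\int[mu]_(U in G) Re (F U)) (\int[mu]_(U in G) Im (F U)).

Lemma tame_cst c : tame (fun=> c).
Proof.
split; first exact: cmeasurable_cst.
by exists (Num.max `|Re c| `|Im c|) => U _; rewrite !le_max !lexx orbT.
Qed.

Lemma tame_ext F F' : tame F -> (forall U, G U -> F U = F' U) -> tame F'.
Proof.
move=> [mF [c Hc]] FF'; split; first exact: cmeasurable_ext FF'.
by exists c => U GU; rewrite -FF' //; apply: Hc.
Qed.

Lemma tame_conj F : tame F -> tame (fun U => (F U)^*).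
Proof.
move=> [mF [c Hc]]; split; first exact: cmeasurable_conj.
by exists c => U GU; rewrite ReV ImV normrN; apply: Hc.
Qed.

Lemma tame_add F F' : tame F -> tame F' -> tame (fun U => F U + F' U).
Proof.
move=> [mF [c Hc]] [mF' [c' Hc']]; split; first exact: cmeasurableD.
exists (c + c') => U GU; have [? ?] := Hc U GU; have [? ?] := Hc' U GU.
by rewrite !raddfD; split; apply: le_trans (ler_normD _ _) _; apply: lerD.
Qed.

Lemma tame_mul F F' : tame F -> tame F' -> tame (fun U => F U * F' U).
Proof.
move=> [mF [c Hc]] [mF' [c' Hc']]; split; first exact: cmeasurableM.
exists (c * c' + c * c') => U GU; have [? ?] := Hc U GU; have [? ?] := Hc' U GU.
rewrite ReM ImM; split; [apply: le_trans (ler_normB _ _) _|apply: le_trans (ler_normD _ _) _].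
  by rewrite !normrM; apply: lerD; apply: ler_pM.
by rewrite !normrM; apply: lerD; apply: ler_pM.
Qed.

Hypothesis Gunit : forall U, G U -> U \is unitarymx.

Lemma tame_entry i j : tame (fun U => U i j).
Proof.
split; [exact: cmeasurable_entry|exists 1 => U /Gunit Uu].
have : `|U i j| <= 1.
  rewrite -(@expr_le1 _ 2) // normCK.
  have /matrixP/(_ i i) := unitarymxP Uu; rewrite !mxE eqxx mulr1n => <-.
  rewrite (bigD1 j) //= !mxE lerDl sumr_ge0 // => k _.
  by rewrite !mxE mul_conjC_ge0.
move=> le1; split; rewrite -lecR.
  exact: le_trans (normc_ge_Re _) le1.
exact: le_trans (normc_ge_Im _) le1.
Qed.

Lemma tame_comp m (V : M -> 'M[C]_m) (f : 'M[C]_m -> C) :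
  (forall i j, tame (fun U => V U i j)) -> (forall U, G U -> V U \is unitarymx) ->
  polyfun f -> tame (fun U => f (V U)).
Proof.
move=> Vt Vu; elim=> {f} [c|i j|f _ IHf|f g _ IHf _ IHg|f g _ IHf _ IHg|f g _ IHf fg].
- exact: tame_cst.
- exact: Vt.
- exact: tame_conj.
- exact: tame_add.
- exact: tame_mul.
- by apply: tame_ext IHf _ => U /Vu; apply: fg.
Qed.

Hypothesis mG : measurable (G : set (borel_mx R n)).
Hypothesis haar : is_haar G mu.

Lemma tame_integrable F : tame F ->
  mu.-integrable G (EFin \o (fun U => Re (F U))) /\
  mu.-integrable G (EFin \o (fun U => Im (F U))).
Proof.
move=> [[mRe mIm] [c Hc]].
have muG : (mu G < +oo)%E by rewrite haar.1 ltry.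
split; apply: measurable_bounded_integrable => //; exists c; split; rewrite ?num_real //.
  by move=> x cx U GU /=; apply: le_trans (Hc U GU).1 (ltW cx).
by move=> x cx U GU /=; apply: le_trans (Hc U GU).2 (ltW cx).
Qed.

Lemma cint_ext F F' : (forall U, G U -> F U = F' U) -> cint F = cint F'.
Proof.
by move=> FF'; congr Complex; apply: eq_Rintegral => U /set_mem /FF' ->.
Qed.

Lemma cint_cst c : cint (fun=> c) = c.
Proof.
have E r : \int[mu]_(_ in G) r = r.
  by rewrite Rintegral_cst // (_ : fine _ = 1) ?mulr1 // -[RHS]/(fine 1%E); congr fine; apply: haar.1.
by rewrite /cint !E; case: c.
Qed.

Lemma cintD F F' : tame F -> tame F' -> cint (fun U => F U + F' U) = cint F + cint F'.
Proof.
move=> /tame_integrable[iR iI] /tame_integrable[iR' iI'].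
rewrite /cint; under eq_Rintegral do rewrite raddfD.
by under [X in Complex _ X]eq_Rintegral do rewrite raddfD; rewrite !RintegralD.
Qed.

Lemma cintZ c F : tame F -> cint (fun U => c * F U) = c * cint F.
Proof.
move=> /tame_integrable[iR iI].
have iZ r (f : M -> R) : mu.-integrable G (EFin \o f) ->
    mu.-integrable G (EFin \o (fun U => r * f U)).
  by move=> /(integrableZl mG r); apply: eq_integrable => // U _; rewrite /= EFinM.
rewrite /cint; under eq_Rintegral do rewrite ReM.
under [X in Complex _ X]eq_Rintegral do rewrite ImM.
rewrite RintegralB ?RintegralD ?RintegralZl //; try exact: iZ.
by case: c.
Qed.

Lemma Rintegral_translate g (c : R) (f : borel_mx R n -> R) : G g ->
  (forall U, G (g *m U) <-> G U) ->
  measurable_fun (G : set (borel_mx R n)) f -> (forall U, G U -> `|f U| <= c) ->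
  \int[mu]_(U in G) f (g *m U : M) = \int[mu]_(U in G) f U.
Proof.
move=> Gg GgU mf fc; pose phi (U : borel_mx R n) : borel_mx R n := g *m U.
have mphi : measurable_fun setT phi := measurable_mulmx g.
have phiG : phi @^-1` G = G by apply/seteqP; split=> U /=; rewrite /phi GgU.
have muG : (mu G < +oo)%E by rewrite haar.1 ltry.
(* f is measurable on G only; its extension by 0 is measurable everywhere and can be integrated
   against the pushforward. *)
pose f0 : borel_mx R n -> R := f \_ G.
have f0E U : G U -> f0 U = f U by move=> GU; rewrite /f0 patchE mem_set.
have mf0 : measurable_fun setT f0 by apply/(measurable_restrictT f mG).
have mEf0 : measurable_fun setT (EFin \o f0) by apply: measurableT_comp.
have if0 : mu.-integrable (phi @^-1` G) ((EFin \o f0) \o phi).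
  rewrite phiG; apply: (measurable_bounded_integrable (f := f0 \o phi)) => //.
    by apply: measurable_funTS; apply: measurableT_comp.
  exists c; split; rewrite ?num_real // => x cx U GU /=.
  by rewrite f0E ?GgU //; apply: le_trans (fc _ _) (ltW cx); rewrite GgU.
congr fine; transitivity (\int[mu]_(U in phi @^-1` G) ((EFin \o f0) \o phi) U)%E.
  by rewrite phiG; apply: eq_integral => U /set_mem GU /=; rewrite f0E ?GgU.
rewrite -integral_pushforward //.
transitivity (\int[mu]_(U in G) (EFin \o f0) U)%E; last first.
  by apply: eq_integral => U /set_mem GU /=; rewrite f0E.
apply: eq_measure_integral => A mA AG; rewrite /pushforward.
have mphiA : measurable (phi @^-1` A) by rewrite -[X in measurable X]setTI; apply: mphi.
(* A is the translate by g of its preimage, and invariance is applied to this preimage. *)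
apply: etrans (esym (haar.2 g Gg _ mphiA)) _; congr (mu _).
have gu : g \in unitmx := unitarymx_unit (Gunit Gg).
apply/seteqP; split=> [U [V AV <-] //|U AU].
exists (invmx g *m U); last by rewrite mulKVmx.
by rewrite /phi /= mulKVmx.
Qed.

Lemma cint_translate g F : G g -> (forall U, G (g *m U) <-> G U) -> tame F ->
  cint (fun U => F (g *m U)) = cint F.
Proof.
move=> Gg GgU [[mRe mIm] [c Hc]]; congr Complex.
  by apply: (@Rintegral_translate g c (fun U => Re (F U))) => // U /Hc[].
by apply: (@Rintegral_translate g c (fun U => Im (F U))) => // U /Hc[].
Qed.

(** W maps unitary matrices of size m into G, and V is a coordinate on which W g acts as left
    multiplication by g, while the weight h stays fixed. The two factors of U(l) x U(l) and the
    group U^u(2l) are the instances. *)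
Lemma haar_functional_cint m (V : M -> 'M[C]_m) (W : 'M[C]_m -> M) (h : M -> C) :
  (forall i j, tame (fun U => V U i j)) -> (forall U, G U -> V U \is unitarymx) ->
  tame h ->
  (forall g, g \is unitarymx -> G (W g)) ->
  (forall g U, g \is unitarymx -> G U ->
     [/\ G (W g *m U), V (W g *m U) = g *m V U & h (W g *m U) = h U]) ->
  (forall g U, g \is unitarymx -> G (W g *m U) -> G U) ->
  haar_functional (fun f : 'M[C]_m -> C => cint (fun U => f (V U) * h U)).
Proof.
move=> Vt Vu ht GW WP WI.
have ft f : polyfun f -> tame (fun U => f (V U) * h U).
  by move=> pf; apply: tame_mul ht; apply: tame_comp.
split.
- move=> f f' pf pf'; rewrite -cintD; [|exact: ft|exact: ft].
  by apply: cint_ext => U _; rewrite mulrDl.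
- move=> c f pf; rewrite -cintZ; last exact: ft.
  by apply: cint_ext => U _; rewrite mulrA.
- by move=> f f' ff'; apply: cint_ext => U /Vu /ff' ->.
- move=> f g pf gu; rewrite -[RHS](@cint_translate (W g)); last exact: ft.
  + by apply: cint_ext => U GU; have [_ -> ->] := WP g U gu GU.
  + exact: GW.
  + by move=> U; split=> [|GU]; [apply: WI gu|have [] := WP g U gu GU].
Qed.

End HaarIntegral.

(** * The commutant of J *)

Section JCommutant.
Variables (C : numClosedFieldType) (l : nat).
Local Notation M := 'M[C]_(l + l).
Local Notation J := (block_mx 0 (- 1%:M) 1%:M 0 : M).

(* The columns of eigP are eigenvectors of J, for the eigenvalues i and -i. *)
Definition eigP : M := block_mx 1%:M 1%:M (- 'i)%:M 'i%:M.
Definition eigQ : M := 2^-1 *: block_mx 1%:M 'i%:M 1%:M (- 'i)%:M.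

Lemma eigPK : eigP *m eigQ = 1%:M.
Proof.
rewrite -scalemxAr mulmx_block -!scalar_mxM -!(raddfD (@scalar_mx C l)) /=.
rewrite !mul1r !mulr1 mulNr mulrN -expr2 sqrCi opprK subrr addNr !raddf0 -scalar_mx_block.
by rewrite scale_scalar_mx mulVf // pnatr_eq0.
Qed.

Lemma eigQK : eigQ *m eigP = 1%:M.
Proof. exact: mulmx1C eigPK. Qed.

Definition jdiag (V1 V2 : 'M[C]_l) : M := eigP *m block_mx V1 0 0 V2 *m eigQ.
Definition jpart1 (U : M) : 'M[C]_l := ulsubmx (eigQ *m U *m eigP).
Definition jpart2 (U : M) : 'M[C]_l := drsubmx (eigQ *m U *m eigP).

Lemma conj_jdiag V1 V2 : eigQ *m jdiag V1 V2 *m eigP = block_mx V1 0 0 V2.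
Proof. by rewrite /jdiag !mulmxA eigQK mul1mx -mulmxA eigQK mulmx1. Qed.

Lemma jpart1K V1 V2 : jpart1 (jdiag V1 V2) = V1.
Proof. by rewrite /jpart1 conj_jdiag block_mxKul. Qed.

Lemma jpart2K V1 V2 : jpart2 (jdiag V1 V2) = V2.
Proof. by rewrite /jpart2 conj_jdiag block_mxKdr. Qed.

Lemma jdiagM V1 V2 W1 W2 :
  jdiag V1 V2 *m jdiag W1 W2 = jdiag (V1 *m W1) (V2 *m W2).
Proof.
rewrite /jdiag !mulmxA -[in LHS](mulmxA _ eigQ eigP) eigQK mulmx1.
by rewrite -[in LHS](mulmxA eigP) mulmx_block !mul0mx !mulmx0 !addr0 add0r.
Qed.

Lemma jdiag1 : jdiag 1%:M 1%:M = 1%:M.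
Proof. by rewrite /jdiag -scalar_mx_block mulmx1 eigPK. Qed.

Lemma jdiagJ : jdiag 'i%:M (- 'i)%:M = J.
Proof.
rewrite /jdiag -scalemxAr !mulmx_block !mulmx0 !addr0 !add0r.
rewrite -!scalar_mxM -!(raddfD (@scalar_mx C l)) /= !scale_block_mx !scale_scalar_mx.
rewrite !mul1r !mulr1 !mulrN !mulNr -!expr2 sqrCi !opprK subrr addNr mulr0 raddf0.
by rewrite -opprD mulrN mulVf ?pnatr_eq0 // raddfN.
Qed.

Lemma jdiag_commJ V1 V2 : jdiag V1 V2 *m J = J *m jdiag V1 V2.
Proof. by rewrite -jdiagJ !jdiagM !mul_scalar_mx !mul_mx_scalar. Qed.

(** In the eigenbasis U commutes with diag(i, -i), and i differs from -i, so the off-diagonal blocks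
    vanish. *)
Lemma jpartK (U : M) : U *m J = J *m U -> jdiag (jpart1 U) (jpart2 U) = U.
Proof.
move=> UJ; pose D := eigQ *m U *m eigP.
have UE : U = eigP *m D *m eigQ.
  by rewrite /D !mulmxA eigPK mul1mx -mulmxA eigPK mulmx1.
pose d : M := block_mx 'i%:M 0 0 (- 'i)%:M.
have JE : J = eigP *m d *m eigQ by rewrite -jdiagJ.
have Dd : D *m d = d *m D.
  have : eigQ *m (U *m J) *m eigP = eigQ *m (J *m U) *m eigP by rewrite UJ.
  rewrite JE !mulmxA eigQK mul1mx -[in X in X = _](mulmxA _ eigQ eigP) eigQK mulmx1.
  by [].
rewrite /jdiag /jpart1 /jpart2 -/D; suff -> : block_mx (ulsubmx D) 0 0 (drsubmx D) = D.
  by [].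
rewrite -[RHS]submxK; move: Dd; rewrite -[in LHS](submxK D) -[in RHS](submxK D).
rewrite !mulmx_block !mulmx0 !mul0mx !addr0 !add0r !mul_mx_scalar !mul_scalar_mx.
move=> /eq_block_mx[_ /eqP ur /eqP dl _].
have two_i : (- 'i : C) - 'i != 0.
  by rewrite -opprD oppr_eq0 -mulr2n mulrn_eq0 negb_or /= neq0Ci.
congr block_mx.
  by move: ur; rewrite -subr_eq0 -scalerBl scaler_eq0 (negPf two_i) /= => /eqP.
move: dl; rewrite eq_sym -subr_eq0 -scalerBl scaler_eq0 (negPf two_i) /= => /eqP //.
Qed.

Local Notation "A ^*m" := (map_mx Num.conj A) (at level 2).

(** J is real, so conjugation exchanges its eigenspaces: the conjugate of [eigP] is [eigP] times the
    block swap s. *)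
Lemma jdiag_conj V1 V2 : (jdiag V1 V2)^*m = jdiag V2^*m V1^*m.
Proof.
pose s : M := block_mx 0 1%:M 1%:M 0.
have Pc : eigP^*m = eigP *m s.
  rewrite map_block_mx !map_scalar_mx rmorph1 rmorphN /= conjCi opprK.
  by rewrite mulmx_block !mulmx0 !mulmx1 !addr0 !add0r.
have Qc : eigQ^*m = s *m eigQ.
  rewrite map_mxZ map_block_mx !map_scalar_mx rmorph1 rmorphN /= conjCi opprK.
  rewrite -scalemxAr mulmx_block !mul0mx !mul1mx !addr0 !add0r.
  by rewrite fmorphV rmorph_nat.
rewrite /jdiag !map_mxM Pc Qc map_block_mx !map_mx0 !mulmxA.
congr (_ *m _); rewrite -!mulmxA; congr (_ *m _).
by rewrite !mulmx_block !mulmx0 !mul0mx !mulmx1 !mul1mx !addr0 !add0r.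
Qed.

(** The columns of [eigP] are orthogonal with squared norm 2, so its adjoint is twice its inverse
    and the two scalars cancel. *)
Lemma jdiag_adjoint V1 V2 : ((jdiag V1 V2) ^t*)%sesqui = jdiag (V1 ^t*)%sesqui (V2 ^t*)%sesqui.
Proof.
have Pt : (eigP ^t*)%sesqui = 2 *: eigQ.
  rewrite scalerA mulfV ?pnatr_eq0 // scale1r tr_block_mx map_block_mx !tr_scalar_mx !map_scalar_mx.
  by rewrite rmorph1 rmorphN /= conjCi opprK.
have Qt : (eigQ ^t*)%sesqui = 2^-1 *: eigP.
  rewrite linearZ /= map_mxZ tr_block_mx map_block_mx !tr_scalar_mx !map_scalar_mx.
  by rewrite rmorph1 rmorphN /= conjCi opprK fmorphV rmorph_nat.
rewrite /jdiag !trmx_mul !map_mxM Pt Qt tr_block_mx map_block_mx !trmx0 !map_mx0.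
by rewrite -scalemxAl -!scalemxAr scalerA mulfV ?pnatr_eq0 // scale1r mulmxA.
Qed.

Lemma jdiag_unitary V1 V2 :
  (jdiag V1 V2 \is unitarymx) = (V1 \is unitarymx) && (V2 \is unitarymx).
Proof.
apply/unitarymxP/andP=> [|[/unitarymxP V1u /unitarymxP V2u]]; last first.
  by rewrite jdiag_adjoint jdiagM V1u V2u jdiag1.
rewrite jdiag_adjoint jdiagM => E; split; apply/unitarymxP.
  by rewrite -[LHS](jpart1K _ (V2 *m (V2 ^t*)%sesqui)) E -jdiag1 jpart1K.
by rewrite -[LHS](jpart2K (V1 *m (V1 ^t*)%sesqui)) E -jdiag1 jpart2K.
Qed.

Lemma inv_det_coef_jdiag V1 V2 k : V1 \is unitarymx -> V2 \is unitarymx ->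
  inv_det_coef (jdiag V1 V2) k =
  \sum_(i < k.+1) inv_det_coef V1 i * inv_det_coef V2 (k - i).
Proof.
move=> V1u V2u; pose ch n (V : 'M[C]_n) := \det (1%:M - 'X *: map_mx polyC V).
rewrite -[LHS]/(inv_coef (ch _ (jdiag V1 V2)) k) (_ : ch _ _ = ch _ V1 * ch _ V2).
  by apply: inv_coef_mul; apply: char_coef0.
rewrite /ch /jdiag; pose P' := map_mx polyC eigP; pose Q' := map_mx polyC eigQ.
have PQ : P' *m Q' = 1%:M by rewrite -map_mxM eigPK map_mx1.
rewrite !map_mxM -/P' -/Q' -PQ scalemxAl scalemxAr -{1}(mulmx1 P') -mulmxBl -mulmxBr.
rewrite 2!det_mulmx mulrAC -det_mulmx PQ det1 mul1r.
rewrite map_block_mx !map_mx0 scale_block_mx !scaler0 scalar_mx_block opp_block_mx add_block_mx.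
by rewrite oppr0 !addr0 det_ublock.
Qed.

End JCommutant.

Lemma polyfun_char_span (C : numClosedFieldType) n (f : 'M[C]_n -> C) :
  char_span f -> polyfun f.
Proof.
move=> [L HL]; suff H : polyfun (fun U : 'M[C]_n => \sum_(t <- L) eval_term t U).
  by apply: (polyfun_ext H) => U /HL ->.
apply: polyfun_sum => t; apply: polyfun_mul (polyfun_cst _ _) _; apply: polyfun_mul.
  rewrite /char_mono; elim: (t.1.2) => [|r s IHs].
    by apply: (polyfun_ext (polyfun_cst n 1)) => U _; rewrite big_nil.
  by apply: (polyfun_ext (polyfun_mul (polyfun_char_coef C n r) IHs)) => U _; rewrite big_cons.
by apply: polyfun_exp; apply: polyfun_conj; apply: polyfun_char_coef.
Qed.

Lemma polyfun_detH_conj (C : numClosedFieldType) n a b :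
  polyfun (fun V : 'M[C]_n => detH V a * (detH V b)^*).
Proof.
by apply: polyfun_mul; [|apply: polyfun_conj]; apply: polyfun_char_span; apply: char_span_detH.
Qed.

Lemma detH_conj (C : numClosedFieldType) n (V : 'M[C]_n) a :
  detH (map_mx Num.conj V) a = (detH V a)^*.
Proof.
suff <- : detH V^T a = detH V a by have := detH_adjoint V^T a; rewrite trmxK.
rewrite /detH; apply: eq_bigr => j _; rewrite /inv_det_coef.
suff -> : \det (1%:M - 'X *: map_mx polyC V^T) = \det (1%:M - 'X *: map_mx polyC V) by [].
by rewrite -det_tr linearB /= linearZ /= trmx1 map_trmx trmxK.
Qed.

(** * The two groups and their unitary coordinates *)

Section Groups.
Variables (R : realType) (l : nat).
Local Notation C := (Cplx R).
Local Notation M := 'M[C]_(l + l).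
Local Notation J := (Jmx R l).

Lemma tame_sum (G : set M) (I : Type) (s : seq I) (F : I -> M -> C) :
  (forall i, tame G (F i)) -> tame G (fun U => \sum_(i <- s) F i U).
Proof.
move=> Ft; elim: s => [|i s IHs].
  by apply: (tame_ext (tame_cst G 0)) => U _; rewrite big_nil.
by apply: (tame_ext (tame_add (Ft i) IHs)) => U _; rewrite big_cons.
Qed.

Lemma tame_mulmx_entry (G : set M) (A B : M) i j :
  (forall U, G U -> U \is unitarymx) -> tame G (fun U => (A *m U *m B) i j).
Proof.
move=> Gu; have H k k' := tame_mul (tame_mul (tame_cst G (A i k')) (tame_entry Gu k' k))
  (tame_cst G (B k j)).
apply: (tame_ext (tame_sum (index_enum 'I_(l + l))
  (fun k => tame_sum (index_enum 'I_(l + l)) (H k)))) => U _.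
by rewrite mxE; apply: eq_bigr => k _; rewrite mxE mulr_suml.
Qed.

Lemma UU_jpart U : UU_group R l U ->
  [/\ jpart1 U \is unitarymx, jpart2 U \is unitarymx & jdiag (jpart1 U) (jpart2 U) = U].
Proof.
move=> [Uu UJ]; have UE := jpartK UJ.
by have := Uu; rewrite -{1}UE jdiag_unitary => /andP[].
Qed.

Lemma UU_jdiag V1 V2 : V1 \is unitarymx -> V2 \is unitarymx ->
  UU_group R l (jdiag V1 V2).
Proof. by move=> V1u V2u; split; [rewrite jdiag_unitary V1u|apply: jdiag_commJ]. Qed.

Lemma mxOver_realP (A : M) : reflect (map_mx Num.conj A = A) (A \is a mxOver Num.real).
Proof.
apply: (iffP mxOverP) => [Ar|/matrixP Ac i j].
  by apply/matrixP => i j; rewrite mxE; apply/CrealP/Ar.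
by apply/CrealP; rewrite -[RHS]Ac mxE.
Qed.

Lemma Uu_UU U : Uu_group R l U -> UU_group R l U.
Proof.
move=> [Ur UU UJ]; split=> //; apply/unitarymxP; rewrite -[RHS]UU; congr (_ *m _).
by apply/matrixP => i j; rewrite !mxE; apply/CrealP/mxOverP.
Qed.

Lemma Uu_jpart U : Uu_group R l U -> jpart2 U = map_mx Num.conj (jpart1 U).
Proof.
move=> UG; have [_ _ UE] := UU_jpart (Uu_UU UG); have [Ur _ _] := UG.
have Uc := mxOver_realP _ Ur.
by rewrite -{1}Uc -{1}UE jdiag_conj jpart2K.
Qed.

Lemma Uu_jdiag V : V \is unitarymx -> Uu_group R l (jdiag V (map_mx Num.conj V)).
Proof.
move=> Vu; have Vcu : map_mx Num.conj V \is unitarymx by rewrite conjC_unitary.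
have [Uu UJ] := UU_jdiag Vu Vcu.
have Uc : map_mx Num.conj (jdiag V (map_mx Num.conj V)) = jdiag V (map_mx Num.conj V).
  rewrite jdiag_conj; congr jdiag.
  by apply/matrixP => i j; rewrite !mxE conjCK.
have Ur : jdiag V (map_mx Num.conj V) \is a mxOver Num.real.
  exact/mxOver_realP.
split; [exact: Ur| |exact: UJ]; have /unitarymxP <- := Uu; congr (_ *m _).
by rewrite -[LHS]trmxK -{1}Uc -map_trmx trmxK.
Qed.

(** One function for each entry of the two matrix equations of the group, written with the
    operations for which [cmeasurable] is known to be stable. The group is their common zero set,
    hence measurable. *)
Definition comm_eqs (t : bool * 'I_(l + l) * 'I_(l + l)) (U : M) : C :=
  let: (b, i, j) := t in
  if b then \sum_k U i k * (U j k)^* + - (1%:M : M) i j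
  else \sum_k (U i k * J k j + - 1 * (J i k * U k j)).

Lemma comm_eqsP U : (forall t, comm_eqs t U = 0) <-> UU_group R l U.
Proof.
split=> [H|[/unitarymxP Uu UJ] [[[] i] j] /=].
- split.
    apply/unitarymxP/matrixP => i j; have /= /eqP := H (true, i, j).
    rewrite subr_eq0 => /eqP <-; rewrite mxE; apply: eq_bigr => k _; by rewrite !mxE.
  apply/matrixP => i j; have /= /eqP := H (false, i, j).
  by rewrite big_split -mulr_sumr mulN1r subr_eq0 !mxE => /eqP.
- rewrite -Uu mxE; apply/eqP; rewrite subr_eq0; apply/eqP/eq_bigr => k _; by rewrite !mxE.
- rewrite big_split -mulr_sumr mulN1r; apply/eqP; rewrite subr_eq0.
  by move/matrixP/(_ i j): UJ; rewrite !mxE => ->.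
Qed.

Lemma cmeasurable_comm_eqs t : cmeasurable setT (comm_eqs t).
Proof.
case: t => [[[] i] j] /=.
  apply: cmeasurableD; last exact: cmeasurable_cst.
  apply: cmeasurable_sum => k; apply: cmeasurableM; first exact: cmeasurable_entry.
  by apply: cmeasurable_conj; apply: cmeasurable_entry.
apply: cmeasurable_sum => k; apply: cmeasurableD.
  by apply: cmeasurableM; [exact: cmeasurable_entry|exact: cmeasurable_cst].
apply: cmeasurableM; first exact: cmeasurable_cst.
by apply: cmeasurableM; [exact: cmeasurable_cst|exact: cmeasurable_entry].
Qed.

Lemma measurable_UU : measurable (UU_group R l : set (borel_mx R (l + l))).
Proof.
rewrite (_ : UU_group R l = [set U | forall t, comm_eqs t U = 0]).
  exact: measurable_zeros cmeasurable_comm_eqs.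
by apply/seteqP; split=> U /comm_eqsP.
Qed.

Lemma UuE U : Uu_group R l U <-> UU_group R l U /\ forall ij, U ij.1 ij.2 + - 1 * (U ij.1 ij.2)^* = 0.
Proof.
split=> [UG|[[Uu UJ] Ur]].
  split=> [|ij]; first exact: Uu_UU.
  have [Ur _ _] := UG; apply/eqP; rewrite mulN1r subr_eq0 eq_sym; apply/eqP/CrealP/mxOverP.
  exact: Ur.
have Uc i j : (U i j)^* = U i j.
  by apply/eqP; rewrite eq_sym -subr_eq0 -mulN1r; apply/eqP; apply: (Ur (i, j)).
split=> //; first by apply/mxOverP => i j; apply/CrealP.
rewrite -(unitarymxP Uu); congr (_ *m _); apply/matrixP => i j; by rewrite !mxE Uc.
Qed.

Lemma measurable_Uu : measurable (Uu_group R l : set (borel_mx R (l + l))).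
Proof.
rewrite (_ : Uu_group R l = UU_group R l `&`
  [set U : M | forall ij, U ij.1 ij.2 + - 1 * (U ij.1 ij.2)^* = 0]).
  apply: measurableI measurable_UU _.
  apply: (@measurable_zeros _ _ _ (fun (ij : 'I_(l + l) * 'I_(l + l)) (U : M) =>
    U ij.1 ij.2 + - 1 * (U ij.1 ij.2)^*)) => ij.
  apply: cmeasurableD; first exact: cmeasurable_entry.
  apply: cmeasurableM; first exact: cmeasurable_cst.
  by apply: cmeasurable_conj; apply: cmeasurable_entry.
by apply/seteqP; split=> U /UuE.
Qed.

Lemma unitarymx_1 n : (1%:M : 'M[C]_n) \is unitarymx.
Proof. by apply/unitarymxP; rewrite trmx1 map_mx1 mul1mx. Qed.

Lemma UU_mul A B : UU_group R l A -> UU_group R l B -> UU_group R l (A *m B).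
Proof.
move=> [Au AJ] [Bu BJ]; split; first exact: mul_unitarymx.
by rewrite -mulmxA BJ !mulmxA AJ.
Qed.

Lemma UU_adjoint A : UU_group R l A -> UU_group R l (A ^t*)%sesqui.
Proof.
move=> /UU_jpart[V1u V2u <-]; rewrite jdiag_adjoint.
by apply: UU_jdiag; rewrite trmxC_unitary.
Qed.

Lemma unitary_cancel (A U : M) : A \is unitarymx -> (A ^t*)%sesqui *m (A *m U) = U.
Proof. by move=> /unitarymxP AA; rewrite mulmxA (mulmx1C AA) mul1mx. Qed.

Lemma UU_cancel A U : UU_group R l A -> UU_group R l (A *m U) -> UU_group R l U.
Proof.
move=> GA GAU; rewrite -(unitary_cancel U GA.1); apply: UU_mul GAU.
exact: UU_adjoint.
Qed.

Lemma Uu_mul A B : Uu_group R l A -> Uu_group R l B -> Uu_group R l (A *m B).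
Proof.
move=> [Ar AA AJ] [Br BB BJ]; split.
- by apply/mxOver_realP; rewrite map_mxM (mxOver_realP _ Ar) (mxOver_realP _ Br).
- by rewrite trmx_mul mulmxA -(mulmxA A) BB mulmx1.
- by rewrite -mulmxA BJ !mulmxA AJ.
Qed.

Lemma Uu_cancel A U : Uu_group R l A -> Uu_group R l (A *m U) -> Uu_group R l U.
Proof.
move=> GA GAU; rewrite -(unitary_cancel U (Uu_UU GA).1); apply: Uu_mul GAU.
have [V1u _ UE] := UU_jpart (Uu_UU GA); rewrite -UE (Uu_jpart GA) jdiag_adjoint.
by rewrite -map_trmx; apply: Uu_jdiag; rewrite trmx_unitary conjC_unitary.
Qed.

Lemma tame_jpart (G : set M) i j : (forall U, G U -> U \is unitarymx) ->
  tame G (fun U => jpart1 U i j) /\ tame G (fun U => jpart2 U i j).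
Proof.
by move=> Gu; split; apply: (tame_ext (tame_mulmx_entry _ _ _ _ Gu)) => U _; rewrite !mxE.
Qed.

Variable mu : probability (borel_mx R (l + l)) R.

(** Left multiplication by [jdiag g 1%:M] moves the first coordinate and fixes the second, so a
    function of the second may serve as weight. *)
Lemma haar_functional_UU1 (h : 'M[C]_l -> C) : is_haar (UU_group R l) mu -> polyfun h ->
  haar_functional (fun f : 'M[C]_l -> C =>
    cint (UU_group R l) mu (fun U => f (jpart1 U) * h (jpart2 U))).
Proof.
move=> hmu ph; have Gu U : UU_group R l U -> U \is unitarymx by case.
have W1 g : g \is unitarymx -> UU_group R l (jdiag g 1%:M).
  by move=> gu; apply: UU_jdiag; rewrite ?gu ?unitarymx_1.
apply: (@haar_functional_cint _ _ _ _ Gu measurable_UU hmu l (@jpart1 C l)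
  (fun g => jdiag g 1%:M) (fun U => h (jpart2 U))).
- by move=> i j; have [] := tame_jpart i j Gu.
- by move=> U /UU_jpart[].
- apply: tame_comp ph => [i j|U /UU_jpart[] //]; by have [] := tame_jpart i j Gu.
- exact: W1.
- move=> g U gu GU; have [V1u V2u UE] := UU_jpart GU.
  have -> : jdiag g 1%:M *m U = jdiag (g *m jpart1 U) (jpart2 U).
    by rewrite -[in LHS]UE jdiagM mul1mx.
  rewrite jpart1K jpart2K; split; [|reflexivity|reflexivity].
  by apply: UU_jdiag V2u; apply: mul_unitarymx.
- by move=> g U gu; apply: UU_cancel; apply: W1.
Qed.

Lemma haar_functional_UU2 : is_haar (UU_group R l) mu ->
  haar_functional (fun f : 'M[C]_l -> C =>
    cint (UU_group R l) mu (fun U => f (jpart2 U) * 1)).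
Proof.
move=> hmu; have Gu U : UU_group R l U -> U \is unitarymx by case.
have W1 g : g \is unitarymx -> UU_group R l (jdiag 1%:M g).
  by move=> gu; apply: UU_jdiag; rewrite ?gu ?unitarymx_1.
apply: (@haar_functional_cint _ _ _ _ Gu measurable_UU hmu l (@jpart2 C l)
  (fun g => jdiag 1%:M g) (fun=> 1)).
- by move=> i j; have [] := tame_jpart i j Gu.
- by move=> U /UU_jpart[].
- exact: tame_cst.
- exact: W1.
- move=> g U gu GU; have [V1u V2u UE] := UU_jpart GU.
  have -> : jdiag 1%:M g *m U = jdiag (jpart1 U) (g *m jpart2 U).
    by rewrite -[in LHS]UE jdiagM mul1mx.
  rewrite jpart2K; split; [|reflexivity|reflexivity].
  by apply: UU_jdiag V1u _; apply: mul_unitarymx.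
- by move=> g U gu; apply: UU_cancel; apply: W1.
Qed.

Lemma haar_functional_Uu : is_haar (Uu_group R l) mu ->
  haar_functional (fun f : 'M[C]_l -> C =>
    cint (Uu_group R l) mu (fun U => f (jpart1 U) * 1)).
Proof.
move=> hmu; have Gu U : Uu_group R l U -> U \is unitarymx by move=> /Uu_UU[].
apply: (@haar_functional_cint _ _ _ _ Gu measurable_Uu hmu l (@jpart1 C l)
  (fun g => jdiag g (map_mx Num.conj g)) (fun=> 1)).
- by move=> i j; have [] := tame_jpart i j Gu.
- by move=> U /Uu_UU/UU_jpart[].
- exact: tame_cst.
- exact: Uu_jdiag.
- move=> g U gu GU; have [V1u V2u UE] := UU_jpart (Uu_UU GU).
  split; [by apply: Uu_mul GU; apply: Uu_jdiag| |reflexivity].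
  by rewrite -[in LHS]UE jdiagM jpart1K.
- by move=> g U gu; apply: Uu_cancel; apply: Uu_jdiag.
Qed.

End Groups.

(** * Coefficientwise assembly of the two identities *)

Lemma fps_has_sum_list (C : comNzRingType) (K : Type) (P : set (seq nat))
    (F : seq nat -> K -> C) (S : K -> C) :
  (forall a, exists L : seq (seq nat), [/\ uniq L, {in L, forall la, P la},
     forall la, P la -> F la a <> 0 -> la \in L & \sum_(la <- L) F la a = S a]) ->
  fps_has_sum P F S.
Proof.
move=> H a; have [L [uL LP PL <-]] := H a; split.
  apply: sub_finite_set (finite_seq L) => la [Pla /PL]; exact.
rewrite (fsbig_seq _ _ uL); apply: esym; apply: fsbig_widen => //.
move=> la [/= Pla laL]; apply: contra_notP laL; exact: PL.
Qed.

Section HaarSeries.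
Variables (R : realType) (l : nat).
Local Notation C := (Cplx R).
Local Notation s := (schur C).

Lemma cint_sum (n : nat) (G : set 'M[C]_n) (mu : probability (borel_mx R n) R)
    (I : Type) (r : seq I) (F : I -> 'M[C]_n -> C) :
  measurable (G : set (borel_mx R n)) -> is_haar G mu ->
  (forall i, tame G (F i)) ->
  cint G mu (fun U => \sum_(i <- r) F i U) = \sum_(i <- r) cint G mu (F i).
Proof.
move=> mG hmu Ft; have [sumE _] : cint G mu (fun U => \sum_(i <- r) F i U) =
    \sum_(i <- r) cint G mu (F i) /\ tame G (fun U => \sum_(i <- r) F i U).
  elim: r => [|i r [IHr tr]].
    have E U : G U -> 0 = \sum_(i <- [::]) F i U by rewrite big_nil.
    rewrite -(cint_ext mu E) cint_cst // big_nil; split=> //.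
    exact: tame_ext (tame_cst G 0) E.
  have E U : G U -> F i U + \sum_(i <- r) F i U = \sum_(i <- i :: r) F i U by rewrite big_cons.
  rewrite -(cint_ext mu E) big_cons cintD // IHr; split=> //.
  exact: tame_ext (tame_add (Ft i) tr) E.
exact: sumE.
Qed.

(** The second coordinate is the conjugate of the first, so a splitting (b, c) of the monomial
    contributes det H at b times the conjugate of det H at c: a single use of orthogonality on
    U(l). *)
Lemma expect_Uu (mu : probability (borel_mx R (l + l)) R) (a : monom) N d :
  forall (aN : forall j, (N <= j)%N -> a j = 0%N) (ad : forall j, (a j <= d)%N),
  is_haar (Uu_group R l) mu ->
  expect_fps (Uu_group R l) mu (fun U => detH U) a =
  \sum_(la <- parts_upto l (degree a)) \sum_(bc <- splits a N d) s la bc.1 * s la bc.2.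
Proof.
move=> aN ad hmu; rewrite -[LHS]/(cint (Uu_group R l) mu (fun U => detH U a)).
pose f bc (V : 'M[C]_l) := detH V bc.1 * (detH V bc.2)^*.
have pf bc : polyfun (f bc) := @polyfun_detH_conj C l _ _.
have Gu U : Uu_group R l U -> U \is unitarymx by move=> /Uu_UU[].
have ft bc : tame (Uu_group R l) (fun U => f bc (jpart1 U) * 1).
  apply: tame_mul _ (tame_cst _ 1); apply: tame_comp (pf bc).
    by move=> i j; have [] := tame_jpart i j Gu.
  by move=> U /Uu_UU/UU_jpart[].
rewrite (@cint_ext _ _ _ _ _ (fun U => \sum_(bc <- splits a N d) f bc (jpart1 U) * 1)).
  rewrite (cint_sum _ (@measurable_Uu R l) hmu ft) exchange_big /=.
  rewrite big_seq [RHS]big_seq; apply: eq_bigr => -[b c] /mem_splits-/(_ aN ad)/degree_split[ba ca].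
  rewrite (haar_schur_orthogonality (haar_functional_Uu hmu) ba ca) /=.
  by rewrite (cint_cst (@measurable_Uu R l) hmu) mulr1 mul1r.
move=> U UG; have [V1u V2u UE] := UU_jpart (Uu_UU UG).
rewrite -{1}UE (detH_mul aN ad (fun k => inv_det_coef_jdiag k V1u V2u)).
by apply: eq_bigr => bc _; rewrite (Uu_jpart UG) detH_conj mulr1.
Qed.

Lemma expect_UU (mu : probability (borel_mx R (l + l)) R) (a b : monom) N d e :
  forall (aN : forall j, (N <= j)%N -> a j = 0%N) (ad : forall j, (a j <= d)%N)
  (bN : forall j, (N <= j)%N -> b j = 0%N) (bd : forall j, (b j <= d)%N),
  (degree a <= e)%N -> (degree b <= e)%N ->
  is_haar (UU_group R l) mu ->
  expect_fps (UU_group R l) mu (fun U => fps_xy (detH U) (detH (U ^t*)%sesqui)) (a, b) =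
  \sum_(la <- parts_upto l e) \sum_(nu <- parts_upto l e)
    (\sum_(bc <- splits a N d) s la bc.1 * s nu bc.2) *
    (\sum_(bc <- splits b N d) s la bc.1 * s nu bc.2).
Proof.
move=> aN ad bN bd ae be hmu.
rewrite -[LHS]/(cint (UU_group R l) mu (fun U => detH U a * detH (U ^t*)%sesqui b)).
pose f x y (V : 'M[C]_l) := detH V x * (detH V y)^*.
have pf x y : polyfun (f x y) := @polyfun_detH_conj C l _ _.
have Gu U : UU_group R l U -> U \is unitarymx by case.
have ft x y : tame (UU_group R l) (fun U => f x.1 y.1 (jpart1 U) * f x.2 y.2 (jpart2 U)).
  apply: tame_mul; apply: tame_comp (pf _ _).
  - by move=> i j; have [] := tame_jpart i j Gu.
  - by move=> U /UU_jpart[].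
  - by move=> i j; have [] := tame_jpart i j Gu.
  - by move=> U /UU_jpart[].
rewrite (@cint_ext _ _ _ _ _ (fun U => \sum_(x <- splits a N d) \sum_(y <- splits b N d)
    f x.1 y.1 (jpart1 U) * f x.2 y.2 (jpart2 U))); last first.
  move=> U UG; have [V1u V2u UE] := UU_jpart UG.
  rewrite -{1 2}UE detH_adjoint (detH_mul aN ad (fun k => inv_det_coef_jdiag k V1u V2u)).
  rewrite (detH_mul bN bd (fun k => inv_det_coef_jdiag k V1u V2u)) rmorph_sum big_distrlr /=.
  by apply: eq_bigr => x _; apply: eq_bigr => y _; rewrite rmorphM mulrACA.
rewrite (cint_sum _ (@measurable_UU R l) hmu); last by move=> x; apply: tame_sum.
transitivity (\sum_(x <- splits a N d) \sum_(y <- splits b N d)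
  (\sum_(la <- parts_upto l e) s la x.1 * s la y.1) *
  (\sum_(nu <- parts_upto l e) s nu x.2 * s nu y.2)).
  rewrite big_seq [RHS]big_seq; apply: eq_bigr => -[x1 x2] /mem_splits-/(_ aN ad)/degree_split[x1a x2a].
  rewrite (cint_sum _ (@measurable_UU R l) hmu) //.
  rewrite big_seq [RHS]big_seq; apply: eq_bigr => -[y1 y2] /mem_splits-/(_ bN bd)/degree_split[y1b y2b].
  (* The first coordinate is integrated with a function of the second as weight. The factor T 1 is
     then the integral of this weight, to which orthogonality applies once more. *)
  rewrite (haar_schur_orthogonality (haar_functional_UU1 hmu (pf x2 y2))
    (leq_trans x1a ae) (leq_trans y1b be)) /= mulrC; congr (_ * _).
  rewrite -[RHS]mul1r -[1 in RHS](cint_cst (@measurable_UU R l) hmu).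
  under cint_ext => U _ do rewrite mul1r -[f _ _ _]mulr1.
  rewrite (haar_schur_orthogonality (haar_functional_UU2 hmu)
    (leq_trans x2a ae) (leq_trans y2b be)) /=; congr (_ * _).
  by apply: cint_ext => U _; rewrite mulr1.
transitivity (\sum_(x <- splits a N d) \sum_(y <- splits b N d)
  \sum_(la <- parts_upto l e) \sum_(nu <- parts_upto l e)
    (s la x.1 * s nu x.2) * (s la y.1 * s nu y.2)).
  apply: eq_bigr => x _; apply: eq_bigr => y _; rewrite big_distrlr /=.
  by apply: eq_bigr => la _; apply: eq_bigr => nu _; rewrite mulrACA.
under eq_bigr do rewrite exchange_big /=.
rewrite exchange_big /=; apply: eq_bigr => la _.
under eq_bigr do rewrite exchange_big /=.
by rewrite exchange_big /=; apply: eq_bigr => nu _; rewrite big_distrlr.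
Qed.

End HaarSeries.

Lemma fps_mul_neq0 (C : comNzRingType) (f g : monom -> C) (a : monom) : fps_mul f g a <> 0 ->
  exists b c, [/\ (degree b <= degree a)%N, (degree c <= degree a)%N, f b <> 0 & g c <> 0].
Proof.
have [N aN] := monom_bound a; rewrite (fps_mulE aN (monom_le_degree a)) => H.
apply: contrapT => nex; apply: H; rewrite big_seq big1 // => -[b c].
move=> /mem_splits-/(_ aN (monom_le_degree a))/degree_split[ba ca] /=.
have [->|/eqP fb] := eqVneq (f b) 0; first by rewrite mul0r.
have [->|/eqP gc] := eqVneq (g c) 0; first by rewrite mulr0.
by case: nex; exists b, c.
Qed.

Lemma schur_parts_upto (C : comNzRingType) n la a e : is_part la -> (size la <= n)%N ->
  (degree a <= e)%N -> schur C la a <> 0 -> la \in parts_upto n e.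
Proof.
move=> pla sla ae /schur_degree - /(_ pla) E; apply/mem_parts_upto; split=> // i.
by apply: leq_trans (nth_sumn la i) _; rewrite E.
Qed.

Theorem corollary5p3 (R : realType) (l : nat) :
  (forall mu : probability (borel_mx R (l + l)) R,
     is_haar (UU_group R l) mu ->
     fps_has_sum [set la | is_part la /\ (size la <= 2 * l)%N]
       (fun la => fps_xy (schur_tilde (Cplx R) la) (schur_tilde (Cplx R) la))
       (expect_fps (UU_group R l) mu
          (fun U => fps_xy (detH U) (detH (U ^t*)%sesqui)))) /\
  (forall mu : probability (borel_mx R (l + l)) R,
     is_haar (Uu_group R l) mu ->
     fps_has_sum [set la | is_part la /\ (size la <= l)%N]
       (fun la => schur_tilde (Cplx R) (dbl_part la))
       (expect_fps (Uu_group R l) mu (fun U => detH U))).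
Proof.
split=> mu hmu; apply: fps_has_sum_list.
- move=> [a b]; have [N1 aN1] := monom_bound a; have [N2 bN2] := monom_bound b.
  pose N := maxn N1 N2; pose e := maxn (degree a) (degree b).
  have aN j : (N <= j)%N -> a j = 0%N by rewrite geq_max => /andP[/aN1].
  have bN j : (N <= j)%N -> b j = 0%N by rewrite geq_max => /andP[_ /bN2].
  have ae : (degree a <= e)%N := leq_maxl _ _.
  have be : (degree b <= e)%N := leq_maxr _ _.
  have ad j : (a j <= e)%N := leq_trans (monom_le_degree a j) ae.
  have bd j : (b j <= e)%N := leq_trans (monom_le_degree b j) be.
  (* Schur functions are homogeneous of degree the sum of the parts, so a partition contributes at
     (a, b) only if the parts of both its quotients are at most e. *)
  exists [seq unquotient l la nu | la <- parts_upto l e, nu <- parts_upto l e]; split.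
  + apply: allpairs_uniq; [exact: uniq_parts_upto|exact: uniq_parts_upto|].
    move=> [x1 x2] [y1 y2] /allpairsP[[u1 u2] /= [/mem_parts_upto[p1 s1 _] /mem_parts_upto[p2 s2 _] [-> ->]]].
    move=> /allpairsP[[v1 v2] /= [/mem_parts_upto[q1 t1 _] /mem_parts_upto[q2 t2 _] [-> ->]]] /= E.
    have [_ _ _ E1 E2] := unquotientP p1 s1 p2 s2.
    have [_ _ _ E3 E4] := unquotientP q1 t1 q2 t2.
    by congr (_, _); [rewrite -E1 E E3|rewrite -E2 E E4].
  + move=> _ /allpairsP[[la nu] /= [/mem_parts_upto[p1 s1 _] /mem_parts_upto[p2 s2 _] ->]].
    by have [pa sa _ _ _] := unquotientP p1 s1 p2 s2; split; rewrite // mul2n.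
  + move=> la [pla]; rewrite mul2n => sla nz.
    have : schur_tilde (Cplx R) la a <> 0 by move=> z; apply: nz; rewrite /fps_xy /= z mul0r.
    rewrite /schur_tilde; case: eqP => // core0 /fps_mul_neq0[b1 [b2 [b1a b2a z1 z2]]].
    have [p0 s0 p1 s1 <-] := two_quotientP pla sla core0.
    apply: allpairs_f; first exact: (schur_parts_upto p0 s0 (leq_trans b1a ae) z1).
    exact: (schur_parts_upto p1 s1 (leq_trans b2a ae) z2).
  + rewrite (expect_UU aN ad bN bd ae be hmu) big_allpairs_dep /=.
    rewrite big_seq [RHS]big_seq; apply: eq_bigr => la /mem_parts_upto[p1 s1 _].
    rewrite big_seq [RHS]big_seq; apply: eq_bigr => nu /mem_parts_upto[p2 s2 _].
    have [_ _ core0 q0 q1] := unquotientP p1 s1 p2 s2.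
    by rewrite /fps_xy /schur_tilde core0 eqxx q0 q1 (fps_mulE aN ad) (fps_mulE bN bd).
- move=> a; have [N aN] := monom_bound a.
  have tildeE la : is_part la -> schur_tilde (Cplx R) (dbl_part la) =
      fps_mul (schur (Cplx R) la) (schur (Cplx R) la).
    by move=> pla; have [core0 q] := dbl_part_quotient pla; rewrite /schur_tilde core0 eqxx !q.
  exists (parts_upto l (degree a)); split.
  + exact: uniq_parts_upto.
  + by move=> la /mem_parts_upto[].
  + move=> la [pla sla]; rewrite tildeE // => /fps_mul_neq0[b [c [ba _ z _]]].
    exact: (schur_parts_upto pla sla ba z).
  + rewrite (expect_Uu aN (monom_le_degree a) hmu).
    rewrite big_seq [RHS]big_seq; apply: eq_bigr => la /mem_parts_upto[pla _ _].
    by rewrite tildeE // (fps_mulE aN (monom_le_degree a)).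
Qed.
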